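(* Let $T>0$, $x_0\in\mathbb{R}$, $\alpha>0$, and let $\phi$ be a numerical scheme that is well defined and local. For coefficients $\mu,\sigma:\mathbb{R}\to\mathbb{R}$, let $X$ be the solution of $dX_t=\mu(X_t)\,dt+\sigma(X_t)\,dW_t$, $X_0=x_0$, and let $X^n$ be the $n$-th numerical solution on $[0,T]$ produced by $\phi$ for this SDE. Consider the property (convergence in probability, uniformly on $[0,T]$, with order $\alpha$) $$\text{(P)}\qquad \forall\, C>0:\quad \mathbb{P}\Big(n^{\alpha}\sup_{0\le t\le T}|X^n_t-X_t|>C\Big)\to 0\quad\text{as } n\to\infty .$$ If (P) holds whenever $\mu,\sigma$ are globally Lipschitz, then (P) also holds when the globally Lipschitz condition is replaced with the conditions that $\mu,\sigma$ are locally Lipschitz and the solution $X$ has no finite time explosion.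
   Context: $W$ is a one-dimensional standard Brownian motion and $x_0$ is non-random. A function is locally Lipschitz if it is Lipschitz on every compact set. ''No finite time explosion'' means that almost surely the solution $X$ does not reach $\pm\infty$ in finite time; $X=X(x_0,\mu,\sigma,W)$ is the unique strong solution of the SDE. A numerical scheme $\phi$ associates with the data $(x_0,\mu,\sigma,W)$ a sequence of approximating real-valued processes $X^n=X^{\phi,n}(x_0,\mu,\sigma,W)$, $n\ge1$, on $[0,T]$; the same Brownian motion $W$ is used for every $n$ and for the solution $X$. ''Well defined'' means that these processes exist for the coefficients considered. For a process $Z$ put $\mathbb{T}^m(Z)=\inf\{t\ge0:|Z_t|>m\}$, and let $Z^{\tau}$ denote the process $Z$ stopped at time $\tau$. The scheme $\phi$ is called local if the following holds: whenever $|x_0|<m$ and $\mu=\tilde\mu$, $\sigma=\tilde\sigma$ on $[-m,m]$, then for all $n$, with $\tau=\mathbb{T}^m(X^{\phi,n}(x_0,\mu,\sigma,W))$, $$(X^{\phi,n}(x_0,\mu,\sigma,W))^{\tau}=(X^{\phi,n}(x_0,\tilde\mu,\tilde\sigma,W))^{\tau}\quad\text{almost surely};$$ in particular $\mathbb{T}^m(X^{\phi,n}(x_0,\mu,\sigma,W))=\mathbb{T}^m(X^{\phi,n}(x_0,\tilde\mu,\tilde\sigma,W))$ a.s. *)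

(* Defs.v *)
From HB Require Import structures.
From mathcomp Require Import all_boot all_order all_algebra.
From mathcomp Require Import all_classical all_reals all_analysis.
From mathcomp Require Import measurable_realfun.

Set Implicit Arguments.
Unset Strict Implicit.
Unset Printing Implicit Defensive.

Import Order.TTheory GRing.Theory Num.Theory.
Import numFieldNormedType.Exports.

Local Open Scope classical_set_scope.
Local Open Scope ring_scope.

Definition globally_lipschitz (R : realType) (f : R -> R) : Prop :=
  [lipschitz f x | x in [set: R]].

Definition locally_lipschitz (R : realType) (f : R -> R) : Prop :=
  forall K : set R, compact K -> [lipschitz f x | x in K].

(* A real time-indexed process is a function R -> Omega -> S; only its values
   at nonnegative times (resp. times in [0, T]) are ever used. *)
Section Processes.
Context {d : measure_display} {Omega : measurableType d} {R : realType}.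
Variable P : probability Omega R.

Definition natural_filtration (W : R -> Omega -> R) (t : R) : set (set Omega) :=
  <<s [set A | exists (s : R) (B : set R),
                          [/\ 0 <= s <= t, measurable B &
                              A = W s @^-1` B]] >>.

(* Usual augmentation by the null events. *)
Definition augmented_filtration (W : R -> Omega -> R) (t : R) :
    set (set Omega) :=
  <<s natural_filtration W t `|` [set N | measurable N /\ P N = 0%E] >>.

Definition increment_event (W : R -> Omega -> R) (s t : R) (B : set R) :
    set Omega :=
  [set w | B (W t w - W s w)].

Record brownian_motion (W : R -> Omega -> R) : Prop := BrownianMotion {
  brownian_measurable : forall t : R, 0 <= t -> measurable_fun setT (W t) ;
  brownian_start : {ae P, forall w, W 0 w = 0} ;
  brownian_continuous :
    {ae P, forall w, {within `[0, +oo[, continuous (W ^~ w)}} ;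
  brownian_normal : forall (s t : R) (B : set R),
    0 <= s -> s < t -> measurable B ->
    P (increment_event W s t B) = normal_prob 0 (Num.sqrt (t - s)) B ;
  brownian_indep : forall (s t : R) (A : set Omega) (B : set R),
    0 <= s -> s < t -> natural_filtration W s A -> measurable B ->
    P (A `&` increment_event W s t B) =
      (P A * P (increment_event W s t B))%E }.

Definition adapted {d' : measure_display} {S : measurableType d'}
    (F : R -> set (set Omega)) (X : R -> Omega -> S) : Prop :=
  forall t : R, 0 <= t -> forall B : set S, measurable B -> F t (X t @^-1` B).

(* Convergence to 0 in probability. It is stated with the outer measure of P,
   which is P itself on events, so that no measurability of Y k is presupposed
   (e.g. of a supremum over an uncountable set of times). *)
Definition cvg_to_0_in_probability (Y : nat -> Omega -> \bar R) : Prop :=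
  forall C : R, 0 < C ->
    ((P^*)%mu [set w | C%:E < Y k w]%E) @[k --> \oo] --> (0 : \bar R).

(* The simple process \sum_i xi_i 1_{]t_i, t_{i+1}]}. *)
Record simple_process (F : R -> set (set Omega)) := SimpleProcess {
  simple_size : nat ;
  simple_time : nat -> R ;
  simple_coef : nat -> Omega -> R ;
  simple_time_ge0 : 0 <= simple_time 0%N ;
  simple_time_le : forall i, simple_time i <= simple_time i.+1 ;
  simple_coef_measurable : forall i (B : set R), measurable B ->
    F (simple_time i) (simple_coef i @^-1` B) ;
  simple_coef_bounded : forall i, exists M : R,
    forall w, `|simple_coef i w| <= M }.

Definition simple_value F (H : simple_process F) (s : R) (w : Omega) : R :=
  \sum_(i < simple_size H) simple_coef H i w *
    \1_(`]simple_time H i, simple_time H i.+1] : set R) s.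

Definition simple_integral (W : R -> Omega -> R) F (H : simple_process F)
    (t : R) (w : Omega) : R :=
  \sum_(i < simple_size H) simple_coef H i w *
    (W (Num.min (simple_time H i.+1) t) w - W (Num.min (simple_time H i) t) w).

(* J is the Ito integral of H dW over [0, t]: the limit in probability of the
   integrals of simple processes H' k approximating H in the sense that
   \int_0^t (H' k - H)^2 ds tends to 0 in probability. This determines J up to
   almost sure equality. The integrand H is meant to have almost surely
   measurable paths. *)
Definition is_ito_integral (W : R -> Omega -> R) (H : R -> Omega -> R)
    (t : R) (J : Omega -> R) : Prop :=
  exists H' : nat -> simple_process (augmented_filtration W),
    cvg_to_0_in_probability (fun k w =>
      (\int[lebesgue_measure]_(s in `[0%R, t])
        ((simple_value (H' k) s w - H s w) ^+ 2)%:E)%E) /\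
    cvg_to_0_in_probability (fun k w =>
      `|simple_integral W (H' k) t w - J w|%:E).

(* First time in D at which Q holds (+oo if there is none). *)
Definition first_time (D : set R) (Q : R -> Prop) : \bar R :=
  ereal_inf [set t%:E | t in D `&` Q].

(* The value at time t of the path z stopped at tau. *)
Definition stopped {S : Type} (z : R -> S) (tau : \bar R) (t : R) : S :=
  z (fine (Order.min t%:E tau)).

Definition exit_time (X : R -> Omega -> \bar R) (m : nat) (w : Omega) : \bar R :=
  first_time [set t | 0 <= t] (fun t => m%:R%:E <= `|X t w|)%E.

(* X is the strong solution, up to its explosion time, of
   dX = mu(X) dt + sigma(X) dW, X_0 = x0: a process with values in the extended
   reals, adapted to the augmented filtration of W, continuous, constant once
   it has reached +oo or -oo, and such that, for every m, S_m being the first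
   time when |X| >= m,
   X_{t /\ S_m} = x0 + \int_0^t mu(X_s) 1_{s <= S_m} ds
                     + \int_0^t sigma(X_s) 1_{s <= S_m} dW_s  a.s.
   (X_s is finite when s <= S_m, so fine (X s w) is X_s.) *)
Record strong_solution (x0 : R) (mu sigma : R -> R) (W : R -> Omega -> R)
    (X : R -> Omega -> \bar R) : Prop := StrongSolution {
  solution_adapted : adapted (augmented_filtration W) X ;
  solution_start : {ae P, forall w, X 0 w = x0%:E} ;
  solution_continuous :
    {ae P, forall w, {within `[0, +oo[, continuous (X ^~ w)}} ;
  solution_absorbed : {ae P, forall w, forall s t : R, 0 <= s -> s <= t ->
    X s w \isn't a fin_num -> X t w = X s w} ;
  solution_equation : forall (m : nat) (t : R), 0 <= t ->
    let before_exit s w : R := (s%:E <= exit_time X m w)%E%:R in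
    exists2 J : Omega -> R,
      is_ito_integral W
        (fun s w => sigma (fine (X s w)) * before_exit s w) t J &
      {ae P, forall w, stopped (X ^~ w) (exit_time X m w) t =
        (x0 + \int[lebesgue_measure]_(s in `[0%R, t])
                (mu (fine (X s w)) * before_exit s w)
            + J w)%:E} }.

Definition no_explosion (X : R -> Omega -> \bar R) : Prop :=
  {ae P, forall w, forall t : R, 0 <= t -> X t w \is a fin_num}.

(* The coefficients considered: those for which convergence is assumed or
   claimed. *)
Definition considered (W : R -> Omega -> R) (x0 : R) (mu sigma : R -> R) : Prop :=
  (globally_lipschitz mu /\ globally_lipschitz sigma) \/
  [/\ locally_lipschitz mu, locally_lipschitz sigma &
      exists2 X, strong_solution x0 mu sigma W X & no_explosion X].

End Processes.

(* phi x0 mu sigma W n t w is the value at time t of the n-th approximation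
   (n >= 1). Nothing is assumed about phi outside the considered coefficients,
   where its values are irrelevant. *)
Definition numerical_scheme (Omega : Type) (R : realType) : Type :=
  R -> (R -> R) -> (R -> R) -> (R -> Omega -> R) -> nat -> R -> Omega -> R.

Section Schemes.
Context {d : measure_display} {Omega : measurableType d} {R : realType}.
Variables (P : probability Omega R) (T : R) (W : R -> Omega -> R).

Definition well_defined (phi : numerical_scheme Omega R) : Prop :=
  forall x0 mu sigma, considered P W x0 mu sigma ->
  forall (n : nat) (t : R), (0 < n)%N -> 0 <= t <= T ->
    measurable_fun setT (phi x0 mu sigma W n t).

(* T^m(Z), for a process Z indexed by [0, T]. *)
Definition passage_time (Z : R -> Omega -> R) (m : nat) (w : Omega) : \bar R :=
  first_time `[0, T] (fun t => m%:R < `|Z t w|).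

Definition local_scheme (phi : numerical_scheme Omega R) : Prop :=
  forall (x0 : R) (mu sigma mu' sigma' : R -> R) (m : nat),
  considered P W x0 mu sigma -> considered P W x0 mu' sigma' ->
  `|x0| < m%:R ->
  {in `[- m%:R, m%:R], mu =1 mu'} -> {in `[- m%:R, m%:R], sigma =1 sigma'} ->
  forall n, (0 < n)%N ->
    let Z := phi x0 mu sigma W n in
    let Z' := phi x0 mu' sigma' W n in
    {ae P, forall w, let tau := passage_time Z m w in
      forall t : R, 0 <= t <= T ->
        stopped (Z ^~ w) tau t = stopped (Z' ^~ w) tau t}.

(* For all C > 0, P (n^alpha sup_{0 <= t <= T} |Xn n t - X t| > C) --> 0. *)
Definition cvg_with_order (alpha : R) (Xn : nat -> R -> Omega -> R)
    (X : R -> Omega -> \bar R) : Prop :=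
  cvg_to_0_in_probability P (fun n w => ((n%:R `^ alpha)%:E *
    ereal_sup [set `|(Xn n t w)%:E - X t w| | t in `[0%R, T]])%E).

End Schemes.

(* Main.v *)
Require Import Defs.
From HB Require Import structures.
From mathcomp Require Import all_boot all_order all_algebra.
From mathcomp Require Import all_classical all_reals all_analysis.
From mathcomp Require Import measurable_realfun.
From mathcomp Require Import ring lra.
Set Implicit Arguments.
Unset Strict Implicit.
Unset Printing Implicit Defensive.
Import Order.TTheory GRing.Theory Num.Theory.
Import numFieldNormedType.Exports.
Local Open Scope classical_set_scope.
Local Open Scope ring_scope.

(* Localization. Let M be so large that |X| < M - 1 on [0, T] outside an event of small
   probability, and compose mu and sigma with the projection onto [-M, M]. The truncated
   coefficients are globally Lipschitz; suppose that their SDE has a strong solution Y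
   equal to X until X leaves ]-M, M[. Outside a small event Y = X on [0, T] and, for n
   large, the truncated scheme is within 1/2 of Y on [0, T]; it then does not leave
   [-M, M], so that by locality it is the original scheme, and its error is the
   original one.

   Y is obtained by continuing X, which makes uniqueness for the SDE unnecessary: if S is
   the exit time of X from ]-M, M[, then Y_t = X_{t /\ S} + Z_t, where Z vanishes until S
   and solves dZ = mu'(X_S + Z) dt + sigma'(X_S + Z) dW afterwards. Z is the almost sure,
   locally uniform limit of Euler schemes of mesh 16^-n, by a maximal inequality for
   martingale transforms and a Borel-Cantelli argument. The integrands of the schemes then
   converge pathwise, so that their integrals, which converge as well, define the Ito
   integral of the limit without any isometry. *)

(** * Brownian increments *)

(** The hypothesis on [phi] speaks only of actual strong solutions, so one has to be exhibited for
    the truncated coefficients. A solution built from scratch would still have to be identified with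
    X, whereas the continuation agrees with X up to S by construction. The price is that the
    coefficients of Z are random and jump in time at S. As this is the only jump, each scheme feels
    it within a single cell, and its contribution to the mean square error is of order one mesh,
    like that of the Brownian oscillation over a cell. A strong solution must satisfy its equation
    stopped at the exit of Y from every level m. For m <= M this exit comes no later than S and the
    equation is that of X; for m >= M it is the equation of X up to S plus that of Z, whose
    integrands are switched off at the exit of Y. Two schemes are compared at the nodes of an
    auxiliary grid of level N, with bounds that do not depend on N; letting N grow yields a supremum
    over all times. *)

Section Gaussian.
Context {R : realType}.
Implicit Types s : R.
Local Open Scope ereal_scope.

Import HBNNSimple.

(** By monotone convergence along simple functions it suffices to treat indicators, for which this
    is the definition of [normal_prob]. *)
Lemma integral_normal_prob s (f : R -> \bar R) :
  measurable_fun setT f -> (forall x, 0 <= f x) ->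
  \int[normal_prob 0 s]_x f x =
  \int[lebesgue_measure]_x (f x * (normal_pdf 0 s x)%:E).
Proof.
move=> mf f0; pose f_ := nnsfun_approx measurableT mf.
have mpdf : measurable_fun setT (fun x : R => (normal_pdf 0 s x)%:E).
  by apply/measurable_EFinP; exact: measurable_normal_pdf.
have pdf0 x : 0 <= (normal_pdf 0 s x)%:E by rewrite lee_fin normal_pdf_ge0.
have cf x : (f_ n x)%:E @[n --> \oo] --> f x by exact: cvg_nnsfun_approx.
have ndf x : nondecreasing_seq (fun n => (f_ n x)%:E).
  by move=> m n mn; rewrite lee_fin; exact/lefP/nd_nnsfun_approx.
have mf_ n : measurable_fun setT (fun x : R => (f_ n x)%:E).
  exact/measurable_EFinP/measurable_funTS.
have -> : \int[normal_prob 0 s]_x f x =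
    limn (fun n => \int[normal_prob 0 s]_x (f_ n x)%:E).
  rewrite -monotone_convergence//=.
  - by apply: eq_integral => x _; exact/esym/cvg_lim.
  - by move=> n x _; rewrite lee_fin.
have -> : \int[lebesgue_measure]_x (f x * (normal_pdf 0 s x)%:E) =
    limn (fun n => \int[lebesgue_measure]_x ((f_ n x)%:E * (normal_pdf 0 s x)%:E)).
  rewrite -monotone_convergence//=.
  - apply: eq_integral => x _; apply/esym/cvg_lim => //.
    by apply: cvgeZr (cf x).
  - by move=> n; apply: emeasurable_funM => //; exact: mf_.
  - by move=> n x _; rewrite mule_ge0// lee_fin.
  - by move=> x _ m n mn; rewrite lee_wpmul2r//; exact: ndf.
congr (limn _); apply/funext => n.
have mA r : measurable (f_ n @^-1` [set r]) by [].
have mi r : measurable_fun setT (fun x : R => (\1_(f_ n @^-1` [set r]) x)%:E : \bar R).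
  by apply/measurable_EFinP; exact: measurable_indic.
have mri r : measurable_fun setT (fun x : R => (r * \1_(f_ n @^-1` [set r]) x)%:E).
  by under eq_fun do rewrite EFinM; exact: emeasurable_funM.
under eq_integral do rewrite fimfunE -fsumEFin//.
rewrite ge0_integral_fsum//; last first.
  by move=> r x _; rewrite EFinM nnfun_muleindic_ge0.
under [RHS]eq_integral.
  move=> x xD; rewrite fimfunE -fsumEFin// muleC ge0_mule_fsumr; last first.
    by move=> r; rewrite EFinM nnfun_muleindic_ge0.
  over.
rewrite [RHS]ge0_integral_fsum//; last 2 first.
  - by move=> r; apply: emeasurable_funM => //; exact: mri.
  - by move=> r x _; rewrite mule_ge0// EFinM nnfun_muleindic_ge0.
apply: eq_fsbigr => r _.
under [RHS]eq_integral do rewrite EFinM muleCA.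
under eq_integral do rewrite EFinM.
have [r0|r0] := leP 0%R r; last first.
  rewrite preimage_nnfun0// integral0_eq; last first.
    by move=> x ?; rewrite indic0 mule0.
  by rewrite integral0_eq// => x ?; rewrite indic0 !mule0.
rewrite [LHS]ge0_integralZl//; last exact: mi.
rewrite [RHS]ge0_integralZl//; last 2 first.
- by apply: emeasurable_funM => //; exact: mi.
- by move=> x _; rewrite mule_ge0// lee_fin.
congr (_ * _); transitivity (normal_prob 0 s (f_ n @^-1` [set r])).
  by rewrite integral_indic; [congr (normal_prob 0 s _); exact: setIT|exact: measurableT|exact: mA].
rewrite /normal_prob [LHS]integral_mkcond.
apply: eq_integral => x _; rewrite patchE indicE.
by case: ifPn => xA; rewrite ?mule1 ?mule0.
Qed.

Lemma normal_prob_opp s (f : R -> \bar R) : s != 0%R ->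
  measurable_fun setT f -> (forall x, 0 <= f x) ->
  \int[normal_prob 0 s]_x f (- x)%R = \int[normal_prob 0 s]_x f x.
Proof.
move=> s0 mf f0; have mN : measurable_fun setT (-%R : R -> R) by exact: oppr_measurable.
have mpdf : measurable_fun setT (fun x : R => (normal_pdf 0 s x)%:E).
  by apply/measurable_EFinP; exact: measurable_normal_pdf.
rewrite !integral_normal_prob//; last by apply: measurableT_comp mN.
pose g x := f x * (normal_pdf 0 s x)%:E.
transitivity (\int[lebesgue_measure]_x (g \o -%R) x).
  by apply: eq_integral => x _; rewrite /g/= !normal_pdfE// /normal_fun !subr0 sqrrN.
have mg : measurable_fun setT g by exact: emeasurable_funM.
rewrite -(@ge0_integral_pushforward _ _ (measurableTypeR R) (measurableTypeR R) R _ mN lebesgue_measure setT g)//.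
  by apply: eq_measure_integral => A mA _; exact: lebesgue_measureN.
by move=> x _; rewrite mule_ge0// lee_fin normal_pdf_ge0.
Qed.

(** The integrand is dominated pointwise: x^2 times the density of scale s is at most 8 s^2 times
    the density of scale s sqrt 2, whose integral is 1. This avoids an integration by parts, at the
    price of a factor 8 that runs through all later estimates. *)
Lemma normal_prob_square s : (0 < s)%R ->
  \int[normal_prob 0 s]_x (x ^+ 2)%:E <= (8 * s ^+ 2)%:E.
Proof.
move=> s0; have s1 : (s != 0)%R by rewrite gt_eqF.
rewrite integral_normal_prob//=; last 2 first.
- by apply/measurable_EFinP; exact: exprn_measurable.
- by move=> x; rewrite lee_fin sqr_ge0.
pose s' : R := (s * Num.sqrt 2)%R.
have s'0 : (0 < s')%R by rewrite mulr_gt0// sqrtr_gt0.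
have s'1 : (s' != 0)%R by rewrite gt_eqF.
have mpdf (r : R) : measurable_fun setT (fun x : R => (normal_pdf 0 r x)%:E).
  by apply/measurable_EFinP; exact: measurable_normal_pdf.
apply: (@le_trans _ _ (\int[lebesgue_measure]_x ((8 * s ^+ 2)%:E * (normal_pdf 0 s' x)%:E))).
  apply: ge0_le_integral => //=.
  - by move=> x _; rewrite -EFinM lee_fin mulr_ge0 ?sqr_ge0 ?normal_pdf_ge0.
  - apply: emeasurable_funM; last exact: mpdf.
    by apply/measurable_EFinP; exact: exprn_measurable.
  - by apply: emeasurable_funM; [exact: measurable_cst|exact: mpdf].
  - move=> x _; rewrite -!EFinM lee_fin !normal_pdfE//.
    have s'E : (s' ^+ 2 = 2 * s ^+ 2)%R by rewrite exprMn sqr_sqrtr// mulrC.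
    rewrite /normal_fun subr0 s'E.
    (* In this variable the exponentials are exp (- 2 y) and exp (- y), and x^2 is 4 s^2 y. One
       factor exp (- y) absorbs y, and the peaks differ by a factor at most 2. *)
    set y : R := (x ^+ 2 / (4 * s ^+ 2))%R.
    have y0 : (0 <= y)%R by rewrite divr_ge0 ?sqr_ge0// mulr_ge0// sqr_ge0.
    have -> : (- x ^+ 2 / (s ^+ 2 *+ 2) = - y - y)%R by rewrite /y; field.
    have -> : (- x ^+ 2 / (2 * s ^+ 2 *+ 2) = - y)%R by rewrite /y; field.
    have -> : (x ^+ 2 = 4 * s ^+ 2 * y)%R by rewrite /y; field.
    have pk : (normal_peak s <= 2 * normal_peak s')%R.
      rewrite /normal_peak s'E.
      have -> : (2 * s ^+ 2 * pi *+ 2 = 2 * (s ^+ 2 * pi *+ 2))%R by ring.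
      rewrite sqrtrM// invfM.
      have h0 : (0 < Num.sqrt (s ^+ 2 * pi *+ 2))%R.
        by rewrite sqrtr_gt0 mulrn_wgt0// mulr_gt0 ?pi_gt0// exprn_gt0.
      have r0 : (0 < Num.sqrt 2 :> R)%R by rewrite sqrtr_gt0.
      have r2 : (Num.sqrt 2 ^+ 2 = 2 :> R)%R by rewrite sqr_sqrtr.
      have h1 : (1 <= 2 / Num.sqrt 2 :> R)%R by rewrite ler_pdivlMr// mul1r; nra.
      by rewrite mulrA ler_peMl// invr_ge0 ltW.
    have ey : (y * expR (- y) <= 1)%R.
      rewrite -ler_pdivlMr ?expR_gt0// expRN invrK mul1r.
      by apply: le_trans (expR_ge1Dx y); rewrite lerDr.
    rewrite expRD.
    have e0 := expR_gt0 (- y).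
    have p0 := normal_peak_ge0 s.
    have -> : (4 * s ^+ 2 * y * (normal_peak s * (expR (- y) * expR (- y))) =
       4 * s ^+ 2 * (normal_peak s * expR (- y)) * (y * expR (- y)))%R by ring.
    apply: (@le_trans _ _ (4 * s ^+ 2 * (normal_peak s * expR (- y)) * 1)%R).
      by rewrite ler_wpM2l// mulr_ge0 ?mulr_ge0 ?sqr_ge0// ltW.
    rewrite mulr1 (_ : (8 * s ^+ 2 * (normal_peak s' * expR (- y)) =
       4 * s ^+ 2 * ((2 * normal_peak s') * expR (- y)))%R); last by ring.
    apply: ler_wpM2l; first by rewrite mulr_ge0 ?sqr_ge0.
    by apply: ler_wpM2r => //; rewrite ltW.
rewrite ge0_integralZl//.
- by rewrite integral_normal_pdf mule1.
- exact: mpdf.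
- by move=> x _; rewrite lee_fin normal_pdf_ge0.
- by rewrite lee_fin mulr_ge0// sqr_ge0.
Qed.

(** Averaging over x and -x removes the cross term 2 v h x pointwise, so that only nonnegative
    functions are integrated. *)
Lemma normal_prob_affine_square (s v h : R) : (0 < s)%R ->
  \int[normal_prob 0 s]_x ((v + h * x) ^+ 2)%:E <= (v ^+ 2 + h ^+ 2 * (8 * s ^+ 2))%:E.
Proof.
move=> s0; pose f (x : R) := ((v + h * x) ^+ 2)%:E.
have mf : measurable_fun setT f.
  apply/measurable_EFinP; apply: measurable_funX.
  by apply: measurable_funD => //; exact: mulrl_measurable.
have f0 x : 0 <= f x by rewrite lee_fin sqr_ge0.
have mN : measurable_fun setT (-%R : R -> R) by exact: oppr_measurable.
have m2 : measurable_fun setT (fun x : R => (x ^+ 2)%:E).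
  by apply/measurable_EFinP; exact: exprn_measurable.
have twice (a : \bar R) : 2%:E * a = a + a by rewrite (EFinD 1 1) ge0_muleDl ?mul1e ?lee_fin.
rewrite -(@lee_pmul2l _ 2%:E)// ?lte_fin// twice.
rewrite -{2}(normal_prob_opp (f := f)) ?gt_eqF// -ge0_integralD//; last 2 first.
- by move=> x _; rewrite lee_fin sqr_ge0.
- by apply: measurableT_comp mN.
rewrite [leLHS](_ : _ =
    \int[normal_prob 0 s]_x ((2 * v ^+ 2)%:E + (2 * h ^+ 2)%:E * (x ^+ 2)%:E)); last first.
  by apply: eq_integral => x _; rewrite /f -EFinM -!EFinD; congr (_%:E); ring.
have h0 : (0 <= 2 * h ^+ 2)%R by rewrite mulr_ge0// sqr_ge0.
rewrite ge0_integralD//; last 3 first.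
- by move=> x _; rewrite lee_fin mulr_ge0// sqr_ge0.
- by move=> x _; rewrite -EFinM lee_fin mulr_ge0// sqr_ge0.
- by apply: emeasurable_funM; [exact: measurable_cst|exact: m2].
have -> : \int[normal_prob 0 s]_x (2 * v ^+ 2)%:E = (2 * v ^+ 2)%:E.
  have nT : normal_prob 0 s setT = 1 by exact: probability_setT.
  by rewrite integral_cst; [rewrite -[RHS]mule1; congr (_ * _)|exact: measurableT].
have -> : \int[normal_prob 0 s]_x ((2 * h ^+ 2)%:E * (x ^+ 2)%:E) =
    (2 * h ^+ 2)%:E * \int[normal_prob 0 s]_x (x ^+ 2)%:E.
  by rewrite ge0_integralZl// => x _; rewrite lee_fin sqr_ge0.
rewrite -EFinM mulrDr EFinD; apply: leeD2l.
apply: (@le_trans _ _ ((2 * h ^+ 2)%:E * (8 * s ^+ 2)%:E)).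
  by apply: lee_wpmul2l; [rewrite lee_fin|exact: normal_prob_square].
by rewrite -EFinM lee_fin !mulrA.
Qed.
End Gaussian.

(** * The augmented filtration and the independence of increments *)

Section History.
Context {d : measure_display} {Omega : measurableType d} {R : realType}.
Variables (P : probability Omega R) (W : R -> Omega -> R).

(** A copy of Omega whose sigma-algebra is the augmented filtration at time t, so that
    [measurable_fun] from [history t] expresses being known at time t. *)
Definition history (t : R) : Type :=
  g_sigma_algebraType
    (natural_filtration W t `|` [set N | measurable N /\ P N = 0%E]).

HB.instance Definition _ t := Measurable.on (history t).

Lemma history_null t (N : set Omega) : measurable N -> P N = 0%E ->
  measurable (N : set (history t)).
Proof. by move=> mN PN; apply: sub_sigma_algebra; right. Qed.

Lemma history_mono s t (A : set Omega) : s <= t ->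
  measurable (A : set (history s)) -> measurable (A : set (history t)).
Proof.
move=> st; apply: smallest_sub A; first exact: smallest_sigma_algebra.
move=> A [nA|nA]; last by apply: sub_sigma_algebra; right.
apply: sub_sigma_algebra; left.
apply: smallest_sub A nA; first exact: smallest_sigma_algebra.
move=> A [r [B [/andP[r0 rs] mB ->]]]; apply: sub_sigma_algebra.
by exists r, B; split=> //; rewrite r0 (le_trans rs).
Qed.

Lemma measurable_history_mono s t d' (V : measurableType d') (f : Omega -> V) :
  s <= t -> measurable_fun setT (f : history s -> V) ->
  measurable_fun setT (f : history t -> V).
Proof.
move=> st mf _ B mB; rewrite setTI; apply: (history_mono st).
by rewrite -[X in measurable X]setTI; exact: mf.
Qed.

Hypothesis W_brownian : brownian_motion P W.

Lemma natural_filtration_measurable t (A : set Omega) :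
  natural_filtration W t A -> measurable A.
Proof.
apply: smallest_sub A; first by apply: sigma_algebra_measurable.
move=> A [r [B [/andP[r0 rs] mB ->]]]; rewrite -[X in measurable X]setTI.
exact: (brownian_measurable W_brownian).
Qed.

Lemma history_measurable t (A : set Omega) :
  measurable (A : set (history t)) -> measurable A.
Proof.
apply: smallest_sub A; first by apply: sigma_algebra_measurable.
by move=> A [/natural_filtration_measurable|[]].
Qed.

Lemma measurable_history t d' (V : measurableType d') (f : Omega -> V) :
  measurable_fun setT (f : history t -> V) -> measurable_fun setT f.
Proof.
move=> mf _ B mB; rewrite setTI; apply: (@history_measurable t).
by rewrite -[X in measurable X]setTI; exact: mf.
Qed.

Lemma measurable_history_path s t : 0 <= s <= t ->
  measurable_fun setT (W s : history t -> R).
Proof.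
move=> st _ B mB; rewrite setTI; apply: sub_sigma_algebra; left.
by apply: sub_sigma_algebra; exists s, B.
Qed.

(** The events that agree with one of the natural filtration off a null event form a sigma-algebra
    containing the generators. This carries the independence of increments, assumed for the natural
    filtration, over to the augmented one. *)
Lemma history_natural t (A : set Omega) : measurable (A : set (history t)) ->
  exists2 A', natural_filtration W t A' &
    exists N, [/\ measurable N, P N = 0%E & A `\` N = A' `\` N].
Proof.
move: A; apply: (@smallest_sub _ _ _ [set A | exists2 A', natural_filtration W t A' &
    exists N, [/\ measurable N, P N = 0%E & A `\` N = A' `\` N]]); last first.
  move=> A [nA|[mA PA]]; first by exists A => //; exists set0.
  exists set0; first exact: sigma_algebra0.
  by exists A; split => //; rewrite setDv set0D.
split.
- by exists set0; [exact: sigma_algebra0|exists set0].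
- move=> A [A' nA' [N [mN PN AN]]]; exists (setT `\` A').
    exact: sigma_algebraCD.
  exists N; split => //; apply/seteqP; split => w [[_ Aw] Nw]; split => //; split=> //.
    by move=> A'w; apply: Aw; have : (A' `\` N) w by []; rewrite -AN => -[].
  by move=> A'w; apply: Aw; have : (A `\` N) w by []; rewrite AN => -[].
- move=> A /(_ _)/cid2-/all_sig2[A' nA' /(_ _)/cid-/all_sig[N hN]].
  exists (\bigcup_k A' k); first exact: sigma_algebra_bigcup.
  exists (\bigcup_k N k); split.
  + by apply: bigcup_measurable => k _; have [] := hN k.
  + apply/eqP; rewrite eq_le measure_ge0 andbT.
    apply: (le_trans (measure_sigma_subadditive _ _ _ (@subset_refl _ _))) => //.
    * by move=> k; have [] := hN k.
    * by apply: bigcup_measurable => k _; have [] := hN k.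
    * by rewrite eseries0// => k _ _ /=; have [_ PN _] := hN k; exact: PN.
  + apply/seteqP; split => w [[k _ Aw] Nw]; have [_ _ AN] := hN k; split=> //.
      have : (A k `\` N k) w by split=> // Nkw; apply: Nw; exists k.
      by rewrite AN => -[]; exists k.
    have : (A' k `\` N k) w by split=> // Nkw; apply: Nw; exists k.
    by rewrite -AN => -[]; exists k.
Qed.

Lemma measurable_increment_event s t (B : set R) : 0 <= s -> 0 <= t ->
  measurable B -> measurable (increment_event W s t B).
Proof.
move=> s0 t0 mB; rewrite /increment_event.
have : measurable_fun setT (fun w => W t w - W s w).
  by apply: measurable_funB; exact: (brownian_measurable W_brownian).
by move=> /(_ measurableT _ mB); rewrite setTI.
Qed.

Lemma history_indep s t (A : set Omega) (B : set R) : 0 <= s -> s < t ->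
  measurable (A : set (history s)) -> measurable B ->
  P (A `&` increment_event W s t B) = (P A * normal_prob 0 (Num.sqrt (t - s)) B)%E.
Proof.
move=> s0 st hA mB; have [A' nA' [N [mN PN AN]]] := history_natural hA.
have mI := measurable_increment_event s0 (le_trans s0 (ltW st)) mB.
have mA := history_measurable hA; have mA' := natural_filtration_measurable nA'.
have PD (C : set Omega) : measurable C -> P C = P (C `\` N).
  move=> mC; rewrite [LHS](measureDI P mC mN) [X in (_ + X)%E](_ : _ = 0%E) ?adde0//.
  apply/eqP; rewrite eq_le measure_ge0 andbT -PN.
  by apply: le_measure; rewrite ?inE//; exact: measurableI.
have eqI : (A `&` increment_event W s t B) `\` N =
    (A' `&` increment_event W s t B) `\` N.
  by rewrite -!setIDA -!setIDAC AN.
rewrite PD; last exact: measurableI.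
rewrite eqI -PD; last exact: measurableI.
rewrite (brownian_indep W_brownian)// (brownian_normal W_brownian)//.
by congr (_ * _)%E; rewrite (PD A')// -AN -PD.
Qed.

(** Independence makes the joint law of the past and the increment a product, so that by Tonelli V
    and h can be frozen while the Gaussian increment is integrated. Both sides may be infinite. *)
Lemma square_increment_le s t (V h : Omega -> R) : 0 <= s -> s <= t ->
  measurable_fun setT (V : history s -> R) ->
  measurable_fun setT (h : history s -> R) ->
  (\int[P]_w ((V w + h w * (W t w - W s w)) ^+ 2)%:E <=
   \int[P]_w (V w ^+ 2 + 8 * (t - s) * h w ^+ 2)%:E)%E.
Proof.
move=> s0; rewrite le_eqVlt => /orP[/eqP <- mV mh|st mV mh].
  rewrite le_eqVlt; apply/orP; left; apply/eqP/eq_integral => w _.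
  by rewrite !subrr mulr0 addr0 mulr0 mul0r addr0.
have mid : measurable_fun setT (id : Omega -> history s).
  by move=> _ A mA; rewrite setTI; exact: history_measurable mA.
have mxi : measurable_fun setT (fun w => W t w - W s w).
  apply: measurable_funB; apply: (brownian_measurable W_brownian) => //.
  exact: le_trans s0 (ltW st).
(* The past enters as the identity map into [history s], through which every function known at time
   s factors. *)
pose phi w : (history s * measurableTypeR R)%type := (w, W t w - W s w).
have mphi : measurable_fun setT phi by exact: measurable_fun_pair.
pose idm : {mfun Omega >-> history s} := mfun_Sub (mem_set mid).
pose phim : {mfun Omega >-> (history s * measurableTypeR R)%type} := mfun_Sub (mem_set mphi).
pose nu : probability (measurableTypeR R) R := normal_prob 0 (Num.sqrt (t - s)).
have prodE X : measurable X ->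
    (distribution P idm \x nu)%E X = distribution P phim X.
  apply: (@product_measure_unique _ _ (history s) (measurableTypeR R) R (distribution P idm) nu (distribution P phim)) => A B mA mB.
  rewrite /distribution /pushforward/=.
  exact: (history_indep s0 st mA mB).
pose g (z : history s * measurableTypeR R) := ((V z.1 + h z.1 * z.2) ^+ 2)%:E.
have mg : measurable_fun setT g.
  apply/measurable_EFinP; apply: measurable_funX; apply: measurable_funD.
    exact: measurableT_comp mV measurable_fst.
  apply: measurable_funM; last exact: measurable_snd.
  exact: measurableT_comp mh measurable_fst.
have g0 z : (0 <= g z)%E by rewrite lee_fin sqr_ge0.
have -> : (\int[P]_w ((V w + h w * (W t w - W s w)) ^+ 2)%:E =
    \int[distribution P phim]_z g z)%E.
  by rewrite ge0_integral_distribution.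
rewrite (eq_measure_integral (distribution P idm \x nu)%E); last first.
  by move=> A mA _; exact/esym/prodE.
rewrite fubini_tonelli1//.
pose k w := (V w ^+ 2 + 8 * (t - s) * h w ^+ 2)%:E.
have mk : measurable_fun setT (k : history s -> \bar R).
  apply/measurable_EFinP; apply: measurable_funD; first exact: measurable_funX.
  by apply: measurable_funM => //; exact: measurable_funX.
have k0 w : (0 <= k w)%E.
  by rewrite lee_fin addr_ge0 ?sqr_ge0// mulr_ge0 ?sqr_ge0// mulr_ge0// subr_ge0 ltW.
have -> : (\int[P]_w k w = \int[distribution P idm]_w k w)%E.
  by rewrite ge0_integral_distribution.
apply: ge0_le_integral => //.
- by move=> w _; apply: integral_ge0.
- exact: measurable_fun_fubini_tonelli_F.
- move=> w _; have sd0 : 0 < Num.sqrt (t - s) by rewrite sqrtr_gt0 subr_gt0.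
  apply: (le_trans (normal_prob_affine_square (V w) (h w) sd0)).
  by rewrite sqr_sqrtr ?subr_ge0 ?(ltW st)// /k lee_fin lerD2l mulrC.
Qed.

End History.

Section Expectation.
Context {d : measure_display} {Omega : measurableType d} {R : realType}.
Variable P : probability Omega R.
Implicit Types (f g : Omega -> R) (c : R).
Local Open Scope ereal_scope.

Lemma expect_le f g : measurable_fun setT f -> measurable_fun setT g ->
  (forall w, 0 <= f w <= g w)%R ->
  \int[P]_w (f w)%:E <= \int[P]_w (g w)%:E.
Proof.
move=> mf mg fg; apply: ge0_le_integral => //.
- by move=> w _; have /andP[] := fg w; rewrite lee_fin.
- exact/measurable_EFinP.
- exact/measurable_EFinP.
- by move=> w _; have /andP[] := fg w; rewrite lee_fin.
Qed.

Lemma expect_le_cst f c : measurable_fun setT f ->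
  (forall w, 0 <= f w <= c)%R -> \int[P]_w (f w)%:E <= c%:E.
Proof.
move=> mf fc; apply: (le_trans (expect_le mf (measurable_cst c) fc)).
by rewrite /= integral_cst//= probability_setT mule1.
Qed.

Lemma expectD f g : measurable_fun setT f -> measurable_fun setT g ->
  (forall w, 0 <= f w)%R -> (forall w, 0 <= g w)%R ->
  \int[P]_w (f w + g w)%:E = \int[P]_w (f w)%:E + \int[P]_w (g w)%:E.
Proof.
move=> mf mg f0 g0; under eq_integral do rewrite EFinD.
rewrite ge0_integralD//.
- by move=> w _; rewrite lee_fin.
- exact/measurable_EFinP.
- by move=> w _; rewrite lee_fin.
- exact/measurable_EFinP.
Qed.

Lemma expectZ f c : measurable_fun setT f -> (forall w, 0 <= f w)%R -> (0 <= c)%R ->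
  \int[P]_w (c * f w)%:E = c%:E * \int[P]_w (f w)%:E.
Proof.
move=> mf f0 c0; under eq_integral do rewrite EFinM.
rewrite ge0_integralZl//.
- exact/measurable_EFinP.
- by move=> w _; rewrite lee_fin.
Qed.

Lemma expect_sum n (f : nat -> Omega -> R) : (forall i, measurable_fun setT (f i)) ->
  (forall i w, 0 <= f i w)%R ->
  \int[P]_w (\sum_(i < n) f i w)%:E = \sum_(i < n) \int[P]_w (f i w)%:E.
Proof.
move=> mf f0; under eq_integral do rewrite -sumEFin.
rewrite ge0_integral_sum//.
- by move=> i; exact/measurable_EFinP.
- by move=> i w _; rewrite lee_fin.
Qed.

Lemma chebyshev_square f (l : R) (A : set Omega) : measurable A ->
  measurable_fun setT f -> (0 < l)%R -> (forall w, A w -> l <= `|f w|)%R ->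
  P A <= (l ^- 2)%:E * \int[P]_w (f w ^+ 2)%:E.
Proof.
move=> mA mf l0 Af; have l20 : (0 < l ^+ 2)%R by rewrite exprn_gt0.
have -> : P A = (l ^- 2)%:E * \int[P]_w (l ^+ 2 * \1_A w)%:E.
  rewrite expectZ ?(ltW l20)//.

  by rewrite muleA -EFinM mulVf ?gt_eqF// mul1e integral_indic// setIT.
apply: lee_wpmul2l; first by rewrite lee_fin invr_ge0 ltW.
apply: expect_le.
- by apply: measurable_funM => //; exact: measurable_indic.
- exact: measurable_funX.
- move=> w; rewrite mulr_ge0 ?(ltW l20)//= indicE.
  case: (boolP (w \in A)) => [|_]; last by rewrite mulr0 sqr_ge0.
  rewrite inE => /Af lf; rewrite mulr1 -(real_normK (num_real (f w))).
  by rewrite lerXn2r ?nnegrE// ltW.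
Qed.

End Expectation.

(** * A maximal inequality for martingale transforms *)

Section MartingaleTransform.
Context {d : measure_display} {Omega : measurableType d} {R : realType}.
Variables (P : probability Omega R) (W : R -> Omega -> R).
Hypothesis W_brownian : brownian_motion P W.
Variables (delta : R) (delta_gt0 : 0 < delta).

Local Notation t_ i := (i%:R * delta) (only parsing).
Local Notation history := (history P W).

Let t_ge0 i : 0 <= t_ i. Proof. by rewrite mulr_ge0// ltW. Qed.
Let t_le i j : (i <= j)%N -> t_ i <= t_ j.
Proof. by move=> ij; rewrite ler_pM2r// ler_nat. Qed.
Let t_step i : t_ i.+1 - t_ i = delta.
Proof. by rewrite -mulrBl -natrB// subSnn mul1r. Qed.

Definition transform (beta : nat -> Omega -> R) (j : nat) (w : Omega) : R :=
  \sum_(l < j) beta l w * (W (t_ l.+1) w - W (t_ l) w).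

Definition predictable (beta : nat -> Omega -> R) : Prop :=
  forall l, measurable_fun setT (beta l : history (t_ l) -> R).

Lemma measurable_transform beta j : predictable beta ->
  measurable_fun setT (transform beta j : history (t_ j) -> R).
Proof.
move=> beta_meas.
rewrite /transform; apply: (@measurable_sum _ (history (t_ j))) => l.
apply: measurable_funM.
  by apply: measurable_history_mono (beta_meas l); apply: t_le; exact: ltnW.
by apply: measurable_funB; apply: measurable_history_path; rewrite t_ge0 t_le// ltnW.
Qed.

(** Increments are removed from the last one on: the transform so far and the new coefficient are
    known at the left end of the increment, so [square_increment_le] applies without any cross
    term. *)
Lemma transform_square beta j : predictable beta ->
  (\int[P]_w (transform beta j w ^+ 2)%:E <=
   \sum_(l < j) (8 * delta)%:E * \int[P]_w (beta l w ^+ 2)%:E)%E.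
Proof.
move=> beta_meas; elim: j => [|j IH].
  rewrite big_ord0 integral0_eq// => w _.
  by rewrite /transform big_ord0 expr0n.
rewrite big_ord_recr/=.
have mM := measurable_transform (j := j) beta_meas; have mb := beta_meas j.
have mM' := measurable_history W_brownian mM.
have mb' := measurable_history W_brownian mb.
have -> : (\int[P]_w (transform beta j.+1 w ^+ 2)%:E =
    \int[P]_w ((transform beta j w + beta j w * (W (t_ j.+1) w - W (t_ j) w)) ^+ 2)%:E)%E.
  by apply: eq_integral => w _; rewrite /transform big_ord_recr.
apply: (le_trans (square_increment_le W_brownian (t_ge0 j) (t_le (leqnSn j)) mM mb)).
rewrite t_step.
have d8 : 0 <= 8 * delta by rewrite mulr_ge0// ltW.
rewrite expectD; last 4 first.
- exact: measurable_funX.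
- by apply: measurable_funM => //; exact: measurable_funX.
- by move=> w; rewrite sqr_ge0.
- by move=> w; rewrite mulr_ge0// sqr_ge0.
rewrite expectZ//; last 2 first.
- exact: measurable_funX.
- by move=> w; rewrite sqr_ge0.
exact: leeD2r.
Qed.

Lemma measurable_lt_norm (f : Omega -> R) (l : R) : measurable_fun setT f ->
  measurable [set w | l < `|f w|].
Proof.
move=> mf; have : measurable_fun setT (fun w => `|f w|) by exact: measurableT_comp.
move=> /(_ measurableT `]l, +oo[%classic (measurable_itv _)); rewrite setTI.
by congr (measurable _); apply/seteqP; split => w /=; rewrite in_itv/= andbT.
Qed.

Definition crossing (beta : nat -> Omega -> R) (l : R) (J : nat) : set Omega :=
  [set w | exists2 j, (j <= J)%N & l < `|transform beta j w|].

Lemma measurable_crossing beta l J : predictable beta ->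
  measurable (crossing beta l J : set (history (t_ J))).
Proof.
move=> beta_meas.
have -> : crossing beta l J =
    \bigcup_(j in [set j | (j <= J)%N]) [set w | l < `|transform beta j w|].
  by apply/seteqP; split => w [j jJ lj]; exists j.
apply: bigcup_measurable => j jJ.
have mf := measurable_history_mono (t_le jJ) (measurable_transform (j := j) beta_meas).
have : measurable_fun setT ((fun w => `|transform beta j w|) : history (t_ J) -> R).
  exact: measurableT_comp mf.
move=> /(_ measurableT `]l, +oo[%classic (measurable_itv _)); rewrite setTI.
by congr (measurable _); apply/seteqP; split => w /=; rewrite in_itv/= andbT.
Qed.

(* The transform stopped at its first exit from [-l, l] is again a transform. *)
Lemma maximal_inequality beta l J : predictable beta -> 0 < l ->
  (P (crossing beta l J) <=
   (l ^- 2)%:E * \sum_(k < J) (8 * delta)%:E * \int[P]_w (beta k w ^+ 2)%:E)%E.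
Proof.
move=> beta_meas l0.
pose gamma k w := if w \in crossing beta l k then 0 else beta k w.
have mg k : measurable_fun setT (gamma k : history (t_ k) -> R).
  apply: measurable_fun_if => //.
  - apply: (measurable_fun_bool true); rewrite setTI.
    rewrite (_ : _ @^-1` _ = crossing beta l k); first exact: measurable_crossing.
    by apply/seteqP; split => w /= => [/set_mem|/mem_set].
  - exact: measurable_funTS.
have stay j w : ~ crossing beta l j w -> transform gamma j w = transform beta j w /\ transform gamma j.+1 w = transform beta j.+1 w.
  move=> nc; have E i : (i <= j)%N -> gamma i w = beta i w.
    move=> ij; rewrite /gamma ifF//; apply/negbTE/negP; rewrite inE => -[k ki lk].
    by apply: nc; exists k => //; exact: leq_trans ij.
  by split; apply: eq_bigr => i _; rewrite E//; [exact/ltnW|rewrite -ltnS].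
have exit j w : crossing beta l j w -> l < `|transform gamma j w|.
  elim: j => [[j]|j IH].
    rewrite leqn0 => /eqP ->; rewrite /transform big_ord0 normr0 ltNge.
    by rewrite ltW.
  have [cj _|ncj] := pselect (crossing beta l j w).
    rewrite /transform big_ord_recr/= {2}/gamma ifT ?mul0r ?addr0; last exact/mem_set.
    exact: IH.
  have [_ E] := stay _ _ ncj; move=> [k]; rewrite leq_eqVlt => /orP[/eqP ->|kj lk].
    by rewrite E.
  by exfalso; apply: ncj; exists k.
have mc := history_measurable W_brownian (@measurable_crossing beta l J beta_meas).
have mt := measurable_history W_brownian (measurable_transform (j := J) mg).
apply: (le_trans (chebyshev_square P mc mt l0 _)).
  by move=> w /exit /ltW.
apply: lee_wpmul2l; first by rewrite lee_fin invr_ge0 exprn_ge0// ltW.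
apply: (le_trans (transform_square J mg)); apply: lee_sum => k _.
apply: lee_wpmul2l; first by rewrite lee_fin mulr_ge0// ltW.
apply: expect_le.
- exact/measurable_funX/(measurable_history W_brownian (mg k)).
- exact/measurable_funX/(measurable_history W_brownian (beta_meas k)).
- move=> w; rewrite sqr_ge0 /gamma; case: ifP => _ //=; by rewrite expr2 mulr0 sqr_ge0.
Qed.

End MartingaleTransform.

(** * Convergence of Euler schemes *)

Section Grid.
Context {R : realType}.

(* The ratio 16 of consecutive meshes leaves room for a Borel-Cantelli argument
   with threshold 2^-n: an error of order 16^-n in mean square gives
   probabilities of order 16^-n / (2^-n)^2 = 4^-n. *)
Definition mesh (n : nat) : R := 16 ^- n.
Definition node (n i : nat) : R := i%:R * mesh n.

Lemma mesh_gt0 n : 0 < mesh n.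
Proof. by rewrite invr_gt0 exprn_gt0. Qed.

Lemma mesh_le1 n : mesh n <= 1.
Proof. by rewrite invf_le1 ?exprn_gt0// exprn_ege1// ler1n. Qed.

Lemma mesh_le n m : (n <= m)%N -> mesh m <= mesh n.
Proof.
move=> nm; rewrite lef_pV2 ?posrE ?exprn_gt0//.
by rewrite ler_weXn2l// ler1n.
Qed.

Lemma node0 n : node n 0 = 0. Proof. by rewrite /node mul0r. Qed.

Lemma node_ge0 n i : 0 <= node n i.
Proof. by rewrite mulr_ge0// ltW// mesh_gt0. Qed.

Lemma node_le n i j : (node n i <= node n j) = (i <= j)%N.
Proof. by rewrite ler_pM2r ?mesh_gt0// ler_nat. Qed.

Lemma nodeS n i : node n i.+1 = node n i + mesh n.
Proof. by rewrite /node -natr1 mulrDl mul1r. Qed.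

Lemma node_scale n N i : (n <= N)%N -> node n i = node N (i * 16 ^ (N - n)).
Proof.
move=> nN; rewrite /node /mesh natrM natrX -mulrA; congr (_ * _).
have -> : 16 ^+ N = 16 ^+ (N - n) * 16 ^+ n :> R by rewrite -exprD subnK.
by rewrite invfM mulrA mulfV ?mul1r// expf_neq0.
Qed.

(** A cell of level n consists of 16 ^ (N - n) cells of level N, so this is the index of the last
    node of level n that is not after the j-th node of level N. *)
Definition cell (n N j : nat) : nat := j %/ 16 ^ (N - n).

Lemma cell_le n N j : (n <= N)%N -> node n (cell n N j) <= node N j.
Proof. by move=> nN; rewrite (node_scale _ nN) node_le leq_divM. Qed.

Lemma cell_ge n N j : (n <= N)%N -> node N j.+1 <= node n (cell n N j).+1.
Proof.
by move=> nN; rewrite (node_scale _ nN) node_le ltn_ceil// expn_gt0.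
Qed.

Lemma cell_mono n m N j : (n <= m)%N -> (m <= N)%N ->
  node n (cell n N j) <= node m (cell m N j).
Proof.
move=> nm mN; have nN := leq_trans nm mN.
rewrite (node_scale _ nN) (node_scale _ mN) node_le /cell.
rewrite (_ : 16 ^ (N - n) = 16 ^ (m - n) * 16 ^ (N - m))%N; last first.
  by rewrite -expnD addnC addnBA// subnK.
by rewrite mulnA leq_mul2r [X in (_ %/ X)%N]mulnC divnMA leq_divM orbT.
Qed.

Definition floor_index (n : nat) (s : R) : nat := Num.truncn (s / mesh n).

Lemma floor_indexP n s : 0 <= s ->
  node n (floor_index n s) <= s < node n (floor_index n s).+1.
Proof.
move=> s0; have m0 := mesh_gt0 n.
have := truncn_itv (divr_ge0 s0 (ltW m0)).
by rewrite ler_pdivlMr// ltr_pdivrMr.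
Qed.

Lemma floor_indexE n k s : node n k <= s < node n k.+1 -> floor_index n s = k.
Proof.
move=> ks; apply: truncn_def.
by rewrite ler_pdivlMr ?mesh_gt0// ltr_pdivrMr ?mesh_gt0.
Qed.

End Grid.

Section Euler.
Context {d : measure_display} {Omega : measurableType d} {R : realType}.
Variables (P : probability Omega R) (W : R -> Omega -> R).

Local Notation history := (history P W).

(* A clock dominates the variation in time of the coefficients of the schemes. For the
   glued coefficients below, which jump only at an exit time, it is the indicator of
   having exited. *)
Record clock (rho : R -> Omega -> R) : Prop := Clock {
  clock_measurable : forall t, 0 <= t -> measurable_fun setT (rho t : history t -> R) ;
  clock_itv : forall t w, 0 <= t -> 0 <= rho t w <= 1 ;
  clock_le : forall s t w, 0 <= s -> s <= t -> rho s w <= rho t w }.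

(** Instead of joint measurability in state and event, measurability is asked after substitution of
    a function known at time t, which is what an Euler step performs. *)
Record admissible (K : R) (rho : R -> Omega -> R) (a : R -> R -> Omega -> R) : Prop :=
  Admissible {
  admissible_measurable : forall t g, 0 <= t ->
    measurable_fun setT (g : history t -> R) ->
    measurable_fun setT ((fun w => a t (g w) w) : history t -> R) ;
  admissible_bound : forall t z w, 0 <= t -> `|a t z w| <= K ;
  admissible_lip : forall t z z' w, 0 <= t -> `|a t z w - a t z' w| <= K * `|z - z'| ;
  admissible_time : forall s t z w, 0 <= s -> s <= t ->
    `|a t z w - a s z w| <= K * (rho t w - rho s w) }.

Variables (a b : R -> R -> Omega -> R).

(** The scheme starts at 0 because it approximates Z, the part added to the stopped process. *)
Fixpoint euler (n i : nat) (w : Omega) : R :=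
  if i is k.+1 then
    euler n k w + a (node n k) (euler n k w) w * mesh n +
      b (node n k) (euler n k w) w * (W (node n k.+1) w - W (node n k) w)
  else 0.

Definition drift n k w := a (node n k) (euler n k w) w.
Definition diffusion n k w := b (node n k) (euler n k w) w.

(** Between nodes the Brownian path itself is followed, with frozen coefficients, so that schemes of
    different levels can be compared at the nodes of any finer grid. *)
Definition euler_at (n : nat) (s : R) (w : Omega) : R :=
  let k := floor_index n s in
  euler n k w + drift n k w * (s - node n k) + diffusion n k w * (W s w - W (node n k) w).

(** The formula persists at the right end of the cell, where [floor_index] has already moved on,
    because there it is the next Euler step. *)
Lemma euler_at_cell n k s w : node n k <= s <= node n k.+1 ->
  euler_at n s w =
  euler n k w + drift n k w * (s - node n k) + diffusion n k w * (W s w - W (node n k) w).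
Proof.
move=> /andP[ks]; rewrite le_eqVlt => /orP[/eqP ->|sk]; last first.
  by rewrite /euler_at (@floor_indexE _ n k)// ks.
rewrite /euler_at (@floor_indexE _ n k.+1); last first.
  by rewrite lexx/= [ltRHS]nodeS ltrDl mesh_gt0.
rewrite !subrr !mulr0 !addr0/= -/(drift n k w) -/(diffusion n k w) nodeS.
by rewrite [node n k + mesh n - node n k]addrAC subrr add0r.
Qed.

Lemma euler_at0 n w : euler_at n 0 w = 0.
Proof.
rewrite (@euler_at_cell n 0) ?node0 ?node_ge0 ?lexx//=.
by rewrite !subrr !mulr0 !addr0.
Qed.

Lemma euler_at_step n N j w : (n <= N)%N ->
  euler_at n (node N j.+1) w = euler_at n (node N j) w +
    drift n (cell n N j) w * mesh N +
    diffusion n (cell n N j) w * (W (node N j.+1) w - W (node N j) w).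
Proof.
move=> nN; have h1 := @cell_le R n N j nN; have h2 := @cell_ge R n N j nN.
have h3 : node N j <= node N j.+1 :> R by rewrite node_le.
rewrite (euler_at_cell w (introT andP (conj h1 (le_trans h3 h2)))).
rewrite (euler_at_cell w (introT andP (conj (le_trans h1 h3) h2))).
rewrite [node N j.+1 - _](_ : _ = node N j + mesh N - node n (cell n N j)) ?nodeS//.
ring.
Qed.

Variables (K : R) (rho : R -> Omega -> R).
Hypothesis W_brownian : brownian_motion P W.
Hypothesis rho_clock : clock rho.
Hypothesis K_ge1 : 1 <= K.
Hypothesis a_adm : admissible K rho a.
Hypothesis b_adm : admissible K rho b.

Lemma measurable_euler n i : measurable_fun setT (euler n i : history (node n i) -> R).
Proof.
elim: i => [|i IH] /=; first exact: measurable_cst.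
have le_i : node n i <= node n i.+1 :> R by rewrite node_le.
have m1 := measurable_history_mono le_i (admissible_measurable a_adm (node_ge0 n i) IH).
have m2 := measurable_history_mono le_i (admissible_measurable b_adm (node_ge0 n i) IH).
apply: measurable_funD; first apply: measurable_funD.
- exact: measurable_history_mono le_i IH.
- exact: measurable_funM.
- apply: measurable_funM => //; apply: measurable_funB;
    by apply: measurable_history_path; rewrite node_ge0 ?lexx ?le_i.
Qed.

Lemma measurable_drift n i : measurable_fun setT (drift n i : history (node n i) -> R).
Proof.
have H := admissible_measurable a_adm (node_ge0 n i) (@measurable_euler n i).
exact: H.
Qed.

Lemma measurable_diffusion n i :
  measurable_fun setT (diffusion n i : history (node n i) -> R).
Proof.
have H := admissible_measurable b_adm (node_ge0 n i) (@measurable_euler n i).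
exact: H.
Qed.

Lemma measurable_euler_at n s : 0 <= s ->
  measurable_fun setT (euler_at n s : history s -> R).
Proof.
move=> s0; rewrite /euler_at; set k := floor_index n s.
have /andP[ks _] : node n k <= s < node n k.+1 := floor_indexP n s0.
apply: measurable_funD; first apply: measurable_funD.
- exact: measurable_history_mono ks (@measurable_euler n k).
- by apply: measurable_funM => //; exact: measurable_history_mono ks (@measurable_drift n k).
- apply: measurable_funM; first exact: measurable_history_mono ks (@measurable_diffusion n k).
  by apply: measurable_funB; apply: measurable_history_path; rewrite ?node_ge0 ?s0 ?lexx.
Qed.

(** Observed at the j-th node of level N, [lag] is the motion of the scheme, and [tick] that of the
    clock, since the last node of level n. The three definitions after them compare levels n and
    n.+1. *)
Definition lag n N j w := euler_at n (node N j) w - euler n (cell n N j) w.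
Definition tick n N j w := rho (node N j) w - rho (node n (cell n N j)) w.
Definition gap n N j w := euler_at n (node N j) w - euler_at n.+1 (node N j) w.
Definition drift_gap n N j w := drift n (cell n N j) w - drift n.+1 (cell n.+1 N j) w.
Definition diffusion_gap n N j w :=
  diffusion n (cell n N j) w - diffusion n.+1 (cell n.+1 N j) w.

Let K_ge0 : 0 <= K. Proof. exact: le_trans K_ge1. Qed.

Lemma measurable_cell n N j d' (V : measurableType d') (f : Omega -> V) : (n <= N)%N ->
  measurable_fun setT (f : history (node n (cell n N j)) -> V) ->
  measurable_fun setT (f : history (node N j) -> V).
Proof. by move=> nN; apply: measurable_history_mono; exact: cell_le. Qed.

Lemma measurable_lag n N j : (n <= N)%N ->
  measurable_fun setT (lag n N j : history (node N j) -> R).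
Proof.
move=> nN; apply: measurable_funB; first exact: (@measurable_euler_at _ _ (node_ge0 _ _)).
exact: (measurable_cell nN (@measurable_euler _ _)).
Qed.

Lemma measurable_tick n N j : (n <= N)%N ->
  measurable_fun setT (tick n N j : history (node N j) -> R).
Proof.
move=> nN; apply: measurable_funB; first exact: (clock_measurable rho_clock (node_ge0 _ _)).
exact: (measurable_cell nN (clock_measurable rho_clock (node_ge0 _ _))).
Qed.

Lemma measurable_gap n N j : measurable_fun setT (gap n N j : history (node N j) -> R).
Proof. by apply: measurable_funB; exact: (@measurable_euler_at _ _ (node_ge0 _ _)). Qed.

Lemma measurable_drift_gap n N j : (n < N)%N ->
  measurable_fun setT (drift_gap n N j : history (node N j) -> R).
Proof.
move=> nN; apply: measurable_funB.
  exact: (measurable_cell (ltnW nN) (@measurable_drift _ _)).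
exact: (measurable_cell nN (@measurable_drift _ _)).
Qed.

Lemma measurable_diffusion_gap n N j : (n < N)%N ->
  measurable_fun setT (diffusion_gap n N j : history (node N j) -> R).
Proof.
move=> nN; apply: measurable_funB.
  exact: (measurable_cell (ltnW nN) (@measurable_diffusion _ _)).
exact: (measurable_cell nN (@measurable_diffusion _ _)).
Qed.

Lemma tick_itv n N j w : (n <= N)%N -> 0 <= tick n N j w <= 1.
Proof.
move=> nN; have := clock_le rho_clock w (node_ge0 n _) (@cell_le R n N j nN).
have /andP[_] := clock_itv rho_clock w (node_ge0 N j).
have /andP[] := clock_itv rho_clock w (node_ge0 n (cell n N j)).
by rewrite /tick => *; apply/andP; split; lra.
Qed.

(** The change of time is bounded by the tick, and the change of state is the gap minus one lag plus
    the other; squaring four terms gives the factor 4. The tick, lying in [0, 1], dominates its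
    square and is kept to the first power because first powers can be summed in time. *)
Lemma coefficient_gap_square c n N j w : admissible K rho c -> (n < N)%N ->
  (c (node n (cell n N j)) (euler n (cell n N j) w) w -
   c (node n.+1 (cell n.+1 N j)) (euler n.+1 (cell n.+1 N j) w) w) ^+ 2 <=
  4 * K ^+ 2 * (tick n N j w + gap n N j w ^+ 2 + lag n N j w ^+ 2 +
                lag n.+1 N j w ^+ 2).
Proof.
move=> c_adm nN; set s := node n _; set s' := node n.+1 _; set e := euler n _ w.
set e' := euler n.+1 _ w.
have s0 : 0 <= s by exact: node_ge0.
have ss' : s <= s' by exact: cell_mono.
have s't : s' <= node N j by exact: cell_le.
have h1 := admissible_time c_adm e w s0 ss'.
have h2 := admissible_lip c_adm e e' w (le_trans s0 ss').
have h3 := clock_le rho_clock w (le_trans s0 ss') s't.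
have /andP[q0 q1] := tick_itv j w (ltnW nN).
have eE : e - e' = gap n N j w - lag n N j w + lag n.+1 N j w.
  by rewrite /gap /lag -/e -/e'; ring.
rewrite eE in h2.
set q := tick n N j w in q0 q1 *; set D := gap n N j w in h2 *.
set r := lag n N j w in h2 *; set r' := lag n.+1 N j w in h2 *.
set x := c s e w - c s' e' w.
have hx : `|x| <= K * (q + `|D| + `|r| + `|r'|).
  have -> : x = - (c s' e w - c s e w) + (c s' e w - c s' e' w) by rewrite /x; ring.
  apply: (le_trans (ler_normD _ _)); rewrite normrN.
  have : K * `|D - r + r'| <= K * (`|D| + `|r| + `|r'|).
    apply: ler_wpM2l => //; apply: (le_trans (ler_normD _ _)).
    by rewrite lerD2r; exact: ler_normB.
  have : K * (rho s' w - rho s w) <= K * q.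
    by apply: ler_wpM2l => //; rewrite /q /tick -/s lerD2r.
  lra.
have -> : x ^+ 2 = `|x| ^+ 2 by rewrite real_normK ?num_real.
apply: (@le_trans _ _ ((K * (q + `|D| + `|r| + `|r'|)) ^+ 2)).
  apply: lerXn2r => //; rewrite nnegrE //; apply: mulr_ge0 => //.
  by have := normr_ge0 D; have := normr_ge0 r; have := normr_ge0 r'; lra.
rewrite exprMn [4 * _]mulrC -[leRHS]mulrA; apply: ler_wpM2l; first exact: sqr_ge0.
rewrite -(real_normK (num_real D)) -(real_normK (num_real r)) -(real_normK (num_real r')).
have qq : q ^+ 2 <= q by rewrite expr2; nra.
move: (`|D|) (`|r|) (`|r'|) => u v v'.
have := sqr_ge0 (q - u); have := sqr_ge0 (q - v); have := sqr_ge0 (q - v').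
have := sqr_ge0 (u - v); have := sqr_ge0 (u - v'); have := sqr_ge0 (v - v').
rewrite !expr2 in qq *; lra.
Qed.

(** Here 9 = 1 + 8. With tau the time elapsed since the last node, the drift contributes K^2 tau^2
    <= K^2 tau and the Brownian part 8 tau K^2. *)
Lemma lag_square n N j : (n <= N)%N ->
  (\int[P]_w (lag n N j w ^+ 2)%:E <= (9 * K ^+ 2 * mesh n)%:E)%E.
Proof.
move=> nN; set k := cell n N j; have h1 := @cell_le R n N j nN.
have h2 : node N j <= node n k.+1 :> R.
  by apply: (le_trans _ (@cell_ge R n N j nN)); rewrite node_le.
pose tau : R := node N j - node n k.
have tau0 : 0 <= tau by rewrite subr_ge0.
have taum : tau <= mesh n by rewrite /tau; rewrite nodeS in h2; lra.
have tau1 : tau <= 1 by exact: le_trans (mesh_le1 n).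
have -> : (\int[P]_w (lag n N j w ^+ 2)%:E = \int[P]_w ((drift n k w * tau +
    diffusion n k w * (W (node N j) w - W (node n k) w)) ^+ 2)%:E)%E.
  apply: eq_integral => w _; rewrite /lag (@euler_at_cell n k) ?h1//.
  by congr ((_ ^+ 2)%:E); rewrite -/k /tau; ring.
have md := @measurable_drift n k.
have mdt : measurable_fun setT ((fun w => drift n k w * tau) : history (node n k) -> R).
  exact: measurable_funM.
apply: (le_trans (square_increment_le W_brownian (node_ge0 n k) h1 mdt
  (@measurable_diffusion n k))).
apply: expect_le_cst.
  apply: (@measurable_history _ _ _ P W W_brownian (node n k)).
  apply: measurable_funD; first exact: measurable_funX.
  by apply: measurable_funM => //; apply: measurable_funX; exact: measurable_diffusion.
move=> w; rewrite -/tau.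
have hA : drift n k w ^+ 2 <= K ^+ 2.
  rewrite -(real_normK (num_real (drift _ _ _))) lerXn2r ?nnegrE//.
  exact: (admissible_bound a_adm _ _ (node_ge0 n k)).
have hB : diffusion n k w ^+ 2 <= K ^+ 2.
  rewrite -(real_normK (num_real (diffusion _ _ _))) lerXn2r ?nnegrE//.
  exact: (admissible_bound b_adm _ _ (node_ge0 n k)).
have A0 := sqr_ge0 (drift n k w); have B0 := sqr_ge0 (diffusion n k w).
rewrite exprMn; move: (drift n k w ^+ 2) (diffusion n k w ^+ 2) hA hB A0 B0 => A B.
move=> hA hB A0 B0; apply/andP; split.
  by rewrite addr_ge0// !mulr_ge0// sqr_ge0.
apply: (@le_trans _ _ (K ^+ 2 * tau + 8 * tau * K ^+ 2)).
  apply: lerD; last by rewrite ler_wpM2l// mulr_ge0.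
  by rewrite ler_pM ?sqr_ge0// expr2 ler_piMl.
have -> : K ^+ 2 * tau + 8 * tau * K ^+ 2 = 9 * K ^+ 2 * tau by ring.
by rewrite ler_wpM2l// mulr_ge0// sqr_ge0.
Qed.

(** Inside a coarse cell each tick is at most the increase of the clock over the whole cell, and
    these increases telescope to at most 1. Multiplied by [mesh N], the ticks thus cost at most
    [mesh n], whatever the number m of coarse cells. *)
Lemma tick_sum n N m w : (n <= N)%N ->
  \sum_(l < m * 16 ^ (N - n)) tick n N l w <= (16 ^ (N - n))%:R.
Proof.
move=> nN; set p := (16 ^ (N - n))%N; have p0 : (0 < p)%N by rewrite expn_gt0.
suff : \sum_(l < m * p) tick n N l w <= p%:R * (rho (node n m) w - rho (node n 0) w).
  move=> /le_trans; apply; rewrite ler_piMr//.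
  have /andP[_] := clock_itv rho_clock w (node_ge0 n m).
  have /andP[] := clock_itv rho_clock w (node_ge0 n 0); lra.
elim: m => [|m IH]; first by rewrite mul0n big_ord0 subrr mulr0.
rewrite mulSnr big_split_ord/=.
have -> : p%:R * (rho (node n m.+1) w - rho (node n 0) w) =
  p%:R * (rho (node n m) w - rho (node n 0) w) +
  p%:R * (rho (node n m.+1) w - rho (node n m) w) by ring.
apply: lerD => //.
apply: (@le_trans _ _ (\sum_(i < p) (rho (node n m.+1) w - rho (node n m) w))).
  apply: ler_sum => i _; rewrite /tick.
  have -> : cell n N (m * p + i) = m.
    by rewrite /cell -/p divnMDl// divn_small// addn0.
  rewrite lerD2r; apply: (clock_le rho_clock); first exact: node_ge0.
  by rewrite (node_scale _ nN) node_le -/p mulSnr leq_add2l ltnW.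
by rewrite sumr_const card_ord mulr_natl.
Qed.

Lemma gap0 n N w : gap n N 0 w = 0.
Proof. by rewrite /gap node0 !euler_at0 subrr. Qed.

Lemma gapS n N j w : (n < N)%N -> gap n N j.+1 w =
  gap n N j w + drift_gap n N j w * mesh N +
  diffusion_gap n N j w * (W (node N j.+1) w - W (node N j) w).
Proof.
move=> nN; rewrite /gap !euler_at_step//; last exact: ltnW.
by rewrite /drift_gap /diffusion_gap; ring.
Qed.

Lemma gap_transform n N j w : (n < N)%N -> gap n N j w =
  \sum_(l < j) drift_gap n N l w * mesh N + transform W (mesh N) (diffusion_gap n N) j w.
Proof.
move=> nN; elim: j => [|j IH]; first by rewrite gap0 /transform !big_ord0 addr0.
rewrite gapS// IH /transform !big_ord_recr/= -/(node N j) -/(node N j.+1).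
by rewrite -!addrA; congr (_ + _); rewrite addrCA.
Qed.

Let mhist N j := @measurable_history _ _ _ P W W_brownian (node N j).

Definition expected_tick n N j : R := fine (\int[P]_w (tick n N j w)%:E).

Lemma expected_tickE n N j : (n <= N)%N ->
  (\int[P]_w (tick n N j w)%:E = (expected_tick n N j)%:E)%E /\ 0 <= expected_tick n N j.
Proof.
move=> nN; have mt := mhist (@measurable_tick _ _ j nN).
have t0 : (0 <= \int[P]_w (tick n N j w)%:E)%E.
  by apply: integral_ge0 => w _; rewrite lee_fin; have /andP[] := tick_itv j w nN.
split; last by rewrite /expected_tick fine_ge0.
rewrite /expected_tick fineK// ge0_fin_numE//.
apply: (@le_lt_trans _ _ 1%:E); last exact: ltry.
by apply: expect_le_cst mt _ => w; exact: tick_itv.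
Qed.

Lemma expected_tick_sum n N m : (n <= N)%N ->
  \sum_(l < m * 16 ^ (N - n)) expected_tick n N l * mesh N <= mesh n.
Proof.
move=> nN.
have : (\int[P]_w (\sum_(l < m * 16 ^ (N - n)) tick n N l w)%:E <=
    ((16 ^ (N - n))%:R)%:E)%E.
  apply: expect_le_cst.
    by apply: measurable_sum => l; exact: (mhist (@measurable_tick _ _ l nN)).
  move=> w; rewrite tick_sum// andbT sumr_ge0// => l _.
  by have /andP[] := tick_itv l w nN.
rewrite expect_sum; last 2 first.
- by move=> l; exact: (mhist (@measurable_tick _ _ l nN)).
- by move=> l w; have /andP[] := tick_itv l w nN.
under eq_bigr do rewrite (expected_tickE _ nN).1.
rewrite sumEFin lee_fin => h; rewrite -mulr_suml.
have := node_scale (R := R) 1 nN; rewrite /node mul1r mul1n => ->.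
by rewrite ler_wpM2r// ltW// mesh_gt0.
Qed.

(** Here 41 = 4 * (2 + 8) + 1. Squared coefficient gaps are bounded with the factor 4 K^2; those of
    the drift and of the diffusion enter with 2 and 8 times the mesh; the last unit, as 1 <= K^2,
    absorbs the remaining part of the cross term between gap and drift. *)
Definition growth : R := 41 * K ^+ 2.

Lemma growth_ge0 : 0 <= growth.
Proof. by rewrite mulr_ge0// sqr_ge0. Qed.

(** Here 18 = 9 + 9, for the lags of the two levels, the finer mesh being bounded by the coarser. *)
Definition gap_source n N l : R :=
  growth * (expected_tick n N l * mesh N + 18 * K ^+ 2 * mesh n * mesh N).

Lemma gap_source_ge0 n N l : (n <= N)%N -> 0 <= gap_source n N l.
Proof.
move=> nN; have [_ t0] := expected_tickE l nN.
have m0 := mesh_gt0 (R := R) N; have m1 := mesh_gt0 (R := R) n.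
rewrite mulr_ge0 ?growth_ge0// addr_ge0// ?mulr_ge0 ?sqr_ge0//; exact: ltW.
Qed.

(** One step of a discrete Gronwall inequality. The drift gap joins the part known at the left node,
    and [square_increment_le] treats the diffusion gap. *)
Lemma gap_square_rec n N j : (n < N)%N ->
  (\int[P]_w (gap n N j.+1 w ^+ 2)%:E <=
   (1 + growth * mesh N)%:E * \int[P]_w (gap n N j w ^+ 2)%:E + (gap_source n N j)%:E)%E.
Proof.
move=> nN; have nN' := ltnW nN; have m0 := mesh_gt0 (R := R) N; have m1 := mesh_le1 (R := R) N.
have mn1 := mesh_le (R := R) (leqnSn n).
have g0 := growth_ge0.
have -> : (\int[P]_w (gap n N j.+1 w ^+ 2)%:E = \int[P]_w (((gap n N j w +
    drift_gap n N j w * mesh N) +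
    diffusion_gap n N j w * (W (node N j.+1) w - W (node N j) w)) ^+ 2)%:E)%E.
  by apply: eq_integral => w _; rewrite gapS.
have mg := @measurable_gap n N j; have mdr := @measurable_drift_gap _ _ j nN.
have mdi := @measurable_diffusion_gap _ _ j nN.
have mt := @measurable_tick _ _ j nN'; have ml := @measurable_lag _ _ j nN'.
have ml' := @measurable_lag n.+1 N j nN.
have mV : measurable_fun setT
    ((fun w => gap n N j w + drift_gap n N j w * mesh N) : history (node N j) -> R).
  by apply: measurable_funD => //; exact: measurable_funM.
have jj : node N j <= node N j.+1 :> R by rewrite node_le.
apply: (le_trans (square_increment_le W_brownian (node_ge0 N j) jj mV mdi)).
have -> : node N j.+1 - node N j = mesh N :> R by rewrite nodeS addrAC subrr add0r.
pose S w := tick n N j w + lag n N j w ^+ 2 + lag n.+1 N j w ^+ 2.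
have mS : measurable_fun setT S.
  apply: (@mhist N j); apply: measurable_funD; last exact: measurable_funX.
  by apply: measurable_funD => //; exact: measurable_funX.
have S0 w : 0 <= S w.
  have /andP[t0 _] := tick_itv j w nN'.
  by apply: addr_ge0; [apply: addr_ge0|]; rewrite ?sqr_ge0.
have mg2 : measurable_fun setT (fun w => gap n N j w ^+ 2).
  by apply: (@mhist N j); exact: measurable_funX.
have c0 : 0 <= 1 + growth * mesh N by rewrite addr_ge0// mulr_ge0// ltW.
have c1 : 0 <= growth * mesh N by rewrite mulr_ge0// ltW.
apply: (@le_trans _ _ (\int[P]_w ((1 + growth * mesh N) * gap n N j w ^+ 2 +
    growth * mesh N * S w)%:E)%E).
  apply: expect_le.
  - apply: (@mhist N j); apply: measurable_funD; first exact: measurable_funX.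
    by apply: measurable_funM => //; exact: measurable_funX.
  - by apply: measurable_funD; apply: measurable_funM.
  move=> w; rewrite addr_ge0 ?sqr_ge0// 1?mulr_ge0 ?sqr_ge0//=; last first.
    by rewrite mulr_ge0// ltW.
  have hA : drift_gap n N j w ^+ 2 <= 4 * K ^+ 2 * (S w + gap n N j w ^+ 2).
    by apply: (le_trans (coefficient_gap_square j w a_adm nN)); rewrite /S; lra.
  have hB : diffusion_gap n N j w ^+ 2 <= 4 * K ^+ 2 * (S w + gap n N j w ^+ 2).
    by apply: (le_trans (coefficient_gap_square j w b_adm nN)); rewrite /S; lra.
  have hK : 1 <= K ^+ 2 by rewrite exprn_ege1.
  have hS := S0 w; rewrite /growth.
  move: (gap n N j w) (drift_gap n N j w) (diffusion_gap n N j w ^+ 2) (S w)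
    (K ^+ 2) (mesh N) hA hB hK hS m0 m1 => D al B s k m hA hB hK hS m0 m1.
  (* The cross term 2 D al m is at most m (D^2 + al^2), and m^2 <= m. *)
  have h1 : (D + al * m) ^+ 2 <= (1 + m) * D ^+ 2 + 2 * m * al ^+ 2.
    have h2 : (0 <= m * (D - al) ^+ 2) by rewrite mulr_ge0 ?sqr_ge0// ltW.
    have h3 : 0 <= m * (1 - m) * al ^+ 2.
      by apply: mulr_ge0; [apply: mulr_ge0; [exact: ltW|rewrite subr_ge0]|exact: sqr_ge0].
    by rewrite !expr2 in h2 h3 *; lra.
  apply: (le_trans (lerD h1 (lexx _))).
  have D0 := sqr_ge0 D; move: (D ^+ 2) (al ^+ 2) hA hB D0 => X Y hA hB D0.
  have h4 : m * Y <= m * (4 * k * (s + X)) by rewrite ler_wpM2l// ltW.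
  have h5 : m * B <= m * (4 * k * (s + X)) by rewrite ler_wpM2l// ltW.
  have h6 : 0 <= m * X * (k - 1).
    by apply: mulr_ge0; [apply: mulr_ge0 => //; exact: ltW|rewrite subr_ge0].
  have h7 : 0 <= m * k * s.
    by apply: mulr_ge0 => //; apply: mulr_ge0; [exact: ltW|exact: le_trans hK].
  lra.
rewrite expectD//; last 4 first.
- exact: measurable_funM.
- exact: measurable_funM.
- by move=> w; rewrite mulr_ge0// sqr_ge0.
- by move=> w; rewrite mulr_ge0.
rewrite expectZ//; last by move=> w; rewrite sqr_ge0.
apply: leeD2l; rewrite expectZ//.
apply: (@le_trans _ _ ((growth * mesh N)%:E *
   (expected_tick n N j + 9 * K ^+ 2 * mesh n + 9 * K ^+ 2 * mesh n.+1)%:E)%E).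
  apply: lee_wpmul2l; first by rewrite lee_fin.
  rewrite /S expectD; last 4 first.
  - apply: (@mhist N j); apply: measurable_funD => //; exact: measurable_funX.
  - by apply: (@mhist N j); exact: measurable_funX.
  - move=> w; have /andP[t0 _] := tick_itv j w nN'.
    by apply: addr_ge0; rewrite ?sqr_ge0.
  - by move=> w; rewrite sqr_ge0.
  rewrite expectD; last 4 first.
  - exact: (@mhist N j).
  - by apply: (@mhist N j); exact: measurable_funX.
  - by move=> w; have /andP[] := tick_itv j w nN'.
  - by move=> w; rewrite sqr_ge0.
  rewrite (expected_tickE _ nN').1 !EFinD; apply: leeD; last exact: lag_square.
  by apply: leeD => //; exact: lag_square.
rewrite -EFinM lee_fin /gap_source -[leLHS]mulrA; apply: ler_wpM2l => //.
have K0 : 0 <= K ^+ 2 * mesh N by rewrite mulr_ge0 ?sqr_ge0// ltW.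
have := ler_wpM2l K0 mn1.
lra.
Qed.

Lemma gap_square_le n N j : (n < N)%N ->
  (\int[P]_w (gap n N j w ^+ 2)%:E <=
   (expR (growth * mesh N * j%:R) * \sum_(l < j) gap_source n N l)%:E)%E.
Proof.
move=> nN; have m0 := mesh_gt0 (R := R) N; have g0 := growth_ge0.
have c1 : 0 <= growth * mesh N by rewrite mulr_ge0// ltW.
elim: j => [|j IH].
  rewrite big_ord0 mulr0 integral0_eq// => w _.
  by rewrite gap0 expr0n.
apply: (le_trans (gap_square_rec j nN)).
have s0 l := gap_source_ge0 l (ltnW nN).
apply: (@le_trans _ _ ((1 + growth * mesh N)%:E *
   (expR (growth * mesh N * j%:R) * \sum_(l < j) gap_source n N l)%:E +
   (gap_source n N j)%:E)%E).
  by rewrite leeD2r// lee_wpmul2l// lee_fin addr_ge0.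
rewrite -EFinM -EFinD lee_fin big_ord_recr/= mulrDr; apply: lerD.
  rewrite mulrA ler_wpM2r ?sumr_ge0// -natr1 mulrDr mulr1 expRD mulrC.
  by rewrite ler_wpM2l ?expR_ge0// expR_ge1Dx.
by rewrite ler_peMl// -expR0 ler_expR mulr_ge0.
Qed.

(** It does not involve the auxiliary level N, which will tend to infinity. *)
Definition gap_cst (T : nat) : R :=
  expR (growth * T%:R) * (growth * (1 + 18 * K ^+ 2 * T%:R)).

Lemma gap_cst_ge0 T : 0 <= gap_cst T.
Proof.
apply: mulr_ge0; first exact: expR_ge0.
apply: mulr_ge0; first exact: growth_ge0.
by rewrite addr_ge0// mulr_ge0// mulr_ge0// sqr_ge0.
Qed.

Lemma horizon n N T : (n <= N)%N -> (T * 16 ^ N = (T * 16 ^ n) * 16 ^ (N - n))%N.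
Proof. by move=> nN; rewrite -mulnA -expnD subnKC. Qed.

Lemma mesh_horizon N T : mesh N * (T * 16 ^ N)%:R = T%:R :> R.
Proof. by rewrite /mesh natrM natrX mulrCA mulVf ?mulr1// expf_neq0. Qed.

Lemma gap_source_sum n N T j : (n <= N)%N -> (j <= T * 16 ^ N)%N ->
  \sum_(l < j) gap_source n N l <= growth * (1 + 18 * K ^+ 2 * T%:R) * mesh n.
Proof.
move=> nN jT; have g0 := growth_ge0.
apply: (@le_trans _ _ (\sum_(l < T * 16 ^ N) gap_source n N l)).
  rewrite -!(big_mkord xpredT) (big_cat_nat (leq0n j) jT)//= lerDl sumr_ge0// => l _.
  exact: gap_source_ge0.
have hE := expected_tick_sum (T * 16 ^ n) nN; rewrite -(horizon T nN) in hE.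
rewrite -mulr_sumr -[leRHS]mulrA; apply: ler_wpM2l => //; rewrite big_split/=.
apply: (le_trans (lerD hE (lexx _))).
rewrite sumr_const card_ord -[X in _ + X]mulr_natr -[X in _ + X]mulrA mesh_horizon.
by rewrite le_eqVlt; apply/orP; left; apply/eqP; ring.
Qed.

Lemma gap_square_bound n N T j : (n < N)%N -> (j <= T * 16 ^ N)%N ->
  (\int[P]_w (gap n N j w ^+ 2)%:E <= (gap_cst T * mesh n)%:E)%E.
Proof.
move=> nN jT; apply: (le_trans (gap_square_le j nN)); rewrite lee_fin /gap_cst.
have g0 := growth_ge0; have m0 := mesh_gt0 (R := R) N.
rewrite -[leRHS]mulrA; apply: ler_pM; rewrite ?expR_ge0//.
- by apply: sumr_ge0 => l _; apply: gap_source_ge0; exact: ltnW.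
  - rewrite ler_expR -(mesh_horizon N T) -[leLHS]mulrA; apply: ler_wpM2l => //.
    by apply: ler_wpM2l; [exact: ltW|rewrite ler_nat].
- exact: (gap_source_sum (ltnW nN)).
Qed.

(** The expected tick is kept as it is, since it is shown to be small only after summation over the
    nodes. *)
Definition coefficient_bound (T n N l : nat) : R :=
  4 * K ^+ 2 * (expected_tick n N l + gap_cst T * mesh n + 18 * K ^+ 2 * mesh n).

Lemma coefficient_gap_expect c T n N l : admissible K rho c -> (n < N)%N ->
  (l <= T * 16 ^ N)%N ->
  let f w := c (node n (cell n N l)) (euler n (cell n N l) w) w -
   c (node n.+1 (cell n.+1 N l)) (euler n.+1 (cell n.+1 N l) w) w in
  measurable_fun setT f ->
  (\int[P]_w (f w ^+ 2)%:E <= (coefficient_bound T n N l)%:E)%E.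
Proof.
move=> c_adm nN lT f mf; have nN' := ltnW nN.
have mg := mhist (@measurable_gap n N l); have mt := mhist (@measurable_tick n N l nN').
have ml := mhist (@measurable_lag n N l nN').
have ml' := mhist (@measurable_lag n.+1 N l nN).
have t0 w : 0 <= tick n N l w by have /andP[] := tick_itv l w nN'.
have K0 : 0 <= 4 * K ^+ 2 by rewrite mulr_ge0// sqr_ge0.
have m1 : measurable_fun setT (fun w => tick n N l w + gap n N l w ^+ 2).
  by apply: measurable_funD => //; exact: measurable_funX.
have m2 : measurable_fun setT (fun w => tick n N l w + gap n N l w ^+ 2 + lag n N l w ^+ 2).
  by apply: measurable_funD => //; exact: measurable_funX.
have m3 : measurable_fun setT (fun w => tick n N l w + gap n N l w ^+ 2 +
    lag n N l w ^+ 2 + lag n.+1 N l w ^+ 2).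
  by apply: measurable_funD => //; exact: measurable_funX.
have p1 w : 0 <= tick n N l w + gap n N l w ^+ 2.
  by apply: addr_ge0 => //; exact: sqr_ge0.
have p2 w : 0 <= tick n N l w + gap n N l w ^+ 2 + lag n N l w ^+ 2.
  by apply: addr_ge0 => //; exact: sqr_ge0.
have p3 w : 0 <= tick n N l w + gap n N l w ^+ 2 + lag n N l w ^+ 2 + lag n.+1 N l w ^+ 2.
  by apply: addr_ge0 => //; exact: sqr_ge0.
apply: (@le_trans _ _ (\int[P]_w (4 * K ^+ 2 * (tick n N l w + gap n N l w ^+ 2 +
    lag n N l w ^+ 2 + lag n.+1 N l w ^+ 2))%:E)%E).
  apply: expect_le; [exact: measurable_funX|exact: measurable_funM|] => w.
  by rewrite sqr_ge0 coefficient_gap_square.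
rewrite expectZ//.
apply: (@le_trans _ _ ((4 * K ^+ 2)%:E * ((expected_tick n N l)%:E +
    (gap_cst T * mesh n)%:E + (9 * K ^+ 2 * mesh n)%:E + (9 * K ^+ 2 * mesh n.+1)%:E))%E).
  apply: lee_wpmul2l; first by rewrite lee_fin.
  rewrite expectD//; [|exact: measurable_funX|by move=> w; exact: sqr_ge0].
  apply: leeD; last exact: lag_square.
  rewrite expectD//; [|exact: measurable_funX|by move=> w; exact: sqr_ge0].
  apply: leeD; last exact: lag_square.
  rewrite expectD//; [|exact: measurable_funX|by move=> w; exact: sqr_ge0].
  by apply: leeD; [rewrite (expected_tickE _ nN').1|exact: gap_square_bound].
rewrite -!EFinD -EFinM lee_fin /coefficient_bound ler_wpM2l//.
have := ler_wpM2l (sqr_ge0 K) (mesh_le (R := R) (leqnSn n)); lra.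
Qed.

Definition coefficient_cst (T : nat) : R :=
  4 * K ^+ 2 * (1 + T%:R * (gap_cst T + 18 * K ^+ 2)).

Lemma coefficient_cst_ge0 T : 0 <= coefficient_cst T.
Proof.
apply: mulr_ge0; first by rewrite mulr_ge0// sqr_ge0.
by rewrite addr_ge0// mulr_ge0// addr_ge0 ?gap_cst_ge0// mulr_ge0// sqr_ge0.
Qed.

Lemma coefficient_bound_sum T n N : (n < N)%N ->
  \sum_(l < T * 16 ^ N) mesh N * coefficient_bound T n N l <= coefficient_cst T * mesh n.
Proof.
move=> nN; rewrite /coefficient_bound /coefficient_cst.
set k := 4 * K ^+ 2; have k0 : 0 <= k by rewrite mulr_ge0// sqr_ge0.
rewrite (eq_bigr (fun l : 'I__ => k * (expected_tick n N l * mesh N +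
  mesh N * ((gap_cst T + 18 * K ^+ 2) * mesh n)))); last by move=> l _; ring.
have hE := expected_tick_sum (T * 16 ^ n) (ltnW nN); rewrite -(horizon T (ltnW nN)) in hE.
rewrite -mulr_sumr -[leRHS]mulrA; apply: ler_wpM2l => //; rewrite big_split/=.
apply: (le_trans (lerD hE (lexx _))).
rewrite sumr_const card_ord -[X in _ + X]mulr_natr mulrAC mesh_horizon.
by rewrite le_eqVlt; apply/orP; left; apply/eqP; ring.
Qed.

Lemma sum_square_le (J : nat) (x : nat -> R) :
  (\sum_(l < J) x l) ^+ 2 <= J%:R * \sum_(l < J) x l ^+ 2.
Proof.
elim: J => [|J IH]; first by rewrite !big_ord0 mulr0 expr0n.
rewrite !big_ord_recr/=; move: IH.
set S := \sum_(l < J) x l; set Q := \sum_(l < J) x l ^+ 2; set y := x J => IH.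
have Q0 : 0 <= Q by apply: sumr_ge0 => l _; exact: sqr_ge0.
rewrite -natr1; set k : R := J%:R in IH *.
have [J0|J0] := posnP J.
  have S0 : S = 0 by rewrite /S; move: J0 => ->; rewrite big_ord0.
  by rewrite S0 /k J0 mulr0n !add0r mul1r lerDr.
have k0 : 0 < k by rewrite ltr0n.
have h : 2 * S * y <= Q + k * y ^+ 2.
  rewrite -(ler_pM2l k0).
  have := sqr_ge0 (S - k * y); rewrite !expr2 in IH *; lra.
rewrite !expr2 in IH h *; lra.
Qed.

Definition gap_event (T n N : nat) (l : R) : set Omega :=
  [set w | exists2 j, (j <= T * 16 ^ N)%N & 2 * l < `|gap n N j w|].

Lemma measurable_gap_event T n N l : measurable (gap_event T n N l).
Proof.
have -> : gap_event T n N l =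
    \bigcup_(j in [set j | (j <= T * 16 ^ N)%N]) [set w | 2 * l < `|gap n N j w|].
  by apply/seteqP; split => w [j jJ lj]; exists j.
apply: bigcup_measurable => j _; apply: measurable_lt_norm.
exact: (mhist (@measurable_gap n N j)).
Qed.

(** By [gap_transform] the gap is a drift sum plus a martingale transform; each is allowed the
    threshold l, whence the 2 * l of the event. Chebyshev and Cauchy-Schwarz treat the sum of the
    absolute drift gaps and the maximal inequality treats the transform; they contribute the terms T
    and 8 of the constant. *)
Lemma gap_probability T n N l : (n < N)%N -> 0 < l ->
  (P (gap_event T n N l) <= (l ^- 2 * ((8 + T%:R) * coefficient_cst T * mesh n))%:E)%E.
Proof.
move=> nN l0; have m0 := mesh_gt0 (R := R) N; set J := (T * 16 ^ N)%N.
have l2 : 0 <= l ^- 2 by rewrite invr_ge0 exprn_ge0// ltW.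
have mdr j := mhist (@measurable_drift_gap n N j nN).
have mdi j := mhist (@measurable_diffusion_gap n N j nN).
pose V w := \sum_(k < J) `|drift_gap n N k w| * mesh N.
have mV : measurable_fun setT V.
  apply: measurable_sum => k; apply: measurable_funM => //.
  exact: measurableT_comp.
have V0 w : 0 <= V w by apply: sumr_ge0 => k _; rewrite mulr_ge0// ltW.
have pred : predictable P W (mesh N) (diffusion_gap n N).
  by move=> j; exact: measurable_diffusion_gap.
pose B := [set w | l < `|V w|].
have mB : measurable B by exact: measurable_lt_norm.
have mC : measurable (crossing W (mesh N) (diffusion_gap n N) l J).
  by apply: (@history_measurable _ _ _ P W W_brownian (node N J)); exact: measurable_crossing.
have sub : gap_event T n N l `<=` B `|` crossing W (mesh N) (diffusion_gap n N) l J.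
  move=> w [j jJ lj]; have [Bw|nBw] := pselect (B w); first by left.
  right; exists j => //; rewrite ltNge; apply/negP => tl.
  have /negP := nBw; rewrite -leNgt ger0_norm// => Vl.
  move: lj; rewrite ltNge => /negP; apply; rewrite (gap_transform _ _ nN).
  apply: (le_trans (ler_normD _ _)).
  have -> : 2 * l = l + l by ring.
  apply: lerD => //; apply: le_trans Vl; apply: (le_trans (ler_norm_sum _ _ _)).
  rewrite /V -!(big_mkord xpredT (fun k => `|drift_gap n N k w| * mesh N)).
  rewrite (big_cat_nat (leq0n j) jJ)//= big_mkord.
  rewrite (eq_bigr (fun k : 'I_j => `|drift_gap n N k w| * mesh N)); last first.
    by move=> k _; rewrite normrM (gtr0_norm m0).
  by rewrite lerDl sumr_ge0// => k _; rewrite mulr_ge0// ltW.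
apply: (@le_trans _ _ (P B + P (crossing W (mesh N) (diffusion_gap n N) l J))%E).
  apply: le_trans (le_measure _ _ _ sub) _; rewrite ?inE//.
  - exact: measurable_gap_event.
  - exact: measurableU.
  - exact: measureU2.
have hB : (P B <= (l ^- 2 * (T%:R * (coefficient_cst T * mesh n)))%:E)%E.
  apply: (le_trans (chebyshev_square P mB mV l0 _)); first by move=> w /ltW.
  rewrite EFinM; apply: lee_wpmul2l; first by rewrite lee_fin.
  apply: (@le_trans _ _ (\int[P]_w (T%:R * \sum_(k < J) mesh N * drift_gap n N k w ^+ 2)%:E)%E).
    apply: expect_le.
    - exact: measurable_funX.
    - apply: measurable_funM => //; apply: measurable_sum => k.
      by apply: measurable_funM => //; exact: measurable_funX.
    - move=> w; rewrite sqr_ge0/=.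
      apply: (le_trans (sum_square_le J (fun k => `|drift_gap n N k w| * mesh N))).
      rewrite -(mesh_horizon N T) -/J (mulrC (mesh N)) -mulrA ler_wpM2l// mulr_sumr.
      apply: ler_sum => k _; rewrite exprMn real_normK ?num_real//.
      by rewrite le_eqVlt; apply/orP; left; apply/eqP; ring.
  rewrite expectZ//; last 2 first.
  - apply: measurable_sum => k.
    by apply: measurable_funM => //; exact: measurable_funX.
  - by move=> w; apply: sumr_ge0 => k _; rewrite mulr_ge0 ?sqr_ge0// ltW.
  rewrite EFinM; apply: lee_wpmul2l; first by rewrite lee_fin.
  rewrite (@expect_sum _ _ _ P J (fun k w => mesh N * drift_gap n N k w ^+ 2)); last 2 first.
  - by move=> k; apply: measurable_funM => //; exact: measurable_funX.
  - by move=> k w; rewrite mulr_ge0 ?sqr_ge0// ltW.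
  apply: (@le_trans _ _ (\sum_(k < J) (mesh N * coefficient_bound T n N k)%:E)%E).
    apply: lee_sum => k _; rewrite expectZ ?(ltW m0)//; last 2 first.
    - exact: measurable_funX.
    - by move=> w; exact: sqr_ge0.
    rewrite EFinM; apply: lee_wpmul2l; first by rewrite lee_fin ltW.
    exact: (coefficient_gap_expect a_adm nN (ltnW (ltn_ord k)) (mdr k)).
  by rewrite sumEFin lee_fin; exact: coefficient_bound_sum.
have hC : (P (crossing W (mesh N) (diffusion_gap n N) l J) <=
    (l ^- 2 * (8 * (coefficient_cst T * mesh n)))%:E)%E.
  apply: (le_trans (maximal_inequality W_brownian m0 J pred l0)).
  rewrite [leRHS]EFinM; apply: lee_wpmul2l; first by rewrite lee_fin.
  apply: (@le_trans _ _ (\sum_(k < J) (8 * (mesh N * coefficient_bound T n N k))%:E)%E).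
    apply: lee_sum => k _; rewrite mulrA [leRHS]EFinM.
    apply: lee_wpmul2l; first by rewrite lee_fin mulr_ge0// ltW.
    exact: (coefficient_gap_expect b_adm nN (ltnW (ltn_ord k)) (mdi k)).
  rewrite sumEFin lee_fin -mulr_sumr ler_wpM2l//.
  exact: coefficient_bound_sum.
apply: (le_trans (leeD hB hC)); rewrite -EFinD lee_fin.
by rewrite le_eqVlt; apply/orP; left; apply/eqP; ring.
Qed.

End Euler.

(** * Continuous paths and grid times *)

Section Paths.
Context {R : realType}.
Implicit Types (y z : R -> R).

Definition path_continuous y : Prop := forall s : R, 0 <= s -> forall e : R, 0 < e ->
  exists2 dl : R, 0 < dl & forall r : R, 0 <= r -> `|r - s| < dl -> `|y r - y s| < e.

Lemma path_continuousP y : path_continuous y <-> {within `[0, +oo[, continuous y}.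
Proof.
split => [cy|/subspace_continuousP cy s s0 e e0].
  apply/subspace_continuousP => s; rewrite /= in_itv/= andbT => s0.
  apply/cvgrPdist_lt => e e0; have [dl dl0 h] := cy s s0 e e0.
  rewrite near_withinE; exists dl => //= r /= rs; rewrite in_itv/= andbT => r0.
  by rewrite distrC; apply: h => //; rewrite distrC.
have : s \in `[0, +oo[ by rewrite in_itv/= s0.
move=> /cy /cvgrPdist_lt /(_ e e0); rewrite near_withinE => -[dl /= dl0 h].
exists dl => // r r0 rs; rewrite distrC; apply: h; first by rewrite /= distrC.
by rewrite in_itv/= r0.
Qed.

Lemma path_continuous_cvg y (s : R) (u : nat -> R) : path_continuous y -> 0 <= s ->
  (forall n, 0 <= u n) -> u n @[n --> \oo] --> s -> y (u n) @[n --> \oo] --> y s.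
Proof.
move=> cy s0 u0 us; apply/cvgrPdist_lt => e e0; have [dl dl0 h] := cy s s0 e e0.
move/cvgrPdist_lt : us => /(_ dl dl0); apply: filterS => n un.
by rewrite distrC; apply: h => //; rewrite distrC.
Qed.

Lemma path_continuousD y z : path_continuous y -> path_continuous z ->
  path_continuous (fun s => y s + z s).
Proof.
move=> cy cz s s0 e e0; have e2 : 0 < e / 2 by rewrite divr_gt0.
have [d1 d10 h1] := cy s s0 _ e2; have [d2 d20 h2] := cz s s0 _ e2.
exists (Num.min d1 d2); first by rewrite lt_min d10.
move=> r r0; rewrite lt_min => /andP[/(h1 r r0) k1 /(h2 r r0) k2].
rewrite (_ : _ - _ = (y r - y s) + (z r - z s)); last by ring.
by apply: (le_lt_trans (ler_normD _ _)); rewrite [e]splitr ltrD.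
Qed.

Lemma mesh_cvg0 : mesh n @[n --> \oo] --> (0 : R).
Proof.
have -> : mesh = (fun n => 1 * 16^-1 ^+ n) :> (nat -> R).
  by apply/funext => n; rewrite /mesh mul1r exprVn.
by apply: cvg_geometric; rewrite ger0_norm// invf_lt1// ltr1n.
Qed.

Lemma floor_node_cvg (s : R) : 0 <= s -> node n (floor_index n s) @[n --> \oo] --> s.
Proof.
move=> s0; apply/cvgrPdist_lt => e e0.
move/cvgrPdist_lt : mesh_cvg0 => /(_ e e0); apply: filterS => n.
have := floor_indexP n s0; rewrite nodeS => /andP[h1 h2].
rewrite sub0r normrN (gtr0_norm (mesh_gt0 n)) => he.
by rewrite ger0_norm ?subr_ge0//; lra.
Qed.

(** If s is a node, the times just before and just after it lie in different cells, so the cell has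
    to depend on r; it still contains s because cells are taken closed. *)
Lemma common_cell n (s : R) : 0 <= s ->
  exists2 dl : R, 0 < dl & forall r, 0 <= r -> `|r - s| < dl ->
    exists k, node n k <= r <= node n k.+1 /\ node n k <= s <= node n k.+1.
Proof.
move=> s0; set k := floor_index n s; have /andP[h1 h2] := floor_indexP n s0.
have m0 := mesh_gt0 (R := R) n; rewrite -/k in h1 h2.
have [sk|sk] := eqVneq (node n k) s.
  exists (mesh n) => // r r0; rewrite ltr_norml => /andP[r1 r2].
  have [rs|sr] := leP s r.
    by exists k; rewrite !nodeS in h2 *; rewrite -sk; split; apply/andP; split; lra.
  have : (0 < k)%N.
    rewrite lt0n; apply/eqP => k0; move: sk; rewrite k0 node0 => sk.
    by move: sr; rewrite -sk ltNge r0.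
  case: k h1 h2 sk => // k h1 h2 sk _; exists k.
  by rewrite nodeS in sk; rewrite nodeS -sk; split; apply/andP; split; lra.
have {}h1 : node n k < s by rewrite lt_neqAle sk.
exists (Num.min (s - node n k) (node n k.+1 - s)).
  by rewrite lt_min !subr_gt0 h1.
move=> r r0; rewrite lt_min !ltr_norml => /andP[/andP[a1 a2] /andP[a3 a4]].
by exists k; split; apply/andP; split; lra.
Qed.

End Paths.

(** * The almost sure limit of the schemes *)

Section EulerLimit.
Context {d : measure_display} {Omega : measurableType d} {R : realType}.
Variables (P : probability Omega R) (W : R -> Omega -> R).
Variables (a b : R -> R -> Omega -> R) (K : R) (rho : R -> Omega -> R).
Hypothesis W_brownian : brownian_motion P W.
Hypothesis rho_clock : clock P W rho.
Hypothesis K_ge1 : 1 <= K.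
Hypothesis a_adm : admissible P W K rho a.
Hypothesis b_adm : admissible P W K rho b.

Local Notation history := (history P W).
Local Notation euler_at := (euler_at W a b).
Local Notation gap := (gap W a b).
Local Notation gap_event := (gap_event W a b).

Let K_ge0 : 0 <= K. Proof. exact: le_trans K_ge1. Qed.

Lemma euler_at_path n w : path_continuous (W ^~ w) -> path_continuous ((euler_at n) ^~ w).
Proof.
move=> cW s s0 e e0; have [d1 d10 h1] := common_cell n s0.
have e' : 0 < e / (2 * K) by rewrite divr_gt0// mulr_gt0// (lt_le_trans _ K_ge1).
have [d2 d20 h2] := cW s s0 _ e'.
exists (Num.min d1 (Num.min d2 (e / (2 * K)))).
  by rewrite !lt_min d10 d20.
move=> r r0; rewrite !lt_min => /andP[/(h1 r r0)[k [rk sk]] /andP[/(h2 r r0) k2 k3]].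
rewrite (euler_at_cell _ _ _ _ rk) (euler_at_cell _ _ _ _ sk).
set D := drift _ _ _ _ _ _; set S := diffusion _ _ _ _ _ _.
rewrite (_ : _ - _ = D * (r - s) + S * (W r w - W s w)); last by ring.
apply: (le_lt_trans (ler_normD _ _)); rewrite !normrM.
have hD : `|D| <= K by exact: (admissible_bound a_adm _ _ (node_ge0 n k)).
have hS : `|S| <= K by exact: (admissible_bound b_adm _ _ (node_ge0 n k)).
have K0 : 0 < K by exact: lt_le_trans K_ge1.
apply: (@le_lt_trans _ _ (K * `|r - s| + K * `|W r w - W s w|)).
  by apply: lerD; apply: ler_wpM2r.
rewrite -mulrDr; apply: (@lt_le_trans _ _ (K * (e / (2 * K) + e / (2 * K)))).
  by rewrite ltr_pM2l// ltrD.
by rewrite le_eqVlt; apply/orP; left; apply/eqP; field; rewrite gt_eqF.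
Qed.

Lemma gap_event_mono T n l : {homo (fun N => gap_event T n N l) : N M / (N <= M)%N >-> N `<=` M}.
Proof.
move=> N M NM w [j jT lj]; exists (j * 16 ^ (M - N))%N.
  by rewrite (leq_trans (leq_mul jT (leqnn _)))// -mulnA -expnD subnKC.
by rewrite /gap -node_scale.
Qed.

(** The union catches a large gap at the nodes of every grid; the levels start at n.+1 so that the
    grid refines those of both schemes. *)
Definition bad_event (T n : nat) : set Omega :=
  \bigcup_N gap_event T n (n.+1 + N)%N (2 ^- n).

Lemma measurable_bad_event T n : measurable (bad_event T n).
Proof. by apply: bigcup_measurable => N _; apply: measurable_gap_event; eassumption. Qed.

Definition bad_cst (T : nat) : R := (8 + T%:R) * coefficient_cst K T.

Lemma bad_cst_ge0 T : 0 <= bad_cst T.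
Proof. by rewrite mulr_ge0 ?addr_ge0// coefficient_cst_ge0. Qed.

(** The events increase with the level of the grid, so their bound, uniform in that level, passes to
    the union. *)
Lemma bad_event_le T n : (P (bad_event T n) <= (bad_cst T * 2 ^- n)%:E)%E.
Proof.
have mG N : measurable (gap_event T n (n.+1 + N)%N (2 ^- n)).
  by apply: measurable_gap_event; eassumption.
have c0 := bad_cst_ge0 T.
have bound N : (P (gap_event T n (n.+1 + N)%N (2 ^- n)) <= (bad_cst T * 2 ^- n)%:E)%E.
  apply: (le_trans (gap_probability W_brownian rho_clock K_ge1 a_adm b_adm T _ _)).
  - by rewrite leq_addr.
  - by rewrite invr_gt0 exprn_gt0.
  rewrite lee_fin -/(bad_cst T) mulrCA; apply: ler_wpM2l => //.
  have -> : mesh n = (2 ^- n) ^+ 4 :> R.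
    have e16 : 2 ^+ 4 = 16 :> R by rewrite -natrX.
    by rewrite /mesh -e16 exprVn -!exprM mulnC.
  set x : R := 2 ^- n.
  have x0 : 0 < x by rewrite invr_gt0 exprn_gt0.
  have x1 : x <= 1 by rewrite invf_le1 ?exprn_gt0// exprn_ege1// ler1n.
  have -> : x ^- 2 * x ^+ 4 = x * x by field; rewrite gt_eqF.
  by rewrite ler_piMr// ltW.
have cG : P (gap_event T n (n.+1 + N)%N (2 ^- n)) @[N --> \oo] --> P (bad_event T n).
  apply: (nondecreasing_cvg_mu (mu := P)) => //; first exact: measurable_bad_event.
  by move=> N M NM; apply/subsetPset; apply: gap_event_mono; rewrite leq_add2l.
rewrite -(cvg_lim _ cG)//; apply: lime_le; first exact: (cvgP _ cG).
by apply: nearW => N; exact: bound.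
Qed.

Lemma bad_event_null T : P (lim_sup_set (bad_event T)) = 0%E.
Proof.
apply: lim_sup_set_cvg0; first by move=> n; exact: measurable_bad_event.
apply: (@le_lt_trans _ _ (bad_cst T * 2)%:E); last exact: ltry.
apply: lime_le; first by apply: is_cvg_nneseries => n _ _; exact: measure_ge0.
apply: nearW => m; rewrite big_mkord.
apply: (@le_trans _ _ (\sum_(i < m) (bad_cst T * 2 ^- i)%:E)%E).
  by apply: lee_sum => i _; exact: bad_event_le.
rewrite sumEFin lee_fin -mulr_sumr ler_wpM2l ?bad_cst_ge0//.
suff -> : \sum_(i < m) 2 ^- i = 2 - 2 * 2 ^- m :> R.
  by rewrite gerBl mulr_ge0// invr_ge0 exprn_ge0.
elim: m => [|m IH]; first by rewrite big_ord0 expr0 invr1 mulr1 subrr.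
rewrite big_ord_recr/= IH exprS; field.
by rewrite expf_neq0.
Qed.

(** Every time is a limit of nodes of ever finer grids and both interpolations are continuous, so
    the bound at the nodes extends to all times. *)
Lemma euler_gap_bound T n w : path_continuous (W ^~ w) -> ~ bad_event T n w ->
  forall s, 0 <= s <= T%:R -> `|euler_at n s w - euler_at n.+1 s w| <= 2 * 2 ^- n.
Proof.
move=> cW nb s /andP[s0 sT].
pose u N : R := node (n.+1 + N)%N (floor_index (n.+1 + N)%N s).
have us : u N @[N --> \oo] --> s.
  have := floor_node_cvg s0; rewrite -(cvg_shiftn n.+1) => h.
  apply: cvg_trans h; apply: near_eq_cvg; apply: nearW => N.
  by rewrite /u addnC.
have cn : (euler_at n (u N) w - euler_at n.+1 (u N) w) @[N --> \oo] -->
    euler_at n s w - euler_at n.+1 s w.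
  have u0 N : 0 <= u N by exact: node_ge0.
  have cv k := path_continuous_cvg (@euler_at_path k w cW) s0 u0 us.
  exact: cvgB (cv n) (cv n.+1).
have cnn : `|euler_at n (u N) w - euler_at n.+1 (u N) w| @[N --> \oo] -->
    `|euler_at n s w - euler_at n.+1 s w| by exact: cvg_norm.
rewrite -(cvg_lim _ cnn)//; apply: limr_le; first exact: (cvgP _ cnn).
apply: nearW => N; rewrite leNgt; apply/negP => h; apply: nb; exists N => //.
exists (floor_index (n.+1 + N)%N s) => //.
have /andP[h1 _] := floor_indexP (n.+1 + N)%N s0.
rewrite -(ler_nat R) -(ler_pM2r (mesh_gt0 (n.+1 + N))).
apply: (le_trans h1); apply: (le_trans sT).
by rewrite -[leLHS](mesh_horizon (n.+1 + N) T) mulrC.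
Qed.

(** The right-hand side is the sum of the geometric bounds [2 * 2 ^- k] for n <= k < m. *)
Lemma euler_cauchy n m w (s : R) : (n <= m)%N ->
  (forall k, (n <= k)%N -> `|euler_at k s w - euler_at k.+1 s w| <= 2 * 2 ^- k) ->
  `|euler_at n s w - euler_at m s w| <= 4 * (2 ^- n - 2 ^- m).
Proof.
move=> nm h; rewrite -(subnKC nm); elim: (m - n)%N => [|k IH].
  by rewrite addn0 !subrr normr0 mulr0.
rewrite addnS -(subrKA (euler_at (n + k) s w)).
apply: (le_trans (ler_normD _ _)); have := h (n + k)%N (leq_addr _ _).
have -> : 2 ^- (n + k) = 2 * 2 ^- (n + k).+1 :> R.
  by rewrite exprS; field; rewrite expf_neq0.
have : 2 ^- (n + k) = 2 * 2 ^- (n + k).+1 :> R.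
  by rewrite exprS; field; rewrite expf_neq0.
move: IH; set x : R := 2 ^- (n + k); set y : R := 2 ^- (n + k).+1.
move=> *; lra.
Qed.

(* On the null event N0 the limit is replaced by 0, so that all the paths of Z are
   continuous. *)
Lemma euler_limit : exists (N0 : set Omega) (Z : R -> Omega -> R),
  [/\ measurable N0, P N0 = 0%E,
      forall w, ~ N0 w -> path_continuous (W ^~ w),
      forall t, 0 <= t -> measurable_fun setT (Z t : history t -> R) &
      (forall w, path_continuous (Z ^~ w)) /\
      forall w, ~ N0 w -> forall T : nat, exists n0, forall n, (n0 <= n)%N ->
        forall s, 0 <= s <= T%:R -> `|euler_at n s w - Z s w| <= 4 * 2 ^- n].
Proof.
have [N1 [mN1 PN1 hN1]] := brownian_continuous W_brownian.
pose N0 := N1 `|` \bigcup_T lim_sup_set (bad_event T).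
have mB T : measurable (lim_sup_set (bad_event T)).
  apply: bigcap_measurable => // n _; apply: bigcup_measurable => j _.
  exact: measurable_bad_event.
have mN0 : measurable N0 by apply: measurableU => //; exact: bigcup_measurable.
have PN0 : P N0 = 0%E.
  apply/negligibleP => //; apply: negligibleU; first exact/negligibleP.
  by apply: negligible_bigcup => T; apply/negligibleP => //; exact: bad_event_null.
have cW w : ~ N0 w -> path_continuous (W ^~ w).
  move=> nw; apply/path_continuousP; apply: contrapT => nc; apply: nw; left.
  exact: hN1.
have ev w : ~ N0 w -> forall T : nat, exists n0, forall n, (n0 <= n)%N ->
    forall s, 0 <= s <= T%:R -> `|euler_at n s w - euler_at n.+1 s w| <= 2 * 2 ^- n.
  move=> nw T; have cw := cW w nw.
  apply: contrapT => ne; apply: nw; right; exists T => // n0 _.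
  apply: contrapT => nb; apply: ne; exists n0 => n n0n s sT.
  apply: (@euler_gap_bound T) => //.
  by move=> bn; apply: nb; exists n.
have unif w : ~ N0 w -> forall T : nat, exists n0, forall n m, (n0 <= n)%N -> (n <= m)%N ->
    forall s, 0 <= s <= T%:R -> `|euler_at n s w - euler_at m s w| <= 4 * 2 ^- n.
  move=> nw T; have [n0 h] := ev w nw T; exists n0 => n m n0n nm s sT.
  apply: (le_trans (euler_cauchy nm _)); first by move=> k nk; apply: h => //; exact: leq_trans nk.
  by rewrite ler_wpM2l// gerBl invr_ge0 exprn_ge0.
have half_cvg0 : (2 ^- n : R) @[n --> \oo] --> (0 : R).
  have -> : (fun n => 2 ^- n) = (fun n => 1 * 2^-1 ^+ n) :> (nat -> R).
    by apply/funext => n; rewrite mul1r exprVn.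
  by apply: cvg_geometric; rewrite ger0_norm// invf_lt1// ltr1n.
have small e : 0 < e -> exists n1, forall n, (n1 <= n)%N -> 4 * 2 ^- n < e :> R.
  move=> e0; have e4 : 0 < e / 4 by rewrite divr_gt0.
  move/cvgrPdist_lt : half_cvg0 => /(_ _ e4) [n1 _ h]; exists n1 => n /h.
  rewrite /= sub0r normrN gtr0_norm ?invr_gt0 ?exprn_gt0//.
  by rewrite ltr_pdivlMr// mulrC.
have hT (s : R) : 0 <= s -> 0 <= s <= (Num.truncn s).+1%:R.
  by move=> s0; rewrite s0 ltW// truncnS_gt.
have cE w s : ~ N0 w -> 0 <= s -> cvgn (fun n => euler_at n s w).
  move=> nw s0; apply/cauchy_cvgP; apply: cauchy_exP => e e0.
  have [n1 h1] := small e e0; have [n0 h] := unif w nw (Num.truncn s).+1.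
  exists (euler_at (maxn n0 n1) s w); exists (maxn n0 n1) => // m /= nm.
  apply: (@le_lt_trans _ _ (4 * 2 ^- maxn n0 n1)); last by apply: h1; exact: leq_maxr.
  by apply: h => //; [exact: leq_maxl|exact: hT].
pose Z s w := if w \in N0 then 0 else limn (fun n => euler_at n s w).
have ZE w : N0 w -> Z ^~ w = fun=> 0.
  by move=> /mem_set Nw; apply/funext => s; rewrite /Z Nw.
have ZnE w s : ~ N0 w -> Z s w = limn (fun n => euler_at n s w).
  by move=> nw; rewrite /Z memNset.
have bnd w : ~ N0 w -> forall T : nat, exists n0, forall n, (n0 <= n)%N ->
        forall s, 0 <= s <= T%:R -> `|euler_at n s w - Z s w| <= 4 * 2 ^- n.
  move=> nw T; have [n0 h] := unif w nw T; exists n0 => n n0n s sT.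
  have /andP[s0 _] := sT; rewrite ZnE//.
  have cm : `|euler_at n s w - euler_at m s w| @[m --> \oo] -->
      `|euler_at n s w - limn (fun n => euler_at n s w)|.
    by apply: cvg_norm; apply: cvgB; [exact: cvg_cst|exact: cE].
  rewrite -(cvg_lim _ cm)//; apply: limr_le; first exact: (cvgP _ cm).
  by near=> m; apply: h => //; near: m; exact: nbhs_infty_ge.
exists N0, Z; split=> //.
- move=> t t0.
  (* The augmented filtration contains the null events at every time, so the values imposed on N0
     keep Z adapted. *)
  have mN0h : measurable (N0 : set (history t)) by exact: history_null.
  apply: (@measurable_fun_cvg _ (history t) R setT
      (fun n w => if w \in N0 then 0 else euler_at n t w)).
    move=> n; apply: measurable_fun_if => //.
    + apply: (measurable_fun_bool true); rewrite setTI.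
      rewrite (_ : _ @^-1` _ = N0)//.
      by apply/seteqP; split => w /= => [/set_mem|/mem_set].
    + by apply: measurable_funTS; apply: measurable_euler_at; eassumption.
  move=> w _; rewrite /Z; case: (boolP (w \in N0)) => [wN|].
    exact: cvg_cst.
  rewrite notin_setE => nw.
  exact: cE.
split=> [w|//].
have [Nw|nw] := pselect (N0 w).
  rewrite ZE// => s s0 e e0; exists 1 => // r r0 _.
  by rewrite subrr normr0.
move=> s s0 e e0; have e3 : 0 < e / 3 by rewrite divr_gt0.
(* The horizon exceeds s + 1, so the uniform estimate covers all r within distance 1 of s. *)
have [n1 h1] := small _ e3; have [n0 h] := bnd w nw (Num.truncn (s + 1)).+1.
pose n := maxn n0 n1.
have [dl dl0 hd] := @euler_at_path n w (cW w nw) s s0 _ e3.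
exists (Num.min 1 dl); first by rewrite lt_min ltr01.
move=> r r0; rewrite lt_min => /andP[rs1 rs].
have hs := truncnS_gt (s + 1).
have a1 := h n (leq_maxl _ _) r; have a2 := h n (leq_maxl _ _) s.
have {}a1 : `|euler_at n r w - Z r w| <= 4 * 2 ^- n.
  apply: a1; rewrite r0/=; apply: le_trans (ltW hs).
  by move: rs1; rewrite ltr_norml => /andP[_]; lra.
have {}a2 : `|euler_at n s w - Z s w| <= 4 * 2 ^- n.
  by apply: a2; rewrite s0/=; apply: le_trans (ltW hs); rewrite lerDl.
have a3 := hd r r0 rs; have a4 := h1 n (leq_maxr _ _).
rewrite (_ : Z r w - Z s w = - (euler_at n r w - Z r w) +
  (euler_at n r w - euler_at n s w) + (euler_at n s w - Z s w)); last by ring.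
apply: (le_lt_trans (ler_normD _ _)).
apply: (le_lt_trans (lerD (ler_normD _ _) (lexx _))); rewrite normrN.
lra.
Unshelve. all: by end_near.
Qed.

End EulerLimit.

(** * Convergence in probability *)

Section ConvergenceInProbability.
Context {d : measure_display} {Omega : measurableType d} {R : realType}.
Variable P : probability Omega R.
Implicit Types (Y : nat -> Omega -> \bar R) (u : nat -> \bar R).
Local Open Scope ereal_scope.

Lemma cvge0P u : (forall n, 0 <= u n) ->
  (u n @[n --> \oo] --> 0) <->
  (forall e : R, (0 < e)%R -> exists n0, forall n, (n0 <= n)%N -> u n <= e%:E).
Proof.
move=> u0; split=> [cu e e0|h].
  have : nbhs (0 : \bar R) [set y | y < e%:E].
    by apply: open_nbhs_nbhs; split; [exact: open_ereal_lt_ereal|rewrite /= lte_fin].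
  by move=> /cu[n0 _ hn]; exists n0 => n /hn/ltW.
apply/fine_cvgP; split.
  have [n0 hn] := h 1%R ltr01; exists n0 => // n /= /hn un.
  by rewrite ge0_fin_numE// (le_lt_trans un)// ltry.
apply/cvgrPdist_le => e e0; have [n0 hn] := h e e0; exists n0 => // n /= /hn un.
have fu : u n \is a fin_num by rewrite ge0_fin_numE// (le_lt_trans un)// ltry.
rewrite sub0r normrN ger0_norm; last by rewrite fine_ge0.
by rewrite -lee_fin fineK.
Qed.

Lemma outer_probability_ge0 (A : set Omega) : 0 <= (P^*)%mu A.
Proof. exact: mu_ext_ge0. Qed.

Lemma cvg_in_probabilityP Y : cvg_to_0_in_probability P Y <->
  (forall C e : R, (0 < C)%R -> (0 < e)%R -> exists n0, forall n, (n0 <= n)%N ->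
    (P^*)%mu [set w | C%:E < Y n w] <= e%:E).
Proof.
have u0 C n : 0 <= (P^*)%mu [set w | C%:E < Y n w] by exact: outer_probability_ge0.
split=> [h C e C0 e0|h C C0]; first exact: ((cvge0P (u0 C)).1 (h C C0) e e0).
by apply/(cvge0P (u0 C)) => e; exact: h.
Qed.

Lemma outer_probabilityU (A B : set Omega) :
  (P^*)%mu (A `|` B) <= (P^*)%mu A + (P^*)%mu B.
Proof. exact: (outer_measureU2 ((P^*)%mu)). Qed.

Lemma outer_probability_null (N : set Omega) : P.-negligible N -> (P^*)%mu N = 0.
Proof.
move=> [B [mB PB NB]]; apply/eqP; rewrite eq_le outer_probability_ge0 andbT -PB.
by rewrite -(measurable_mu_extE P mB); exact: le_mu_ext.
Qed.

Lemma ae_off_null (N : set Omega) (Q : Omega -> Prop) : measurable N -> P N = 0 ->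
  (forall w, ~ N w -> Q w) -> {ae P, forall w, Q w}.
Proof. by move=> mN PN h; exists N; split=> // w /= nQ; apply: contrapT => /h. Qed.

Lemma cvg_in_probability_le Y Y' : {ae P, forall w, forall n, Y' n w <= Y n w} ->
  cvg_to_0_in_probability P Y -> cvg_to_0_in_probability P Y'.
Proof.
move=> hN /cvg_in_probabilityP h; apply/cvg_in_probabilityP => C e C0 e0.
have [n0 hn] := h C e C0 e0; exists n0 => n n0n.
apply: le_trans (hn n n0n).
pose N := ~` [set w | forall n, Y' n w <= Y n w].
rewrite -[leRHS]adde0 -(outer_probability_null (hN : P.-negligible N)).
apply: le_trans (outer_probabilityU _ _); apply: le_mu_ext => w /= Cw.
have [Nw|nN] := pselect (N w); [by right|left].
have hw : forall k, Y' k w <= Y k w by exact: contrapT.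
exact: lt_le_trans Cw (hw n).
Qed.

Lemma cvg_in_probabilityD Y Y' : cvg_to_0_in_probability P Y ->
  cvg_to_0_in_probability P Y' ->
  cvg_to_0_in_probability P (fun n w => Y n w + Y' n w).
Proof.
move=> /cvg_in_probabilityP h /cvg_in_probabilityP h'.
apply/cvg_in_probabilityP => C e C0 e0.
have C2 : (0 < C / 2)%R by rewrite divr_gt0.
have e2 : (0 < e / 2)%R by rewrite divr_gt0.
have [n0 hn] := h _ _ C2 e2; have [n1 hn'] := h' _ _ C2 e2.
exists (maxn n0 n1) => n; rewrite geq_max => /andP[/hn k /hn' k'].
rewrite [e]splitr EFinD; apply: le_trans (leeD k k').
apply: le_trans (outer_probabilityU _ _); apply: le_mu_ext => w /= Cw.
have [?|le1] := ltP (C / 2)%:E (Y n w); first by left.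
have [?|le2] := ltP (C / 2)%:E (Y' n w); first by right.
by exfalso; move: Cw; rewrite ltNge => /negP; apply; rewrite [C]splitr EFinD leeD.
Qed.

(** The event that Y n exceeds C lies in the n-th tail union; these unions decrease to
    [lim_sup_set], which is contained in N. *)
Lemma cvg_in_probability_ae Y (N : set Omega) : (forall n, measurable_fun setT (Y n)) ->
  measurable N -> P N = 0 -> (forall w, ~ N w -> Y n w @[n --> \oo] --> 0) ->
  (forall n w, 0 <= Y n w) ->
  cvg_to_0_in_probability P Y.
Proof.
move=> mY mN PN cY Y0; apply/cvg_in_probabilityP => C e C0 e0.
pose A n := [set w | C%:E < Y n w].
have mA n : measurable (A n).
  rewrite -[A n]setTI; exact: emeasurable_fun_o_infty.
have cA := lim_sup_set_cvg P A mA.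
have {cA} cA : P (\bigcup_(k >= n) A k) @[n --> \oo] --> 0.
  have <- : P (lim_sup_set A) = 0.
    apply/eqP; rewrite eq_le measure_ge0 andbT -PN; apply: le_measure.
    - rewrite inE; apply: bigcap_measurable => // k _.
      by apply: bigcup_measurable => j _; exact: mA.
    - by rewrite inE.
    move=> w Aw; apply: contrapT => nw.
    have /(cvge0P (fun n => Y0 n w)) /(_ C C0) [n0 hn] := cY w nw.
    have [k /= n0k] := Aw n0 I; rewrite /A /= ltNge => /negP; apply; exact: hn.
  apply: cA; apply: (@le_lt_trans _ _ 1); last exact: ltry.
  by apply: probability_le1; apply: bigcup_measurable => j _; exact: mA.
have /(_ e e0) [n0 hn] := (cvge0P (fun n => measure_ge0 P _)).1 cA.
exists n0 => n /hn; apply: le_trans.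
rewrite (measurable_mu_extE P (mA n)); apply: le_measure; rewrite ?inE//.
  by apply: bigcup_measurable => j _; exact: mA.
by move=> w Aw; exists n => /=.
Qed.

End ConvergenceInProbability.

(** * Exit times *)

Section Hitting.
Context {R : realType}.
Implicit Types (y : R -> R) (c s t : R).

Definition hit c y t : Prop := exists s, 0 <= s <= t /\ c <= `|y s|.

Definition exit_at c y : \bar R := first_time [set t | 0 <= t] (fun t => c <= `|y t|).

(* [stopped z tau t] is [z (stop_at tau t)]. *)
Definition stop_at (tau : \bar R) (t : R) : R := fine (Order.min t%:E tau).

Lemma exit_at_ge0 c y : (0 <= exit_at c y)%E.
Proof. by apply: le_ereal_inf_tmp => _ [t [/= t0 _] <-]; rewrite lee_fin. Qed.

(** Exit times are compared below through their real lower bounds, which involve the path only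
    strictly before s. *)
Lemma le_exit_at c y s : (s%:E <= exit_at c y)%E <->
  (forall r, 0 <= r -> r < s -> `|y r| < c).
Proof.
split=> [se r r0 rs|h].
  rewrite ltNge; apply/negP => cr; move: rs; rewrite ltNge => /negP; apply.
  rewrite -lee_fin (le_trans se)//; apply: ereal_inf_lbound.
  by exists r.
apply: le_ereal_inf_tmp => _ [t [/= t0 ct] <-]; rewrite lee_fin leNgt; apply/negP => ts.
by have := h t t0 ts; rewrite ltNge ct.
Qed.

(** The infimum is attained because, along a continuous path, |y| < c at some time persists a little
    after it. *)
Lemma exit_at_attained c y : path_continuous y ->
  exit_at c y = +oo%E \/ exists tau, [/\ exit_at c y = tau%:E, 0 <= tau & c <= `|y tau|].
Proof.
move=> cy; have := exit_at_ge0 c y; case E : (exit_at c y) => [tau| |]// tau0.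
  right; exists tau; split => //; rewrite leNgt; apply/negP => yc.
  have yc0 : 0 < c - `|y tau| by rewrite subr_gt0.
  have [dl dl0 h] := cy tau tau0 _ yc0.
  have : ((tau + dl)%:E <= exit_at c y)%E.
    apply/le_exit_at => r r0 rt; have [rtau|taur] := ltP r tau.
      by apply: (le_exit_at c y tau).1 => //; rewrite E.
    have := h r r0; rewrite ger0_norm ?subr_ge0// ltrBlDl => /(_ rt) h1.
    have := ler_normD (y r - y tau) (y tau); rewrite subrK; lra.
  by rewrite E lee_fin gerDl leNgt dl0.
by left.
Qed.

Lemma exit_at_le c y t : path_continuous y -> (exit_at c y <= t%:E)%E <-> hit c y t.
Proof.
move=> cy; split=> [et|[s [/andP[s0 st] cs]]]; last first.
  by apply: (@le_trans _ _ s%:E); [apply: ereal_inf_lbound; exists s|rewrite lee_fin].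
have [E|[tau [E tau0 ct]]] := exit_at_attained c cy.
  by rewrite E leye_eq in et.
by exists tau; rewrite tau0; split=> //; rewrite -lee_fin -E.
Qed.

Lemma stop_atE (tau : \bar R) t : (0 <= tau)%E -> (stop_at tau t)%:E = Order.min t%:E tau.
Proof.
rewrite /stop_at; case: tau => [tau| |]// _; first by rewrite -EFin_min.
by rewrite min_l ?leey.
Qed.

Lemma stop_at_ge0 tau t : (0 <= tau)%E -> 0 <= t -> 0 <= stop_at tau t.
Proof. by move=> tau0 t0; rewrite -lee_fin stop_atE// le_min lee_fin t0. Qed.

Lemma stop_at_le tau t : (0 <= tau)%E -> stop_at tau t <= t.
Proof. by move=> tau0; rewrite -lee_fin stop_atE// ge_min lexx. Qed.

Lemma stop_at_le_tau tau t : (0 <= tau)%E -> ((stop_at tau t)%:E <= tau)%E.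
Proof. by move=> tau0; rewrite stop_atE// ge_min lexx orbT. Qed.

Lemma stop_at_before tau t : (t%:E <= tau)%E -> stop_at tau t = t.
Proof. by move=> h; rewrite /stop_at min_l. Qed.

Lemma stop_at_lip tau s t : (0 <= tau)%E -> `|stop_at tau t - stop_at tau s| <= `|t - s|.
Proof.
case: tau => [tau| |]// _; last by rewrite !stop_at_before ?leey.
rewrite /stop_at -!EFin_min/=; rewrite /Order.min.
by case: ltP => h1; case: ltP => h2; rewrite ler_norml; apply/andP;
   have [h|h] := lerP s t; rewrite ?(ger0_norm, ltr0_norm) ?subr_ge0 ?subr_lt0 //; split; lra.
Qed.

Lemma path_continuous_stop tau y : (0 <= tau)%E -> path_continuous y ->
  path_continuous (fun t => y (stop_at tau t)).
Proof.
move=> tau0 cy s s0 e e0; have [dl dl0 h] := cy _ (stop_at_ge0 tau0 s0) e e0.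
exists dl => // r r0 rs; apply: h; first exact: stop_at_ge0.
exact: le_lt_trans (stop_at_lip _ _ tau0) rs.
Qed.

Lemma path_norm_max y t : path_continuous y -> 0 <= t ->
  exists2 s, 0 <= s <= t & forall r, 0 <= r <= t -> `|y r| <= `|y s|.
Proof.
move=> cy t0.
have cn : path_continuous (fun s => `|y s|).
  move=> s s0 e e0; have [dl dl0 h] := cy s s0 e e0; exists dl => // r r0 rs.
  exact: le_lt_trans (ler_dist_dist _ _) (h r r0 rs).
have /(EVT_max t0) [s] : {within `[0, t], continuous (fun s => `|y s|)}.
  apply: continuous_subspaceW ((path_continuousP _).1 cn).
  by move=> s /=; rewrite !in_itv/= => /andP[->].
by rewrite in_itv/= => st h; exists s => // r rt; apply: h; rewrite in_itv.
Qed.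

(** A countable description, from which measurability follows. Backwards, |y| attains its maximum on
    [0, t], and this maximum cannot stay below c by a fixed amount. *)
Lemma hitP c y t : path_continuous y -> 0 <= t ->
  hit c y t <-> forall k : nat, exists n i : nat,
    c - k.+1%:R^-1 < `|y (Num.min (node n i) t)|.
Proof.
move=> cy t0; split => [[s [/andP[s0 st] cs]] k|h].
  have k0 : 0 < k.+1%:R^-1 :> R by rewrite invr_gt0.
  have [dl dl0 hd] := cy s s0 _ k0.
  have /cvgrPdist_lt /(_ dl dl0) [n _ /(_ n (leqnn n)) /= hn] := floor_node_cvg s0.
  exists n, (floor_index n s); have /andP[h1 _] := floor_indexP n s0.
  rewrite min_l ?(le_trans h1)//.
  have := hd _ (node_ge0 n (floor_index n s)); rewrite distrC => /(_ hn) h2.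
  have := ler_normD (y s - y (node n (floor_index n s))) (y (node n (floor_index n s))).
  rewrite subrK => h3; rewrite distrC in h2.
  by move: (k.+1%:R^-1) h2 {k0 hd} => q h2; lra.
have [s st smax] := path_norm_max cy t0; exists s; split => //.
rewrite leNgt; apply/negP => yc; have d0 : 0 < c - `|y s| by rewrite subr_gt0.
have [k hk] : exists k : nat, k.+1%:R^-1 < c - `|y s|.
  exists (Num.truncn (c - `|y s|)^-1).
  by rewrite invf_plt ?posrE// truncnS_gt.
have [n [i hi]] := h k.
have : `|y (Num.min (node n i) t)| <= `|y s|.
  by apply: smax; rewrite le_min node_ge0 t0 ge_min lexx orbT.
by move: (k.+1%:R^-1) hi hk => q; lra.
Qed.

(** Keeping the increments over the cells that begin before tau stops at the first node not before
    tau, or at t if that is earlier; the overshoot is at most one mesh. When tau is an exit time,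
    the weights are known at the left nodes and can multiply the coefficients of a simple
    process. *)
Lemma grid_stop (tau : \bar R) n L t : (0 <= tau)%E -> 0 <= t -> t <= node n L ->
  exists th, [/\ 0 <= th, th <= t, `|th - stop_at tau t| <= mesh n &
    forall phi : R -> R,
    \sum_(i < L) ((node n i)%:E < tau)%E%:R *
      (phi (Num.min (node n i.+1) t) - phi (Num.min (node n i) t)) = phi th - phi 0].
Proof.
move=> tau0 t0 tL.
have [k kL hk] : exists2 k, (k <= L)%N & forall i, (i < L)%N ->
    ((node n i)%:E < tau)%E = (i < k)%N.
  elim: L {tL} => [|L [k kL hk]]; first by exists 0%N.
  have [h|h] := ltP (node n L)%:E tau.
    exists L.+1 => // i iL; rewrite iL; apply: le_lt_trans h.
    by rewrite lee_fin node_le -ltnS.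
  exists k; first exact: leqW.
  move=> i; rewrite ltnS leq_eqVlt => /orP[/eqP ->|/hk//].
  by rewrite ltNge h/= ltnNge kL.
exists (Num.min (node n k) t); split.
- by rewrite le_min node_ge0 t0.
- by rewrite ge_min lexx orbT.
- have st_ge0 := stop_at_ge0 tau0 t0; have st_t := stop_at_le t tau0.
  have m0 := mesh_gt0 (R := R) n.
  have h1 : stop_at tau t <= Num.min (node n k) t.
    rewrite le_min st_t andbT; move: kL; rewrite leq_eqVlt => /orP[/eqP ->|kL].
      exact: le_trans tL.
    rewrite -lee_fin; apply: (le_trans (stop_at_le_tau t tau0)).
    by rewrite leNgt hk// ltnn.
  have h2 : Num.min (node n k) t <= stop_at tau t + mesh n.
    case: k kL hk {h1} => [|k] kL hk.
      by rewrite node0 (@le_trans _ _ 0) ?ge_min ?lexx//; lra.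
    have := hk k kL; rewrite ltnSn => kt.
    have [tt|tt] := leP t%:E tau.
      by rewrite stop_at_before// ge_min; apply/orP; right; lra.
    have stE : (stop_at tau t)%:E = tau by rewrite stop_atE// min_r// ltW.
    have : node n k < stop_at tau t by rewrite -lte_fin stE.
    by rewrite ge_min nodeS => ?; apply/orP; left; lra.
  by rewrite ger0_norm ?subr_ge0//; lra.
- move=> phi; rewrite (eq_bigr (fun i : 'I_L => if (i < k)%N then
      (phi (Num.min (node n i.+1) t) - phi (Num.min (node n i) t)) else 0)); last first.
    by move=> i _; rewrite hk//; case: ifP => _; rewrite ?mul1r ?mul0r.
  rewrite -big_mkcond/= -(big_ord_widen L
    (fun i => phi (Num.min (node n i.+1) t) - phi (Num.min (node n i) t)) kL).
  rewrite -(big_mkord xpredT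
    (fun i => phi (Num.min (node n i.+1) t) - phi (Num.min (node n i) t))).
  rewrite telescope_sumr// node0; congr (_ - phi _).
  by rewrite min_l.
Qed.

End Hitting.

Section HittingMeasurable.
Context {d : measure_display} {Omega : measurableType d} {R : realType}.
Variables (P : probability Omega R) (W : R -> Omega -> R).
Local Notation history := (history P W).

Lemma measurable_hit (y : R -> Omega -> R) c t : (forall w, path_continuous (y ^~ w)) ->
  (forall s, 0 <= s -> measurable_fun setT (y s : history s -> R)) -> 0 <= t ->
  measurable ([set w | hit c (y ^~ w) t] : set (history t)).
Proof.
move=> cy my t0.
have -> : [set w | hit c (y ^~ w) t] = \bigcap_k \bigcup_n \bigcup_i
    [set w | c - k.+1%:R^-1 < `|y (Num.min (node n i) t) w|].
  apply/seteqP; split=> w.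
    move=> /(hitP c (cy w) t0) h k _; have [n [i hi]] := h k.
    by exists n => //; exists i.
  move=> h; apply/(hitP c (cy w) t0) => k; have [n _ [i _ hi]] := h k I.
  by exists n, i.
apply: (@bigcap_measurable _ (history t)) => [|k _]; first by exists 0%N.
apply: bigcup_measurable => n _; apply: bigcup_measurable => i _.
have s0 : 0 <= Num.min (node n i) t by rewrite le_min node_ge0.
have st : Num.min (node n i) t <= t by rewrite ge_min lexx orbT.
have mf := measurable_history_mono st (my _ s0).
have : measurable_fun setT ((fun w => `|y (Num.min (node n i) t) w|) : history t -> R).
  exact: measurableT_comp mf.
move=> /(_ measurableT `]c - k.+1%:R^-1, +oo[%classic (measurable_itv _)); rewrite setTI.
by congr (measurable _); apply/seteqP; split => w /=; rewrite in_itv/= andbT.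
Qed.

End HittingMeasurable.

Section AgreeingPaths.
Context {R : realType}.
Implicit Types (y z : R -> R).

Lemma eq_ereal_lower (a b : \bar R) : (0 <= a)%E -> (0 <= b)%E ->
  (forall s : R, (s%:E <= a)%E <-> (s%:E <= b)%E) -> a = b.
Proof.
case: a => [a| |]// _; case: b => [b| |]// _ h.
- apply/eqP; rewrite eqe eq_le -!lee_fin; apply/andP; split.
    exact: (h a).1.
  exact: (h b).2.
- by have := (h (a + 1)).2 (leey _); rewrite lee_fin gerDl ler10.
- by have := (h (b + 1)).1 (leey _); rewrite lee_fin gerDl ler10.
Qed.

(** The paths coincide until y leaves level M. If this happens at a finite time, both have there a
    modulus at least M >= c, so neither leaves level c later. *)
Lemma exit_at_agree c M y z : path_continuous y -> c <= M ->
  (forall s, 0 <= s -> (s%:E <= exit_at M y)%E -> z s = y s) ->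
  exit_at c z = exit_at c y.
Proof.
move=> cy cM zy; apply: eq_ereal_lower; [exact: exit_at_ge0|exact: exit_at_ge0|] => s.
have key u v : (forall s, 0 <= s -> (s%:E <= exit_at M y)%E -> u s = v s) ->
    (forall tau, 0 <= tau -> exit_at M y = tau%:E -> M <= `|u tau|) ->
    (s%:E <= exit_at c u)%E -> (s%:E <= exit_at c v)%E.
  move=> uv ut /le_exit_at h; apply/le_exit_at => r r0 rs.
  have [rt|tr] := leP r%:E (exit_at M y); first by rewrite -uv//; exact: h.
  have [E|[tau [E tau0 _]]] := exit_at_attained M cy; first by rewrite E in tr.
  have := h tau tau0; rewrite E lte_fin in tr; move=> /(_ (lt_trans tr rs)).
  by rewrite ltNge (le_trans cM)// ut.
have att tau : 0 <= tau -> exit_at M y = tau%:E -> M <= `|y tau|.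
  move=> tau0 E; have [E'|[t [E' _ h]]] := exit_at_attained M cy; first by rewrite E' in E.
  by move: E; rewrite E' => -[<-].
split; apply: key => //.
- by move=> tau tau0 E; rewrite zy// ?E// att.
- by move=> r r0 rt; rewrite zy.
Qed.

Lemma exit_at_agree_le c M y z : M <= c ->
  (forall s, 0 <= s -> (s%:E <= exit_at M y)%E -> z s = y s) ->
  (exit_at M y <= exit_at c z)%E.
Proof.
move=> Mc zy; case E : (exit_at M y) => [tau| |].
- apply/le_exit_at => r r0 rt; have rt' : (r%:E <= exit_at M y)%E.
    by rewrite E lee_fin ltW.
  rewrite zy//; apply: lt_le_trans Mc.
  by apply: (le_exit_at M y tau).1 => //; rewrite E.
- rewrite leye_eq; apply/eqP; apply: eq_ereal_lower => //; first exact: exit_at_ge0.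
  move=> s; split=> [_|_]; first exact: leey.
  apply/le_exit_at => r r0 rs; rewrite zy ?E ?leey//; apply: lt_le_trans Mc.
  by apply: (le_exit_at M y (r + 1)).1; rewrite ?E ?leey// ltrDl.
- exact: leNye.
Qed.

End AgreeingPaths.

(** * Coefficients for continuing a process after its exit time *)

Section Glue.
Context {d : measure_display} {Omega : measurableType d} {R : realType}.
Variables (P : probability Omega R) (W : R -> Omega -> R).
Hypothesis W_brownian : brownian_motion P W.
Local Notation history := (history P W).

Variables (x : R -> Omega -> R) (M : R).
Hypothesis x_path : forall w, path_continuous (x ^~ w).
Hypothesis x_meas : forall t, 0 <= t -> measurable_fun setT (x t : history t -> R).

Definition exit_time_of w := exit_at M (x ^~ w).
Definition frozen t w := x (stop_at (exit_time_of w) t) w.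
Definition exited t w : bool := `[< hit M (x ^~ w) t >].

Let exit_ge0 w : (0 <= exit_time_of w)%E. Proof. exact: exit_at_ge0. Qed.

Lemma frozen_path w : path_continuous (frozen ^~ w).
Proof. exact: path_continuous_stop (exit_ge0 w) (x_path w). Qed.

Lemma exitedP t w : exited t w <-> (exit_time_of w <= t%:E)%E.
Proof.
rewrite /exited; split => [/asboolP/(exit_at_le M t (x_path w))//|].
by move=> /(exit_at_le M t (x_path w))/asboolP.
Qed.

Lemma measurable_exited t : 0 <= t -> measurable_fun setT (exited t : history t -> bool).
Proof.
move=> t0; apply: (measurable_fun_bool true); rewrite setTI.
have -> : exited t @^-1` [set true] = [set w | hit M (x ^~ w) t].
  by apply/seteqP; split => w /= /asboolP.
exact: measurable_hit.
Qed.

Lemma measurable_exitedR t : 0 <= t ->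
  measurable_fun setT ((fun w => (exited t w)%:R) : history t -> R).
Proof.
move=> t0; have -> : (fun w => (exited t w)%:R : R) = (fun w => if exited t w then 1 else 0).
  by apply/funext => w; case: exited.
by apply: measurable_fun_ifT => //; exact: measurable_exited.
Qed.

(** The stopped value is the limit of x at the grid times of [grid_stop], and these values are sums
    of increments weighted by indicators known at the left nodes. *)
Lemma measurable_frozen t : 0 <= t -> measurable_fun setT (frozen t : history t -> R).
Proof.
move=> t0; pose L n := (floor_index n t).+1.
pose V n w := x 0 w + \sum_(i < L n) (~~ exited (node n i) w)%:R *
  (x (Num.min (node n i.+1) t) w - x (Num.min (node n i) t) w).
have mx s : 0 <= s -> s <= t -> measurable_fun setT (x s : history t -> R).
  by move=> s0 st; exact: measurable_history_mono st (x_meas s0).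
have mt s : Num.min s t <= t by rewrite ge_min lexx orbT.
apply: (@measurable_fun_cvg _ (history t) R setT V).
  move=> n; apply: measurable_funD; first exact: mx.
  apply: measurable_sum => i; apply: measurable_funM; last first.
    by apply: measurable_funB; apply: mx; rewrite // le_min node_ge0 t0.
  have it : node n i <= t.
    have /andP[+ _] := floor_indexP n t0; apply: le_trans.
    by rewrite node_le -ltnS.
  have := measurable_history_mono it (measurable_exited (node_ge0 n i)).
  move=> me; have -> : (fun w => (~~ exited (node n i) w)%:R : R) =
      (fun w => if exited (node n i) w then 0 else 1).
    by apply/funext => w; case: exited.
  exact: measurable_fun_ifT.
move=> w _; apply/cvgrPdist_lt => e e0.
have [dl dl0 h] := x_path w (stop_at_ge0 (exit_ge0 w) t0) e0.
move/cvgrPdist_lt : (@mesh_cvg0 R) => /(_ dl dl0); apply: filterS => n.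
rewrite sub0r normrN (gtr0_norm (mesh_gt0 n)) => mdl.
have /andP[_ /ltW tL] := floor_indexP n t0.
have [th [th0 tht thm hs]] := grid_stop (exit_ge0 w) t0 tL.
have -> : V n w = x th w.
  rewrite /V (eq_bigr (fun i : 'I_(L n) => ((node n i)%:E < exit_time_of w)%E%:R *
    (x (Num.min (node n i.+1) t) w - x (Num.min (node n i) t) w))).
    by rewrite (hs (x ^~ w)) addrC subrK.
  move=> i _; congr (_%:R * _); congr (nat_of_bool _).
  rewrite ltNge; congr (~~ _); apply/idP/idP => /exitedP//.
by rewrite distrC; apply: h => //; exact: le_lt_trans mdl.
Qed.

Lemma frozen_before t w : (t%:E <= exit_time_of w)%E -> frozen t w = x t w.
Proof. by move=> h; rewrite /frozen stop_at_before. Qed.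

Lemma frozen_after s t w : s <= t -> exited s w -> frozen t w = frozen s w.
Proof.
move=> st /exitedP; rewrite /frozen => es.
have et : (exit_time_of w <= t%:E)%E by rewrite (le_trans es)// lee_fin.
by rewrite /stop_at !min_r.
Qed.

Definition exit_clock t w : R := (exited t w)%:R.
(* With these coefficients Z stays at 0 until the exit time S of x from ]-M, M[, and
   x_{t /\ S} + Z continues x after S as a solution for the coefficients nu. *)
Definition glued (nu : R -> R) t z w : R := (exited t w)%:R * nu (frozen t w + z).

Lemma exit_clockP : clock P W exit_clock.
Proof.
split.
- by move=> t t0; exact: measurable_exitedR.
- by move=> t w _; rewrite /exit_clock; case: exited; rewrite ?lexx ?ler01.
- move=> s t w s0 st; rewrite /exit_clock ler_nat.
  case E : (exited s w) => //; move: E => /exitedP es.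
  have -> // : exited t w.
  by apply/exitedP; rewrite (le_trans es)// lee_fin.
Qed.

(** As a function of time a glued coefficient is 0 before the exit and, the process being frozen,
    constant afterwards. Its only variation is one jump of size at most K, at the time when the
    clock jumps. *)
Lemma glued_admissible (nu : R -> R) K : 1 <= K -> (forall z, `|nu z| <= K) ->
  (forall z z', `|nu z - nu z'| <= K * `|z - z'|) -> admissible P W K exit_clock (glued nu).
Proof.
move=> K1 bnu lnu; have K0 : 0 <= K by exact: le_trans K1.
have mnu : measurable_fun setT nu.
  apply: continuous_measurable_fun => z; apply/cvgrPdist_lt => e e0.
  have K00 : 0 < K by exact: lt_le_trans K1.
  have e' : 0 < e / K by rewrite divr_gt0.
  exists (e / K) => //= r /= zr; apply: (le_lt_trans (lnu _ _)).
  by rewrite mulrC -ltr_pdivlMr.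
split.
- move=> t g t0 mg; apply: measurable_funM; first exact: measurable_exitedR.
  apply: measurableT_comp mnu _.
  by apply: measurable_funD => //; exact: measurable_frozen.
- move=> t z w _; rewrite /glued; case: exited; rewrite ?mul1r// mul0r normr0//.
- move=> t z z' w _; rewrite /glued; case: exited; rewrite ?mul1r ?mul0r.
    by apply: le_trans (lnu _ _) _; rewrite opprD addrACA subrr add0r.
  by rewrite subrr normr0 mulr_ge0.
- move=> s t z w s0 st; have := clock_le exit_clockP w s0 st; rewrite /glued /exit_clock.
  case es : (exited s w); case et : (exited t w).
  + by rewrite (frozen_after st es) !subrr normr0 mulr0.
  + by rewrite ler_nat.
  + by rewrite mul1r mul0r !subr0 mulr1.
  + by rewrite !mul0r !subrr normr0 mulr0.
Qed.

(** Every cell crossed before time s begins strictly before the exit, where the coefficients vanish.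
    Since coefficients are evaluated at left nodes, the exit time itself is included. *)
Lemma glued_euler_before (mu sigma : R -> R) n s w : 0 <= s ->
  (s%:E <= exit_time_of w)%E -> euler_at W (glued mu) (glued sigma) n s w = 0.
Proof.
move=> s0 st.
have nex r : r < s -> exited r w = false.
  move=> rs; apply/negbTE/negP => /exitedP; rewrite leNgt => /negP; apply.
  by apply: lt_le_trans st; rewrite lte_fin.
have ze k : node n k <= s -> euler W (glued mu) (glued sigma) n k w = 0.
  elim: k => // k IH ks; have ks' : node n k < s.
    by apply: lt_le_trans ks; rewrite nodeS ltrDl mesh_gt0.
  by rewrite /= IH ?(ltW ks')// /glued nex// !mul0r !addr0.
rewrite /euler_at; have /andP[ks _] := floor_indexP n s0.
move: ks; set k := floor_index n s; rewrite le_eqVlt => /orP[/eqP E|ks].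
  by rewrite -E !subrr !mulr0 !addr0 ze// E.
by rewrite /drift /diffusion /glued nex// !mul0r !addr0 ze// ltW.
Qed.

End Glue.

(** * Ito integrals *)

Section BoundedConvergence.
Context {R : realType}.
Variables (t B : R) (f_ : nat -> R -> R) (f : R -> R).
Hypothesis f_meas : forall n, measurable_fun `[0, t] (f_ n).
Hypothesis f_bound : forall n s, 0 <= s <= t -> `|f_ n s| <= B.
Hypothesis f_cvg : forall s, 0 <= s <= t -> f_ n s @[n --> \oo] --> f s.

Let inI s : `[0, t]%classic s -> 0 <= s <= t.
Proof. by rewrite /= in_itv. Qed.

Lemma limit_measurable : measurable_fun `[0, t] f.
Proof. by apply: measurable_fun_cvg f_meas _ => s /inI; exact: f_cvg. Qed.

Let bnd_integrable (c : R) : lebesgue_measure.-integrable `[0, t] (fun _ : R => c%:E).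
Proof.
apply/integrableP; split; first exact: measurable_cst.
rewrite integral_cst//= lebesgue_measure_itv/= lte_fin.
by case: ifP => _; rewrite ?mule0 ?ltry// -EFinD -EFinM ltry.
Qed.

Lemma bounded_convergence :
  \int[lebesgue_measure]_(s in `[0, t]) f_ n s @[n --> \oo] -->
  \int[lebesgue_measure]_(s in `[0, t]) f s.
Proof.
have m1 n : measurable_fun `[0, t] (EFin \o f_ n) by exact/measurable_EFinP.
have m2 : measurable_fun `[0, t] (EFin \o f) by apply/measurable_EFinP; exact: limit_measurable.
have cv : {ae lebesgue_measure, forall s, `[0, t]%classic s ->
    (EFin \o f_ n) s @[n --> \oo] --> (EFin \o f) s}.
  by apply: aeW => s /inI st; apply: cvg_EFin; [exact: nearW|exact: f_cvg].
have bd : {ae lebesgue_measure, forall s, forall n, `[0, t]%classic s ->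
    (`|(EFin \o f_ n) s| <= B%:E)%E}.
  by apply: aeW => s n /inI st; rewrite lee_fin; exact: f_bound.
have [fi _ fc] := @dominated_convergence _ _ _ (@lebesgue_measure R) _ (measurable_itv _) _ _ _ m1 m2 cv (bnd_integrable B) bd.
rewrite /Rintegral; apply: fine_cvg; move: fc; rewrite fineK//.
exact: integrable_fin_num.
Qed.

Lemma bounded_convergence_square :
  (\int[lebesgue_measure]_(s in `[0%R, t]) ((f_ n s - f s) ^+ 2)%:E)%E @[n --> \oo] --> (0 : \bar R).
Proof.
have fb s : 0 <= s <= t -> `|f s| <= B.
  move=> st; have cf : `|f_ n s| @[n --> \oo] --> `|f s| by apply: cvg_norm; exact: f_cvg.
  rewrite -(cvg_lim _ cf)//; apply: limr_le; first exact: (cvgP _ cf).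
  by apply: nearW => n; exact: f_bound.
have mf := limit_measurable; pose g n s := ((f_ n s - f s) ^+ 2)%:E.
have m1 n : measurable_fun `[0, t] (g n).
  by apply/measurable_EFinP; apply: measurable_funX; exact: measurable_funB.
have m2 : measurable_fun `[0, t] (fun _ : R => 0%:E : \bar R) by exact: measurable_cst.
have cv : {ae lebesgue_measure, forall s, `[0, t]%classic s ->
    g n s @[n --> \oo] --> (0%:E : \bar R)}.
  apply: aeW => s /inI st; apply: cvg_EFin; first exact: nearW.
  have : f_ n s - f s @[n --> \oo] --> f s - f s.
    by apply: cvgB; [exact: f_cvg|exact: cvg_cst].
  rewrite subrr => h0; have h : (f_ n s - f s) ^+ 2 @[n --> \oo] --> (0 : R).
    have h2 := cvgM h0 h0; rewrite mulr0 in h2.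
    have -> : (fun n => (f_ n s - f s) ^+ 2) = (fun n => (f_ n s - f s) * (f_ n s - f s)).
      by apply/funext => n; rewrite expr2.
    exact: h2.
  exact: h.
have bd : {ae lebesgue_measure, forall s, forall n, `[0, t]%classic s ->
    (`|g n s| <= ((B + B) ^+ 2)%:E)%E}.
  apply: aeW => s n /inI st; rewrite lee_fin ger0_norm ?sqr_ge0//.
  rewrite -(real_normK (num_real (f_ n s - f s))).
  have B0 : 0 <= B by exact: le_trans (fb s st).
  apply: lerXn2r; rewrite ?nnegrE ?addr_ge0//.
  by apply: (le_trans (ler_normB _ _)); apply: lerD; [exact: f_bound|exact: fb].
have [_ _] := @dominated_convergence _ _ _ (@lebesgue_measure R) _ (measurable_itv _) _ _ _ m1 m2 cv (bnd_integrable ((B + B) ^+ 2)) bd.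
by rewrite integral0.
Qed.

End BoundedConvergence.

Section StepFunctions.
Context {R : realType}.

(** The cell that begins at the last node up to t is counted, so that the cells cover [0, t]. *)
Definition grid_size (n : nat) (t : R) : nat := (floor_index n t).+1.

Lemma grid_size_gt n (t : R) : 0 <= t -> t <= node n (grid_size n t).
Proof. by move=> t0; have /andP[_ /ltW] := floor_indexP n t0. Qed.

(** Cells are left-open, as in [simple_value]; in particular the value at time 0 is 0. *)
Definition step (n : nat) (t : R) (c : nat -> R) (s : R) : R :=
  \sum_(i < grid_size n t) c i * \1_(`]node n i, node n i.+1] : set R) s.

Lemma left_cell n (s : R) : 0 < s -> exists i, node n i < s <= node n i.+1.
Proof.
move=> s0; have /andP[h1 h2] := floor_indexP n (ltW s0).
move: h1; rewrite le_eqVlt => /orP[/eqP E|h1]; last first.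
  by exists (floor_index n s); rewrite h1 ltW.
case: (floor_index n s) E {h2} => [|k] E; first by move: s0; rewrite -E node0 ltxx.
by exists k; rewrite -E lexx andbT nodeS ltrDl mesh_gt0.
Qed.

Lemma step_cell n t c s i : 0 <= t -> s <= t -> node n i < s <= node n i.+1 ->
  step n t c s = c i.
Proof.
move=> t0 st /andP[h1 h2].
have iL : (i < grid_size n t)%N.
  rewrite ltnNge -(node_le (R := R) n) -ltNge.
  by apply: (lt_le_trans h1); apply: (le_trans st); exact: grid_size_gt.
rewrite /step (bigD1 (Ordinal iL))//= big1 ?addr0.
  by rewrite indicE mem_set ?mulr1//= in_itv/= h1.
move=> j; rewrite -(inj_eq val_inj)/= => ji.
rewrite indicE memNset ?mulr0//= in_itv/= => /andP[k1 k2].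
have := lt_le_trans k1 h2; have := lt_le_trans h1 k2.
rewrite !ltNge !node_le -!ltnNge => a1 a2.
by move: ji; rewrite eqn_leq -ltnS a2 -ltnS a1.
Qed.

Lemma step0 n t c : step n t c 0 = 0.
Proof.
apply: big1 => i _; rewrite indicE memNset ?mulr0//= in_itv/= ltNge.
by rewrite node_ge0.
Qed.

Lemma step_bound n t c s K : 0 <= s <= t -> (forall i, `|c i| <= K) -> `|step n t c s| <= K.
Proof.
move=> /andP[s0 st] cK; have t0 := le_trans s0 st.
have [->|s1] := eqVneq s 0.
  by rewrite step0 normr0; apply: le_trans (cK 0%N).
have [i hi] : exists i, node n i < s <= node n i.+1 by apply: left_cell; rewrite lt_neqAle eq_sym s1.
by rewrite (step_cell _ t0 st hi).
Qed.

Lemma measurable_step n t c D : measurable_fun D (step n t c).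
Proof.
apply: measurable_sum => i; apply: measurable_funM => //.
Qed.

Lemma integral_step n (t : R) c : 0 <= t ->
  \int[lebesgue_measure]_(s in `[0, t]) step n t c s =
  \sum_(i < grid_size n t) c i * (Num.min (node n i.+1) t - Num.min (node n i) t).
Proof.
move=> t0; pose I i : set R := `]node n i, node n i.+1]%classic.
have lelen i : Num.min (node n i) t <= Num.min (node n i.+1) t.
  by rewrite le_min !ge_min lexx orbT andbT node_le leqnSn.
have int1 i : (\int[lebesgue_measure]_(s in `[0%R, t]) (\1_(I i) s)%:E =
    (Num.min (node n i.+1) t - Num.min (node n i) t)%:E)%E.
  rewrite integral_indic//; last exact: measurable_itv.
  have -> : I i `&` `[0, t]%classic =
      `]Num.min (node n i) t, Num.min (node n i.+1) t]%classic.
    apply/seteqP; split => s; rewrite /I /= !in_itv/= gt_min le_min.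
      by move=> [/andP[h1 ->] /andP[_ ->]]; rewrite h1.
    move=> /andP[/orP[h1|h1] /andP[h2 h3]]; last by move: h3; rewrite leNgt h1.
    have s0 : 0 <= s by apply: ltW; apply: le_lt_trans h1; exact: node_ge0.
    by split; apply/andP; split.
  rewrite /= lebesgue_measure_itv/= lte_fin; case: ltP => // h.
  have -> : Num.min (node n i.+1) t = Num.min (node n i) t by apply/le_anti; rewrite h lelen.
  by rewrite subrr.
have intI i : lebesgue_measure.-integrable `[0, t] (fun s => (\1_(I i) s)%:E).
  apply: (@le_integrable _ _ _ lebesgue_measure _ _ _ (fun=> 1%:E)) => //.
  - by apply/measurable_EFinP; apply: measurable_funTS; apply: measurable_indic; exact: measurable_itv.
  - by move=> s _; rewrite indicE; case: (_ \in _); rewrite lee_fin ?normr0 ?normr1.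
  - apply/integrableP; split; first exact: measurable_cst.
    rewrite integral_cst//= lebesgue_measure_itv/= lte_fin.
    by case: ifP => _; rewrite ?mule0 ?ltry// -EFinD -EFinM ltry.
have intcI i : lebesgue_measure.-integrable `[0, t] (fun s => (c i * \1_(I i) s)%:E).
  have -> : (fun s => (c i * \1_(I i) s)%:E) = (fun s => (c i)%:E * (\1_(I i) s)%:E)%E.
    by apply/funext => s; rewrite EFinM.
  exact: integrableZl.
rewrite /Rintegral /step.
under eq_integral do rewrite -sumEFin.
rewrite integral_sum//.
rewrite (eq_bigr (fun i : 'I_(grid_size n t) =>
    (c i * (Num.min (node n i.+1) t - Num.min (node n i) t))%:E)); first by rewrite sumEFin.
move=> i _; under eq_integral do rewrite EFinM.
rewrite integralZl; [|exact: measurable_itv|exact: intI].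
transitivity ((c i)%:E * (Num.min (node n i.+1) t - Num.min (node n i) t)%:E)%E => //.
exact: (congr1 (fun z => (c i)%:E * z)%E (int1 i)).
Qed.

End StepFunctions.

(** * Sums of simple processes *)

Section Refinement.
Context {R : realType}.

(** Membership is tested on values and not on indices, because the times of a merged list are
    compared by value. Ties are harmless: equal consecutive values give a zero increment. *)
Lemma refine_sum (phi : R -> R) (v : nat -> R) n p q :
  (forall j, v j <= v j.+1) -> (q <= n)%N ->  (p <= q)%N ->
  \sum_(j < n) ((v p <= v j) && (v j < v q))%:R * (phi (v j.+1) - phi (v j)) =
  phi (v q) - phi (v p).
Proof.
move=> vS qn pq; have vle i j : (i <= j)%N -> v i <= v j by move: i j; exact: (homo_leq (@lexx _ R) (fun _ _ _ => @le_trans _ R _ _ _)).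
rewrite -(telescope_sumr (fun j => phi (v j)) pq) -(big_mkord xpredT
  (fun j => ((v p <= v j) && (v j < v q))%:R * (phi (v j.+1) - phi (v j)))).
rewrite (big_cat_nat (leq0n p) (leq_trans pq qn))/= (big_cat_nat pq qn)/=.
rewrite big_nat big1 ?add0r; last first.
  move=> j /andP[_ jp]; have [h|h] := leP (v p) (v j); last by rewrite mul0r.
  have -> : v j.+1 = v j by apply/le_anti; rewrite vS (le_trans (vle _ _ jp) h).
  by rewrite subrr mulr0.
rewrite [X in _ + X]big_nat [X in _ + X]big1 ?addr0; last first.
  by move=> j /andP[qj _]; rewrite [v j < _]ltNge [v q <= v j]vle//= andbF mul0r.
rewrite big_nat [RHS]big_nat; apply: eq_bigr => j /andP[pj jq].
rewrite vle//=; have [h|h] := ltP (v j) (v q); first by rewrite mul1r.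
have -> : v j.+1 = v j by apply/le_anti; rewrite vS (le_trans (vle _ _ jq) h).
by rewrite subrr mulr0.
Qed.

(* Past the end of [s] the sequence is constant. *)
Definition sorted_times (s : seq R) (j : nat) : R :=
  let r := sort <=%R s in nth (last 0 r) r j.

Lemma sorted_times_le s j : sorted_times s j <= sorted_times s j.+1.
Proof.
rewrite /sorted_times; set r := sort _ s.
have sr : sorted <=%R r by apply: sort_sorted; exact: le_total.
have [jr|jr] := ltnP j.+1 (size r); first exact: (sortedP _ sr).
rewrite [leRHS]nth_default//; have [jr'|jr'] := ltnP j (size r); last by rewrite nth_default.
have E : last 0 r = nth (last 0 r) r (size r).-1 by rewrite nth_last; case: (r).
rewrite [leRHS]E.
apply: (sorted_leq_nth le_trans lexx (last 0 r) sr); rewrite ?inE//.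
  by case: (r) jr'.
by rewrite -ltnS prednK// (leq_ltn_trans _ jr').
Qed.

Lemma sorted_times_mem s a : a \in s -> exists2 p, (p < size s)%N & sorted_times s p = a.
Proof.
rewrite -(mem_sort <=%R) => ar; exists (index a (sort <=%R s)).
  by rewrite -(size_sort <=%R) index_mem.
exact: nth_index.
Qed.

Lemma refine_sum_mem s a b phi : a \in s -> b \in s -> a <= b ->
  \sum_(j < size s) ((a <= sorted_times s j) && (sorted_times s j < b))%:R *
    (phi (sorted_times s j.+1) - phi (sorted_times s j)) = phi b - phi a :> R.
Proof.
move=> /sorted_times_mem[p ps <-] /sorted_times_mem[q qs <-] ab.
have [pq|qp] := leqP p q; first by apply: refine_sum => //; [exact: sorted_times_le|exact: ltnW].
have ba : sorted_times s q <= sorted_times s p.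
  have vle i j : (i <= j)%N -> sorted_times s i <= sorted_times s j.
    move: i j; apply: (homo_leq (@lexx _ R) (fun _ _ _ => @le_trans _ R _ _ _)).
    exact: sorted_times_le.
  exact/vle/ltnW.
have E : sorted_times s p = sorted_times s q by apply/le_anti; rewrite ab.
rewrite -E subrr big1// => j _; by case: leP => //= h; rewrite mul0r.
Qed.

End Refinement.

Section SimpleAdd.
Context {d : measure_display} {Omega : measurableType d} {R : realType}.
Variables (P : probability Omega R) (W : R -> Omega -> R).
Local Notation history := (history P W).
Local Notation F := (augmented_filtration P W).

Definition time_list (H : simple_process F) : seq R :=
  [seq simple_time H i | i <- iota 0 (simple_size H).+1].

Lemma time_list_mem (H : simple_process F) i : (i <= simple_size H)%N ->
  simple_time H i \in time_list H.
Proof. by move=> iH; apply: map_f; rewrite mem_iota. Qed.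

Definition refined_coef (H : simple_process F) (s : seq R) (j : nat) (w : Omega) : R :=
  \sum_(i < simple_size H) simple_coef H i w *
    ((simple_time H i <= sorted_times s j) && (sorted_times s j < simple_time H i.+1))%:R.

(** A coefficient contributes only if its own time is not after the refined one, where it is then
    already known. *)
Lemma measurable_refined_coef H s j :
  measurable_fun setT (refined_coef H s j : history (sorted_times s j) -> R).
Proof.
apply: measurable_sum => i.
have [h|h] /= := leP (simple_time H i) (sorted_times s j); last first.
  by rewrite (_ : (fun w => _) = (fun=> 0)); [exact: measurable_cst|by apply/funext => w; rewrite mulr0].
apply: measurable_funM => //; apply: (measurable_history_mono h) => _ B mB.
by rewrite setTI; exact: (simple_coef_measurable H i mB).
Qed.

Lemma refined_coef_bounded H s j : exists B : R, forall w, `|refined_coef H s j w| <= B.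
Proof.
rewrite /refined_coef; elim: (simple_size H) => [|n [B IH]].
  by exists 0 => w; rewrite big_ord0 normr0.
have [C hC] := simple_coef_bounded H n; exists (B + C) => w.
rewrite big_ord_recr/=; apply: (le_trans (ler_normD _ _)); apply: lerD => //.
rewrite normrM; apply: le_trans (hC w); rewrite ler_piMr//.
by case: (_ && _); rewrite ?normr0 ?normr1.
Qed.

Lemma refined_sum H s (phi : R -> R) w : {subset time_list H <= s} ->
  \sum_(j < size s) refined_coef H s j w *
    (phi (sorted_times s j.+1) - phi (sorted_times s j)) =
  \sum_(i < simple_size H) simple_coef H i w *
    (phi (simple_time H i.+1) - phi (simple_time H i)).
Proof.
move=> Hs; rewrite /refined_coef; under eq_bigr do rewrite mulr_suml.
rewrite exchange_big/=; apply: eq_bigr => i _.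
under eq_bigr do rewrite -mulrA.
rewrite -mulr_sumr refine_sum_mem//.
- by apply/Hs/time_list_mem/ltnW.
- exact/Hs/time_list_mem.
- exact: simple_time_le.
Qed.

(** Written as a negated increment of the function 1_{z < s} of z, the indicator turns the value of
    a simple process, like its integral, into a sum of coefficients times increments of a function
    of time. *)
Lemma indic_telescope (a b s : R) : a <= b ->
  \1_(`]a, b] : set R) s = - (((b < s)%R)%:R - ((a < s)%R)%:R) :> R.
Proof.
move=> ab; rewrite indicE opprB; have [as_|sa] := ltP a s; have [bs|sb] := ltP b s.
- by rewrite memNset ?subrr//= in_itv/= as_ leNgt bs.
- by rewrite mem_set ?subr0//= in_itv/= as_ sb.
- by have := lt_le_trans bs (le_trans sa ab); rewrite ltxx.
- by rewrite memNset ?subrr//= in_itv/= ltNge sa.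
Qed.

(** Both processes are rewritten on the sorted union of their times. A single identity, for an
    arbitrary function phi of time, gives values and integrals together. *)
Lemma simple_add (H1 H2 : simple_process F) : exists H : simple_process F,
  (forall s w, simple_value H s w = simple_value H1 s w + simple_value H2 s w) /\
  (forall t w, simple_integral W H t w = simple_integral W H1 t w + simple_integral W H2 t w).
Proof.
pose s := time_list H1 ++ time_list H2.
have s1 : {subset time_list H1 <= s} by move=> r; rewrite mem_cat => ->.
have s2 : {subset time_list H2 <= s} by move=> r; rewrite mem_cat => ->; rewrite orbT.
have ge0 r : r \in s -> 0 <= r.
  have tle (H : simple_process F) i : 0 <= simple_time H i.
    by elim: i => [|i IH]; [exact: simple_time_ge0|exact: le_trans (simple_time_le H i)].
  by rewrite mem_cat => /orP[] /mapP[i _ ->].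
have u0 : 0 <= sorted_times s 0.
  have ss : (0 < size s)%N by rewrite size_cat size_map.
  apply: ge0; rewrite -(mem_sort <=%R) /sorted_times; apply: mem_nth.
  by rewrite size_sort.
pose c j w := refined_coef H1 s j w + refined_coef H2 s j w.
have mc j B : measurable B -> F (sorted_times s j) (c j @^-1` B).
  move=> mB; have mf : measurable_fun setT (c j : history (sorted_times s j) -> R).
    by apply: measurable_funD; exact: measurable_refined_coef.
  by have := mf measurableT _ mB; rewrite setTI.
have bc j : exists B : R, forall w, `|c j w| <= B.
  have [B1 h1] := refined_coef_bounded H1 s j; have [B2 h2] := refined_coef_bounded H2 s j.
  by exists (B1 + B2) => w; apply: (le_trans (ler_normD _ _)); exact: lerD.
pose H := @SimpleProcess _ _ _ F (size s) (sorted_times s) c u0 (sorted_times_le s) mc bc.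
have key phi w : \sum_(j < size s) c j w *
    (phi (sorted_times s j.+1) - phi (sorted_times s j)) =
  \sum_(i < simple_size H1) simple_coef H1 i w *
    (phi (simple_time H1 i.+1) - phi (simple_time H1 i)) +
  \sum_(i < simple_size H2) simple_coef H2 i w *
    (phi (simple_time H2 i.+1) - phi (simple_time H2 i)).
  rewrite -(refined_sum phi w s1) -(refined_sum phi w s2) -big_split/=.
  by apply: eq_bigr => j _; rewrite /c mulrDl.
have valE (G : simple_process F) r w : simple_value G r w =
    - \sum_(i < simple_size G) simple_coef G i w *
      ((fun z : R => (z < r)%R%:R : R) (simple_time G i.+1) - (fun z : R => (z < r)%R%:R : R) (simple_time G i)).
  rewrite -sumrN; apply: eq_bigr => i _; rewrite indic_telescope ?mulrN//.
  exact: simple_time_le.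
exists H; split => [r w|t w]; last exact: (key (fun z => W (Num.min z t) w)).
by rewrite !valE -opprD; congr (- _); exact: (key (fun z => (z < r)%R%:R)).
Qed.

End SimpleAdd.

(** * Ito integrals as pathwise limits *)

Section PathwiseIto.
Context {d : measure_display} {Omega : measurableType d} {R : realType}.
Variables (P : probability Omega R) (W : R -> Omega -> R).
Hypothesis W_brownian : brownian_motion P W.
Local Notation F := (augmented_filtration P W).

Lemma simple_time_nneg (H : simple_process F) i : 0 <= simple_time H i.
Proof.
by elim: i => [|i IH]; [exact: simple_time_ge0|exact: le_trans (simple_time_le H i)].
Qed.

Lemma measurable_simple_coef (H : simple_process F) i :
  measurable_fun setT (simple_coef H i).
Proof.
apply: (measurable_history W_brownian (t := simple_time H i)) => _ B mB.
by rewrite setTI; exact: (simple_coef_measurable H i mB).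
Qed.

Lemma measurable_simple_integral (H : simple_process F) t : 0 <= t ->
  measurable_fun setT (simple_integral W H t).
Proof.
move=> t0; apply: measurable_sum => i; apply: measurable_funM.
  exact: measurable_simple_coef.
by apply: measurable_funB; apply: (brownian_measurable W_brownian);
  rewrite le_min simple_time_nneg.
Qed.

Lemma measurable_simple_value (H : simple_process F) w D :
  measurable_fun D (simple_value H ^~ w).
Proof. by apply: measurable_sum => i; apply: measurable_funM. Qed.

Lemma bounded_integrable (f : R -> R) (t K : R) : measurable_fun `[0, t] f ->
  (forall s, 0 <= s <= t -> `|f s| <= K) ->
  lebesgue_measure.-integrable `[0, t] (EFin \o f).
Proof.
move=> mf fK; apply: measurable_bounded_integrable => //.
  by rewrite /= lebesgue_measure_itv/=; case: ifPn => // _; rewrite -EFinB ltry.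
exists K; split; first exact: num_real.
by move=> y Ky s /=; rewrite in_itv/= => st; rewrite (le_trans (fK s st))// ltW.
Qed.

Lemma measurable_simple_value2 (H : simple_process F) :
  measurable_fun setT (fun z : Omega * R => simple_value H z.2 z.1).
Proof.
apply: measurable_sum => i; apply: measurable_funM.
  by apply: measurableT_comp => //; exact: measurable_simple_coef.
have mi : measurable_fun setT (\1_(`]simple_time H i, simple_time H i.+1]%classic) : R -> R) by [].
exact: (measurableT_comp mi).
Qed.

Lemma measurable_simple_dist (H H' : simple_process F) t : measurable_fun setT (fun w =>
  \int[lebesgue_measure]_(s in `[0, t]) ((simple_value H s w - simple_value H' s w) ^+ 2)).
Proof.
pose f (z : Omega * R) : \bar R :=
  ((simple_value H z.2 z.1 - simple_value H' z.2 z.1) ^+ 2 * \1_(`[0%R, t] : set R) z.2)%:E.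
have mf : measurable_fun setT f.
  apply/measurable_EFinP; apply: measurable_funM.
    by apply: measurable_funX; apply: measurable_funB; exact: measurable_simple_value2.
  have mi : measurable_fun setT (\1_(`[0, t]%classic) : R -> R) by [].
  exact: (measurableT_comp mi).
have f0 z : (0 <= f z)%E by rewrite lee_fin mulr_ge0// ?sqr_ge0.
have mF := @measurable_fun_fubini_tonelli_F _ _ _ _ _ (@lebesgue_measure R) f mf f0.
have mfine : measurable_fun setT (@fine R) by [].
apply: eq_measurable_fun (measurableT_comp mfine mF) => w _ /=.
rewrite /Rintegral; congr fine; rewrite [RHS]integral_mkcond.
apply: eq_integral => s _; rewrite /f /= patchE indicE.
by case: ifPn => _; rewrite ?mulr1 ?mulr0.
Qed.

Variables (H_ : nat -> simple_process F) (H : R -> Omega -> R) (J : Omega -> R).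
Variables (t K : R) (N : set Omega).
Hypothesis t_ge0 : 0 <= t.
Hypothesis N_meas : measurable N.
Hypothesis N_null : P N = 0%E.
Hypothesis H_bound : forall n (s : R) w, 0 <= s <= t -> `|simple_value (H_ n) s w| <= K.
Hypothesis H_cvg : forall (s : R) w, ~ N w -> 0 <= s <= t ->
  simple_value (H_ n) s w @[n --> \oo] --> H s w.
Hypothesis J_cvg : forall w, ~ N w -> simple_integral W (H_ n) t w @[n --> \oo] --> J w.

(** Once set to 0 on N, limits that exist only off N become limits everywhere, hence measurable. *)
Let off (u : Omega -> R) w : R := \1_(~` N) w * u w.

Let offE u w : ~ N w -> off u w = u w.
Proof. by move=> nw; rewrite /off indicE mem_set ?mul1r. Qed.

Let measurable_off u : measurable_fun setT u -> measurable_fun setT (off u).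
Proof. by move=> mu; apply: measurable_funM => //; apply: measurable_indic; exact: measurableC. Qed.

Let measurable_off_cvg (u : nat -> Omega -> R) v : (forall n, measurable_fun setT (u n)) ->
  (forall w, ~ N w -> u n w @[n --> \oo] --> v w) -> measurable_fun setT (off v).
Proof.
move=> mu uv; apply: (@measurable_fun_cvg _ _ _ setT (fun n => off (u n))).
  by move=> n; exact: measurable_off.
move=> w _; rewrite /off; have [nw|nw] := pselect (N w).
  by rewrite indicE memNset// mul0r; under eq_fun do rewrite mul0r; exact: cvg_cst.
by apply: cvgM; [exact: cvg_cst|exact: uv].
Qed.

Let dist n m w := \int[lebesgue_measure]_(s in `[0, t])
  ((simple_value (H_ n) s w - simple_value (H_ m) s w) ^+ 2).

Let err n w := \int[lebesgue_measure]_(s in `[0, t]) ((simple_value (H_ n) s w - H s w) ^+ 2).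

Let square_cvg (u : nat -> R) (l : R) : u n @[n --> \oo] --> l -> (u n) ^+ 2 @[n --> \oo] --> l ^+ 2.
Proof.
move=> ul; rewrite expr2 (_ : (fun n => _) = (fun n => u n * u n)); first exact: cvgM.
by apply/funext => n; rewrite expr2.
Qed.

Let H_le s w : ~ N w -> 0 <= s <= t -> `|H s w| <= K.
Proof.
move=> nw st; have c : `|simple_value (H_ n) s w| @[n --> \oo] --> `|H s w|.
  by apply: cvg_norm; exact: H_cvg.
rewrite -(cvg_lim _ c)//; apply: limr_le; first exact: (cvgP _ c).
by apply: nearW => n; exact: H_bound.
Qed.

Let square_bound (p q : R) : `|p| <= K -> `|q| <= K -> `|(p - q) ^+ 2| <= (K + K) ^+ 2.
Proof.
move=> pK qK; have K0 : 0 <= K by exact: le_trans pK.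
rewrite normrX; apply: lerXn2r; rewrite ?nnegrE ?addr_ge0//.
by apply: (le_trans (ler_normB _ _)); exact: lerD.
Qed.

Let measurable_path w : ~ N w -> measurable_fun `[0, t] (H ^~ w).
Proof.
move=> nw; apply: (measurable_fun_cvg (h := fun n => simple_value (H_ n) ^~ w)).
  by move=> n; exact: measurable_simple_value.
by move=> s; rewrite /= in_itv/=; exact: H_cvg.
Qed.

Let measurable_err n : measurable_fun setT (off (err n)).
Proof.
apply: (@measurable_off_cvg (dist n)) => [m|w nw]; first exact: measurable_simple_dist.
apply: (@bounded_convergence _ t ((K + K) ^+ 2)).
- by move=> m; apply: measurable_funX; apply: measurable_funB; exact: measurable_simple_value.
- by move=> m s st; apply: square_bound; exact: H_bound.
- by move=> s st; apply: square_cvg; apply: cvgB; [exact: cvg_cst|exact: H_cvg].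
Qed.

Let errE n w : ~ N w -> (\int[lebesgue_measure]_(s in `[0%R, t])
    ((simple_value (H_ n) s w - H s w) ^+ 2)%:E = (err n w)%:E)%E.
Proof.
move=> nw; rewrite /err /Rintegral fineK//; apply: integrable_fin_num => //.
apply: (@bounded_integrable _ t ((K + K) ^+ 2)).
  apply: measurable_funX; apply: measurable_funB; last exact: measurable_path.
  exact: measurable_simple_value.
by move=> s st; apply: square_bound; [exact: H_bound|exact: H_le].
Qed.

(** The definition asks for two convergences in probability, and almost sure convergence gives both,
    with bounded convergence in time for the first. *)
Lemma ito_integral_pathwise : is_ito_integral P W H t J.
Proof.
have nae (Q : Omega -> Prop) := ae_off_null (Q := Q) N_meas N_null.
exists H_; split.
  apply: (@cvg_in_probability_le _ _ _ _ (fun n w => `|off (err n) w|%:E)).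
    by apply: nae => w nw n; rewrite offE// errE// lee_fin ler_norm.
  apply: (cvg_in_probability_ae (N := N)) => //.
  - by move=> n; apply/measurable_EFinP; apply: measurableT_comp.
  - move=> w nw.
    have m1 n : measurable_fun `[0, t] (simple_value (H_ n) ^~ w).
      exact: measurable_simple_value.
    have := @bounded_convergence_square _ t K (fun n => simple_value (H_ n) ^~ w) (H ^~ w) m1
      (fun n s => @H_bound n s w) (fun s => @H_cvg s w nw); apply: cvg_trans; apply: near_eq_cvg.
    apply: nearW => n; rewrite offE// errE// ger0_norm//.
    by apply: Rintegral_ge0 => s _; exact: sqr_ge0.
apply: (@cvg_in_probability_le _ _ _ _
    (fun n w => `|off (fun w => simple_integral W (H_ n) t w) w - off J w|%:E)).
  by apply: nae => w nw n; rewrite !offE.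
apply: (cvg_in_probability_ae (N := N)) => //.
- move=> n; apply/measurable_EFinP; apply: measurableT_comp => //; apply: measurable_funB.
    by apply: measurable_off; exact: measurable_simple_integral.
  apply: (@measurable_off_cvg (fun n => simple_integral W (H_ n) t)) => // m.
  exact: measurable_simple_integral.
- move=> w nw; apply: cvg_EFin; first exact: nearW.
  have c := J_cvg nw; rewrite /comp /=.
  have c2 : `|simple_integral W (H_ n) t w - J w| @[n --> \oo] --> (0 : R).
    have := cvg_norm (cvgB c (cvg_cst (J w))); rewrite subrr normr0; exact.
  by move: c2; apply: cvg_trans; apply: near_eq_cvg; apply: nearW => n; rewrite /= !offE.
Qed.
End PathwiseIto.

Section ItoLinearity.
Context {d : measure_display} {Omega : measurableType d} {R : realType}.
Variables (P : probability Omega R) (W : R -> Omega -> R).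

Lemma ito_integral_congr (H H' : R -> Omega -> R) (J J' : Omega -> R) (t : R) :
  {ae P, forall w, forall s, 0 <= s <= t -> H s w = H' s w} ->
  {ae P, forall w, J w = J' w} ->
  is_ito_integral P W H t J -> is_ito_integral P W H' t J'.
Proof.
move=> HH JJ [H_ [h1 h2]]; exists H_; split.
  apply: cvg_in_probability_le h1; apply: filterS HH => w HH n.
  rewrite le_eqVlt; apply/orP; left; apply/eqP.
  by apply: eq_integral => s; rewrite inE/= in_itv/= => st; rewrite HH.
by apply: cvg_in_probability_le h2; apply: filterS JJ => w -> n.
Qed.

Lemma ito_integral_add (H1 H2 : R -> Omega -> R) (J1 J2 : Omega -> R) (t : R) :
  {ae P, forall w, measurable_fun `[0, t] (H1 ^~ w)} ->
  {ae P, forall w, measurable_fun `[0, t] (H2 ^~ w)} ->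
  is_ito_integral P W H1 t J1 -> is_ito_integral P W H2 t J2 ->
  is_ito_integral P W (fun s w => H1 s w + H2 s w) t (fun w => J1 w + J2 w).
Proof.
move=> m1 m2 [G1 [v1 i1]] [G2 [v2 i2]].
have [G hG] := choice (fun n => simple_add (G1 n) (G2 n)).
exists G; split.
  (* Each error is taken twice because (A + B)^2 <= 2 A^2 + 2 B^2. *)
  apply: cvg_in_probability_le (cvg_in_probabilityD (cvg_in_probabilityD v1 v1)
    (cvg_in_probabilityD v2 v2)).
  apply: filterS2 m1 m2 => w m1 m2 n.
  have [valE _] := hG n; under eq_integral do rewrite valE.
  have mf1 : measurable_fun `[0, t] (fun s => ((simple_value (G1 n) s w - H1 s w) ^+ 2)%:E).
    apply/measurable_EFinP; apply: measurable_funX; apply: measurable_funB => //.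
    exact: measurable_simple_value.
  have mf2 : measurable_fun `[0, t] (fun s => ((simple_value (G2 n) s w - H2 s w) ^+ 2)%:E).
    apply/measurable_EFinP; apply: measurable_funX; apply: measurable_funB => //.
    exact: measurable_simple_value.
  have ge0 (f : R -> R) s : (0 <= (f s ^+ 2)%:E)%E by rewrite lee_fin sqr_ge0.
  pose f1 s := ((simple_value (G1 n) s w - H1 s w) ^+ 2)%:E.
  pose f2 s := ((simple_value (G2 n) s w - H2 s w) ^+ 2)%:E.
  have f10 s : (0 <= f1 s)%E by rewrite lee_fin sqr_ge0.
  have f20 s : (0 <= f2 s)%E by rewrite lee_fin sqr_ge0.
  rewrite -(ge0_integralD lebesgue_measure _ (fun s _ => f10 s) mf1 (fun s _ => f10 s) mf1)//.
  rewrite -(ge0_integralD lebesgue_measure _ (fun s _ => f20 s) mf2 (fun s _ => f20 s) mf2)//.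
  rewrite -ge0_integralD//; last 4 first.
  - by move=> s _; exact: adde_ge0.
  - exact: emeasurable_funD.
  - by move=> s _; exact: adde_ge0.
  - exact: emeasurable_funD.
  apply: ge0_le_integral => //.
  - apply/measurable_EFinP; apply: measurable_funX; apply: measurable_funB => //.
      by apply: measurable_funD; exact: measurable_simple_value.
    exact: measurable_funD.
  - by apply: emeasurable_funD; exact: emeasurable_funD.
  move=> s _; rewrite /f1 /f2 -!EFinD lee_fin.
  set p := simple_value _ _ _; set q := simple_value _ _ _; set u := H1 _ _; set v := H2 _ _.
  by have := sqr_ge0 ((p - u) - (q - v)); rewrite !expr2; nra.
apply: cvg_in_probability_le (cvg_in_probabilityD i1 i2).
apply: aeW => w n; have [_ ->] := hG n.
rewrite -EFinD lee_fin; apply: le_trans (ler_normD _ _); rewrite le_eqVlt; apply/orP; left.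
by apply/eqP; congr (`|_|); ring.
Qed.
End ItoLinearity.

(** * Continuation of a solution after an exit time *)

Section Solution.
Context {d : measure_display} {Omega : measurableType d} {R : realType}.
Variables (P : probability Omega R) (W : R -> Omega -> R).
Hypothesis W_brownian : brownian_motion P W.
Local Notation history := (history P W).

Variables (x : R -> Omega -> R) (M : R) (mu sigma : R -> R) (K : R).
Hypothesis x_path : forall w, path_continuous (x ^~ w).
Hypothesis x_meas : forall t, 0 <= t -> measurable_fun setT (x t : history t -> R).
Hypothesis K_ge1 : 1 <= K.

Definition bounded_lipschitz (nu : R -> R) : Prop :=
  (forall z, `|nu z| <= K) /\ (forall z z', `|nu z - nu z'| <= K * `|z - z'|).

Hypothesis mu_lip : bounded_lipschitz mu.
Hypothesis sigma_lip : bounded_lipschitz sigma.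

Local Notation a := (glued x M mu).
Local Notation b := (glued x M sigma).
Local Notation exit := (exit_time_of x M).

Variables (N0 : set Omega) (Z : R -> Omega -> R).
Hypothesis N0_meas : measurable N0.
Hypothesis N0_null : P N0 = 0%E.
Hypothesis Z_meas : forall t, 0 <= t -> measurable_fun setT (Z t : history t -> R).
Hypothesis Z_path : forall w, path_continuous (Z ^~ w).
Hypothesis Z_limit : forall w, ~ N0 w -> forall T : nat, exists n0, forall n, (n0 <= n)%N ->
  forall s, 0 <= s <= T%:R -> `|euler_at W a b n s w - Z s w| <= 4 * 2 ^- n.

Definition solution t w := frozen x M t w + Z t w.
Local Notation Y := solution.

Let K_gt0 : 0 < K. Proof. exact: lt_le_trans K_ge1. Qed.

Lemma solution_path w : path_continuous (Y ^~ w).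
Proof. by apply: path_continuousD => //; exact: frozen_path. Qed.

Lemma measurable_solution t : 0 <= t -> measurable_fun setT (Y t : history t -> R).
Proof. by move=> t0; apply: measurable_funD; [exact: measurable_frozen|exact: Z_meas]. Qed.

Lemma half_cvg0 : (2 ^- n : R) @[n --> \oo] --> (0 : R).
Proof.
have -> : (fun n => 2 ^- n) = (fun n => 1 * 2^-1 ^+ n) :> (nat -> R).
  by apply/funext => n; rewrite mul1r exprVn.
by apply: cvg_geometric; rewrite ger0_norm// invf_lt1// ltr1n.
Qed.

(** Locally uniform convergence and continuity of Z allow the time to move with n; this serves for
    left nodes of cells and for the grid times of [grid_stop]. *)
Lemma euler_at_cvg w (s : R) (u : nat -> R) : ~ N0 w -> 0 <= s -> (forall n, 0 <= u n) ->
  u n @[n --> \oo] --> s -> euler_at W a b n (u n) w @[n --> \oo] --> Z s w.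
Proof.
move=> nw s0 u0 us; have cZ := path_continuous_cvg (Z_path w) s0 u0 us.
have [n0 hn0] := Z_limit nw (Num.truncn (s + 1)).+1.
apply/cvgrPdist_lt => e e0; have e8 : 0 < e / 8 by rewrite divr_gt0.
have e2 : 0 < e / 2 by rewrite divr_gt0.
near=> n.
have h1 : `|Z s w - Z (u n) w| < e / 2 by near: n; move/cvgrPdist_lt : cZ; exact.
have h2 : `|0 - 2 ^- n| < e / 8 :> R by near: n; move/cvgrPdist_lt : half_cvg0; exact.
have h3 : `|s - u n| < 1 by near: n; move/cvgrPdist_lt : us; exact.
have n0n : (n0 <= n)%N by near: n; exact: nbhs_infty_ge.
have h4 : `|euler_at W a b n (u n) w - Z (u n) w| <= 4 * 2 ^- n.
  apply: hn0 => //; rewrite u0/=; apply: le_trans (ltW (truncnS_gt (s + 1))).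
  by move: h3; rewrite ltr_norml => /andP[h3 _]; lra.
move: h2; rewrite sub0r normrN gtr0_norm ?invr_gt0 ?exprn_gt0// => h2.
rewrite (_ : _ - _ = (Z s w - Z (u n) w) - (euler_at W a b n (u n) w - Z (u n) w)); last by ring.
apply: (le_lt_trans (ler_normB _ _)); lra.
Unshelve. all: by end_near. Qed.

Lemma Z_before s w : ~ N0 w -> 0 <= s -> (s%:E <= exit w)%E -> Z s w = 0.
Proof.
move=> nw s0 se; have c : euler_at W a b n s w @[n --> \oo] --> Z s w.
  by apply: euler_at_cvg => //; exact: cvg_cst.
rewrite -(cvg_lim _ c)// (_ : (fun n => _) = (fun=> 0)); first by rewrite lim_cst.
by apply/funext => n; apply: glued_euler_before.
Qed.

Lemma solution_before s w : ~ N0 w -> 0 <= s -> (s%:E <= exit w)%E -> Y s w = x s w.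
Proof. by move=> nw s0 se; rewrite /solution Z_before// addr0 frozen_before. Qed.

Lemma a_adm : admissible P W K (exit_clock x M) a.
Proof. by have [h1 h2] := mu_lip; exact: glued_admissible. Qed.

Lemma b_adm : admissible P W K (exit_clock x M) b.
Proof. by have [h1 h2] := sigma_lip; exact: glued_admissible. Qed.

Variable m : R.

Definition exit_solution w := exit_at m (Y ^~ w).

(** The coefficient is that of the n-th scheme, but it is switched off by the exit of the limit Y, a
    time that does not depend on n. *)
Definition stopped_coef (nu : R -> R) n i w : R :=
  glued x M nu (node n i) (euler W a b n i w) w * (~~ exited Y m (node n i) w)%:R.

Definition stopped_integrand (nu : R -> R) s w : R :=
  nu (Y s w) * ((exit w < s%:E)%E && (s%:E <= exit_solution w)%E)%:R.

Lemma stopped_coef_bound nu n i w : bounded_lipschitz nu -> `|stopped_coef nu n i w| <= K.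
Proof.
move=> [bnu _]; rewrite /stopped_coef /glued !normrM.
have b1 (c : bool) : `|c%:R| <= 1 :> R by case: c; rewrite ?normr0 ?normr1.
rewrite -[leRHS]mulr1 ler_pM// ?mulr_ge0//.
by rewrite -[leRHS]mul1r ler_pM.
Qed.

Lemma measurable_stopped_coef nu n i : bounded_lipschitz nu ->
  measurable_fun setT (stopped_coef nu n i : history (node n i) -> R).
Proof.
move=> [h1 h2]; have n0 := node_ge0 (R := R) n i; apply: measurable_funM.
  have adm : admissible P W K (exit_clock x M) (glued x M nu) by exact: glued_admissible.
  apply: (admissible_measurable adm) => //.
  exact: (@measurable_euler _ _ _ P W a b K (exit_clock x M) a_adm b_adm n i).
have -> : (fun w => (~~ exited Y m (node n i) w)%:R : R) =
    (fun w => if exited Y m (node n i) w then 0 else 1).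
  by apply/funext => w; case: exited.
apply: measurable_fun_ifT => //.
by apply: measurable_exited => //; [exact: solution_path|exact: measurable_solution].
Qed.

Lemma euler_at_node n i w : euler_at W a b n (node n i) w = euler W a b n i w.
Proof.
rewrite (@euler_at_cell _ _ _ W a b n i) ?lexx ?node_le ?leqnSn//.
by rewrite !subrr !mulr0 !addr0.
Qed.

(** The step function takes its value at a left node that is strictly before s and tends to s. Such
    nodes eventually see every exit before s and never one at s or later, which matches the
    condition exit < s <= [exit_solution w]. *)
Lemma stopped_step_cvg nu t s w : bounded_lipschitz nu -> ~ N0 w -> 0 <= s <= t ->
  step n t (stopped_coef nu n ^~ w) s @[n --> \oo] --> stopped_integrand nu s w.
Proof.
move=> [bnu lnu] nw /andP[s0 st]; have t0 := le_trans s0 st.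
have ex0 : (0 <= exit w)%E by exact: exit_at_ge0.
have [E|s1] := eqVneq s 0.
  rewrite /stopped_integrand E ltNge ex0/= mulr0.
  by under eq_fun do rewrite step0; exact: cvg_cst.
have {s1} s_gt0 : 0 < s by rewrite lt_neqAle eq_sym s1.
have [i hi] := choice (fun n => @left_cell R n s s_gt0).
pose u n : R := node n (i n).
have u0 n : 0 <= u n by exact: node_ge0.
have us n : u n < s by have /andP[] := hi n.
have ucvg : u n @[n --> \oo] --> s.
  apply/cvgrPdist_lt => e e0; move/cvgrPdist_lt : (@mesh_cvg0 R) => /(_ e e0).
  apply: filterS => n; rewrite sub0r normrN (gtr0_norm (mesh_gt0 n)) => me.
  have /andP[h1 h2] := hi n; rewrite nodeS in h2.
  by rewrite gtr0_norm ?subr_gt0//; rewrite /u; lra.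
have -> : (fun n => step n t (stopped_coef nu n ^~ w) s) =
    (fun n => stopped_coef nu n (i n) w).
  by apply/funext => n; rewrite (step_cell _ t0 st (hi n)).
have after (tau : \bar R) : (tau < s%:E)%E -> (0 <= tau)%E ->
    \forall n \near \oo, (tau <= (u n)%:E)%E.
  case: tau => [tau| |]//; rewrite lte_fin => ts _.
  have ts' : 0 < s - tau by rewrite subr_gt0.
  move/cvgrPdist_lt : ucvg => /(_ _ ts'); apply: filterS => n.
  by rewrite gtr0_norm ?subr_gt0// lee_fin; have := us n; lra.
rewrite /stopped_integrand; have [es|se] := ltP (exit w) s%:E; last first.
  rewrite mulr0; apply: cvg_near_cst; apply: nearW => n.
  rewrite /stopped_coef /glued.
  have -> : exited x M (node n (i n)) w = false; last by rewrite !mul0r.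
  apply/negbTE/negP => /(exitedP _ x_path); rewrite leNgt => /negP; apply.
  by apply: lt_le_trans se; rewrite lte_fin; exact: us.
have ey0 : (0 <= exit_solution w)%E by exact: exit_at_ge0.
have [sR|Rs] := leP s%:E (exit_solution w); last first.
  rewrite mulr0; apply: cvg_near_cst.
  apply: filterS (after _ Rs ey0) => n hn; rewrite /stopped_coef.
  have -> : exited Y m (node n (i n)) w by apply/(exitedP _ solution_path).
  by rewrite mulr0.
rewrite mulr1.
have cY : frozen x M (u n) w + euler_at W a b n (u n) w @[n --> \oo] --> Y s w.
  apply: cvgD; last exact: euler_at_cvg.
  by apply: (@path_continuous_cvg R (frozen x M ^~ w) s u) => //; exact: frozen_path.
apply/cvgrPdist_lt => e e0; have eK : 0 < e / K by rewrite divr_gt0.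
near=> n.
have h1 : `|Y s w - (frozen x M (u n) w + euler_at W a b n (u n) w)| < e / K.
  by near: n; move/cvgrPdist_lt : cY; exact.
have h2 : (exit w <= (u n)%:E)%E by near: n; exact: after.
rewrite /stopped_coef /glued.
have -> : exited x M (node n (i n)) w by apply/(exitedP _ x_path).
have -> : exited Y m (node n (i n)) w = false.
  apply/negbTE/negP => /(exitedP _ solution_path); rewrite leNgt => /negP; apply.
  by apply: lt_le_trans sR; rewrite lte_fin; exact: us.
rewrite mul1r mulr1 -euler_at_node; apply: (le_lt_trans (lnu _ _)).
by rewrite mulrC -ltr_pdivlMr.
Unshelve. all: by end_near. Qed.

Lemma euler_at_incr n i t w : 0 <= t ->
  euler_at W a b n (Num.min (node n i.+1) t) w - euler_at W a b n (Num.min (node n i) t) w =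
  drift W a b n i w * (Num.min (node n i.+1) t - Num.min (node n i) t) +
  diffusion W a b n i w *
    (W (Num.min (node n i.+1) t) w - W (Num.min (node n i) t) w).
Proof.
move=> t0; have [ti|it] := leP t (node n i).
  have ti' : t <= node n i.+1 by rewrite (le_trans ti)// node_le.
  by rewrite !min_r// !subrr !mulr0 addr0.
have le_i : node n i <= node n i.+1 :> R by rewrite node_le.
have c1 : node n i <= Num.min (node n i.+1) t <= node n i.+1.
  by rewrite le_min le_i (ltW it) ge_min lexx.
have c2 : (node n i <= node n i :> R) && (node n i <= node n i.+1 :> R) by rewrite lexx le_i.
rewrite (euler_at_cell _ _ _ w c1) (euler_at_cell _ _ _ w c2); ring.
Qed.

(** Stopping the Euler recursion by [grid_stop] leaves the scheme at th on one side and the drift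
    and Brownian sums on the other; the Brownian sum is isolated. *)
Lemma stopped_euler_sum n t w : 0 <= t -> exists th, [/\ 0 <= th,
  `|th - stop_at (exit_solution w) t| <= mesh n &
  \sum_(i < grid_size n t) stopped_coef sigma n i w *
    (W (Num.min (node n i.+1) t) w - W (Num.min (node n i) t) w) =
  euler_at W a b n th w -
  \int[lebesgue_measure]_(s in `[0, t]) step n t (stopped_coef mu n ^~ w) s].
Proof.
move=> t0; have ey0 : (0 <= exit_solution w)%E by exact: exit_at_ge0.
have [th [th0 tht thm hs]] := grid_stop ey0 t0 (grid_size_gt n t0).
exists th; split=> //; rewrite integral_step//.
have := hs (fun s => euler_at W a b n s w); rewrite euler_at0 subr0 => <-.
rewrite -sumrB; apply: eq_bigr => i _; rewrite euler_at_incr// /stopped_coef.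
have -> : ((node n i)%:E < exit_solution w)%E = ~~ exited Y m (node n i) w.
  by rewrite ltNge; congr (~~ _); apply/idP/idP => /(exitedP _ solution_path).
rewrite /drift /diffusion; ring.
Qed.

Definition stopped_integral n t w : R :=
  \sum_(i < grid_size n t) stopped_coef sigma n i w *
    (W (Num.min (node n i.+1) t) w - W (Num.min (node n i) t) w).

(** The Brownian sum converges because the other terms of the recursion do: the scheme by the
    construction of Z, the drift by bounded convergence. *)
Lemma stopped_integral_cvg t w : 0 <= t -> ~ N0 w ->
  stopped_integral n t w @[n --> \oo] --> Z (stop_at (exit_solution w) t) w -
    \int[lebesgue_measure]_(s in `[0, t]) stopped_integrand mu s w.
Proof.
move=> t0 nw; have ey0 : (0 <= exit_solution w)%E by exact: exit_at_ge0.
have [th hth] := choice (fun n => @stopped_euler_sum n t w t0).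
have -> : (fun n => stopped_integral n t w) = (fun n => euler_at W a b n (th n) w -
    \int[lebesgue_measure]_(s in `[0, t]) step n t (stopped_coef mu n ^~ w) s).
  by apply/funext => n; have [_ _] := hth n.
apply: cvgB; last first.
  apply: (@bounded_convergence _ _ K).
  - by move=> n; exact: measurable_step.
  - by move=> n s st; apply: step_bound => // i; exact: stopped_coef_bound.
  - by move=> s st; exact: stopped_step_cvg.
apply: euler_at_cvg => //; first exact: stop_at_ge0.
  by move=> n; have [] := hth n.
apply/cvgrPdist_lt => e e0; move/cvgrPdist_lt : (@mesh_cvg0 R) => /(_ e e0).
apply: filterS => n; rewrite sub0r normrN (gtr0_norm (mesh_gt0 n)); apply: le_lt_trans.
by rewrite distrC; have [] := hth n.
Qed.

Lemma stopped_coef_history n i (B : set R) : measurable B ->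
  augmented_filtration P W (node n i) (stopped_coef sigma n i @^-1` B).
Proof.
move=> mB; have := @measurable_stopped_coef sigma n i sigma_lip measurableT B mB.
by rewrite setTI.
Qed.

Lemma nodeS_le n i : node n i <= node n i.+1 :> R.
Proof. by rewrite node_le. Qed.

Definition stopped_process n (t : R) : simple_process (augmented_filtration P W) :=
  @SimpleProcess _ _ _ _ (grid_size n t) (node n) (stopped_coef sigma n) (node_ge0 n 0)
    (nodeS_le n) (@stopped_coef_history n)
    (fun i => ex_intro _ K (fun w => stopped_coef_bound n i w sigma_lip)).

(** The value of the integral is read off the limit of the recursion, so this is already the
    equation of Z stopped at the exit of Y. *)
Lemma stopped_ito (t : R) : 0 <= t ->
  is_ito_integral P W (stopped_integrand sigma) t (fun w =>
    Z (stop_at (exit_solution w) t) w -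
    \int[lebesgue_measure]_(s in `[0, t]) stopped_integrand mu s w).
Proof.
move=> t0; apply: (@ito_integral_pathwise _ _ _ P W W_brownian (stopped_process ^~ t) _ _ t K N0 t0
  N0_meas N0_null).
- by move=> n s w st; exact: (@step_bound R n t (stopped_coef sigma n ^~ w) s K st (fun i => stopped_coef_bound n i w sigma_lip)).
- by move=> s w nw st; exact: stopped_step_cvg.
- by move=> w nw; exact: stopped_integral_cvg.
Qed.

End Solution.

(** * Truncated coefficients *)

Section Truncation.
Context {R : realType}.

Definition clip (M z : R) : R := Num.max (- M) (Num.min z M).

Lemma clip_id M z : `|z| <= M -> clip M z = z.
Proof.
by rewrite ler_norml /clip => /andP[h1 h2]; rewrite (min_l h2) (max_r h1).
Qed.

Lemma clip_norm M z : 0 <= M -> `|clip M z| <= M.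
Proof.
move=> M0; rewrite ler_norml /clip le_max lexx/= ge_max ge_min lexx orbT andbT.
by rewrite ge0_cp.
Qed.

Lemma clip_lip M z z' : 0 <= M -> `|clip M z - clip M z'| <= `|z - z'|.
Proof.
move=> M0; wlog zz : z z' / z <= z'.
  by move=> h; have [/h//|/ltW/h] := leP z z'; rewrite (distrC z') (distrC (clip M z')).
have cc : clip M z <= clip M z'.
  by rewrite /clip ge_max !le_max lexx/= le_min !ge_min zz lexx !orbT.
rewrite !ler0_norm ?subr_le0//.
rewrite !opprB /clip.
by case: (leP z M) => h1; case: (leP z' M) => h2; case: (leP (- M) z) => h3;
  case: (leP (- M) z') => h4; case: (leP (- M) M) => h5; lra.
Qed.

(** The truncated function is bounded by K1 * M + |mu 0| and has Lipschitz constant K1. All larger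
    constants are allowed so that drift and diffusion can share one. *)
Lemma locally_lipschitz_clip (mu : R -> R) (M : R) : locally_lipschitz mu -> 0 <= M ->
  exists2 K, 0 <= K & forall K', K <= K' -> bounded_lipschitz K' (mu \o clip M).
Proof.
move=> mu_loc M0; have := mu_loc `[- M, M]%classic (@segment_compact R (- M) M).
move=> [K0 [_ hK]]; pose K1 := `|K0| + 1.
have K10 : 0 <= K1 by rewrite addr_ge0.
have hK1 z z' : `|z| <= M -> `|z'| <= M -> `|mu z - mu z'| <= K1 * `|z - z'|.
  move=> zM zM'; apply: (hK K1 _ (z, z')); first by rewrite (le_lt_trans (ler_norm _))// ltrDl.
  by split; rewrite /= in_itv/= -ler_norml.
exists (K1 * M + K1 + `|mu 0|); first by rewrite !addr_ge0// mulr_ge0.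
move=> K' KK'; have K'1 : K1 <= K'.
  by apply: le_trans KK'; rewrite -addrA addrCA lerDl addr_ge0// mulr_ge0.
split=> [z|z z'] /=.
  have h0 : `|0 : R| <= M by rewrite normr0.
  have := hK1 _ _ (clip_norm z M0) h0; rewrite subr0 => h.
  rewrite -[mu _](subrK (mu 0)); apply: (le_trans (ler_normD _ _)); apply: le_trans KK'.
  apply: lerD => //; apply: (le_trans h); rewrite -[leLHS]addr0; apply: lerD => //.
  by apply: ler_wpM2l => //; exact: clip_norm.
apply: (le_trans (hK1 _ _ (clip_norm z M0) (clip_norm z' M0))).
by apply: ler_pM => //; exact: clip_lip.
Qed.

Lemma bounded_lipschitz_globally K (nu : R -> R) : bounded_lipschitz K nu ->
  globally_lipschitz nu.
Proof.
move=> [_ lnu]; exists K; split; first exact: num_real.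
move=> K' KK' [z z'] _ /=; apply: (le_trans (lnu z z')); apply: ler_wpM2r => //.
exact: ltW.
Qed.

Lemma bounded_lipschitz_measurable K (nu : R -> R) : bounded_lipschitz K nu ->
  measurable_fun setT nu.
Proof.
move=> [bnu lnu]; apply: continuous_measurable_fun => z; apply/cvgrPdist_lt => e e0.
have K0 : 0 <= K by exact: le_trans (bnu 0).
have eK : 0 < e / (K + 1) by rewrite divr_gt0// ltr_wpDl.
near=> z'; apply: (le_lt_trans (lnu z z')).
have h : `|z - z'| < e / (K + 1) by near: z'; exact: cvgr_dist_lt.
apply: (@le_lt_trans _ _ ((K + 1) * `|z - z'|)); first by rewrite ler_wpM2r// lerDl.
by rewrite mulrC -ltr_pdivlMr// ltr_wpDl.
Unshelve. all: by end_near. Qed.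

End Truncation.

(** * Regular versions of solutions *)

Section Regularization.
Context {d : measure_display} {Omega : measurableType d} {R : realType}.
Variables (P : probability Omega R) (W : R -> Omega -> R).
Local Notation history := (history P W).

Record regular_path_process (x0 : R) (x : R -> Omega -> R) : Prop := RegularPathProcess {
  regular_path : forall w, path_continuous (x ^~ w) ;
  regular_measurable : forall t, 0 <= t -> measurable_fun setT (x t : history t -> R) ;
  regular_start : forall w, x 0 w = x0 }.

Lemma within_continuous_fine (X : R -> \bar R) :
  {within `[0, +oo[, continuous X} -> (forall t, 0 <= t -> X t \is a fin_num) ->
  path_continuous (fine \o X).
Proof.
move=> /subspace_continuousP cX fX; apply/path_continuousP/subspace_continuousP => s s0.
have s0' : 0 <= s by move: s0; rewrite /= in_itv/= andbT.
by apply: fine_cvg; rewrite fineK ?fX//; exact: cX.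
Qed.

Lemma within_continuous_EFin (y : R -> R) : path_continuous y ->
  {within `[0, +oo[, continuous (fun t => (y t)%:E)}.
Proof.
move=> /path_continuousP/subspace_continuousP cy; apply/subspace_continuousP => s s0.
by apply: cvg_EFin; [exact: nearW|exact: cy].
Qed.

(** On a null event outside which X starts at x0, is continuous and stays finite, it is replaced by
    the constant x0. The filtration contains the null events, so the process remains adapted. *)
Lemma regular_version x0 mu sigma X : strong_solution P x0 mu sigma W X -> no_explosion P X ->
  exists N x, [/\ measurable N, P N = 0%E, regular_path_process x0 x &
    forall w, ~ N w -> forall t, 0 <= t -> X t w = (x t w)%:E].
Proof.
move=> sol noex.
pose good w := [/\ X 0 w = x0%:E, {within `[0, +oo[, continuous (X ^~ w)} &
  forall t : R, 0 <= t -> X t w \is a fin_num].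
have : {ae P, forall w, good w}.
  by apply: filterS3 (solution_start sol) (solution_continuous sol) noex => w h1 h2 h3; split.
move=> [N [mN PN hN]].
have gN w : ~ N w -> good w by move=> nw; apply: contrapT => /hN.
exists N, (fun t w => if w \in N then x0 else fine (X t w)); split => //.
  split.
  - move=> w; have [wN|wN] := boolP (w \in N).
      by move=> s s0 e e0; exists 1 => // r _ _; rewrite subrr normr0.
    have [_ cX fX] : good w by apply: gN => Nw; rewrite (mem_set Nw) in wN.
    exact: (within_continuous_fine cX fX).
  - move=> t t0; apply: measurable_fun_ifT => //.
      apply: (measurable_fun_bool true); rewrite setTI.
      rewrite (_ : _ @^-1` _ = N); first exact: history_null.
      by apply/seteqP; split => w /= => [/set_mem|/mem_set].
    apply: measurableT_comp => // _ B mB; rewrite setTI.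
    exact: (solution_adapted sol t0 mB).
  - move=> w; case: ifPn => // /negP wN.
    have [->//] : good w by apply: gN => Nw; apply: wN; rewrite inE.
move=> w nw t t0; rewrite memNset// fineK//.
by have [_ _ h] := gN _ nw; exact: h.
Qed.

Lemma exit_timeE (X : R -> Omega -> \bar R) (y : R -> R) m w :
  (forall t, 0 <= t -> X t w = (y t)%:E) -> exit_time X m w = exit_at m%:R y.
Proof.
move=> Xy; rewrite /exit_time /exit_at /first_time; congr ereal_inf; congr image.
by apply/seteqP; split=> t [/= t0]; rewrite ?Xy// lee_fin => h; split; rewrite ?Xy.
Qed.

Definition solves_until (m : R) (x0 : R) (mu sigma : R -> R) (x : R -> Omega -> R) t : Prop :=
  let before_exit s w : R := (s%:E <= exit_at m (x ^~ w))%E%:R in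
  exists2 J : Omega -> R,
    is_ito_integral P W (fun s w => sigma (x s w) * before_exit s w) t J &
    {ae P, forall w, x (stop_at (exit_at m (x ^~ w)) t) w =
      x0 + \int[lebesgue_measure]_(s in `[0%R, t]) (mu (x s w) * before_exit s w) + J w}.

Lemma Rintegral_ext (f g : R -> R) (t : R) : (forall s, 0 <= s <= t -> f s = g s) ->
  \int[lebesgue_measure]_(s in `[0, t]) f s = \int[lebesgue_measure]_(s in `[0, t]) g s.
Proof.
by move=> fg; apply: eq_Rintegral => s; rewrite inE/= in_itv/=; exact: fg.
Qed.

(** Used in both directions: to pass from X to its regular version, and to return to extended reals
    for the continued process. *)
Lemma solves_untilP x0 mu sigma X N x (m : nat) (t : R) : 0 <= t ->
  measurable N -> P N = 0%E -> 
  (forall w, ~ N w -> forall t, 0 <= t -> X t w = (x t w)%:E) ->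
  (let before_exit s w : R := (s%:E <= exit_time X m w)%E%:R in
   exists2 J : Omega -> R,
      is_ito_integral P W
        (fun s w => sigma (fine (X s w)) * before_exit s w) t J &
      {ae P, forall w, stopped (X ^~ w) (exit_time X m w) t =
        (x0 + \int[lebesgue_measure]_(s in `[0%R, t])
                (mu (fine (X s w)) * before_exit s w)
            + J w)%:E}) <-> solves_until m%:R x0 mu sigma x t.
Proof.
move=> t0 mN PN Xx.
have nae (Q : Omega -> Prop) := ae_off_null (Q := Q) mN PN.
have aeE (nu : R -> R) : {ae P, forall w, forall s, 0 <= s <= t ->
    nu (fine (X s w)) * (s%:E <= exit_time X m w)%E%:R =
    nu (x s w) * (s%:E <= exit_at m%:R (x ^~ w))%E%:R}.
  by apply: nae => w /Xx Xw s /andP[s0 _]; rewrite (exit_timeE m Xw) Xw.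
have stE : {ae P, forall w, stopped (X ^~ w) (exit_time X m w) t =
    (x (stop_at (exit_at m%:R (x ^~ w)) t) w)%:E}.
  by apply: nae => w /Xx Xw; rewrite (exit_timeE m Xw) /stopped Xw// stop_at_ge0// exit_at_ge0.
split=> -[J ito eqn]; exists J.
- exact: ito_integral_congr (aeE sigma) (aeW _ (fun=> erefl)) ito.
- apply: filterS3 (aeE mu) stE eqn => w h1 h2; rewrite h2 => -[->].
  by rewrite (Rintegral_ext h1).
- apply: ito_integral_congr (aeW _ (fun=> erefl)) ito.
  by apply: filterS (aeE sigma) => w h s st; rewrite h.
- apply: filterS3 (aeE mu) stE eqn => w h1 h2 h3; rewrite h2 h3.
  by rewrite (Rintegral_ext h1).
Qed.

End Regularization.

Section PathMeasurability.
Context {R : realType}.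

Lemma path_continuous_measurable (y : R -> R) (t : R) : path_continuous y ->
  measurable_fun `[0, t] y.
Proof.
move=> /path_continuousP cy.
have m : measurable_fun (`[0, +oo[%classic : set R) y by exact: subspace_continuous_measurable_fun.
by apply: measurable_funS m => // s; rewrite /= !in_itv/= andbT => /andP[].
Qed.

Lemma measurable_before (tau : \bar R) D :
  measurable_fun D (fun s : R => (s%:E <= tau)%E%:R : R).
Proof.
apply: measurable_funTS.
rewrite (_ : (fun s => _) = \1_([set s : R | (s%:E <= tau)%E])).
  apply: measurable_indic; case: tau => [c| |].
  - by rewrite (_ : [set s : R | (s%:E <= c%:E)%E] = `]-oo, c]%classic)//; apply/seteqP; split=> s; rewrite /= in_itv/= lee_fin.
  - by rewrite (_ : [set s : R | (s%:E <= +oo)%E] = setT)//; apply/seteqP; split=> s //= _; exact: leey.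
  - by rewrite (_ : [set s : R | (s%:E <= -oo)%E] = set0 :> set R); [exact: measurable0|apply/seteqP; split=> s //=].
by apply/funext => s; rewrite indicE; have [h|h] := boolP (_ <= _)%E; [rewrite mem_set|rewrite memNset//; exact/negP].
Qed.

Lemma measurable_after (tau : \bar R) D :
  measurable_fun D (fun s : R => (tau < s%:E)%E%:R : R).
Proof.
rewrite (_ : (fun s => _) = (fun s => 1 - (s%:E <= tau)%E%:R)).
  by apply: measurable_funB => //; exact: measurable_before.
by apply/funext => s; rewrite ltNge; case: (_ <= _)%E; rewrite ?subrr ?subr0.
Qed.

(** At the exit time itself the bound comes from continuity from the left; at time 0, which has no
    left, from the hypothesis on [y 0]. *)
Lemma exit_norm_le (y : R -> R) M s : path_continuous y -> `|y 0| <= M -> 0 <= s ->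
  (s%:E <= exit_at M y)%E -> `|y s| <= M.
Proof.
move=> cy y0 s0 /le_exit_at sM; have [->//|s1] := eqVneq s 0.
have {s1} s_gt0 : 0 < s by rewrite lt_neqAle eq_sym s1.
rewrite leNgt; apply/negP => Mys; have e0 : 0 < `|y s| - M by rewrite subr_gt0.
have [dl dl0 h] := cy s s0 _ e0.
pose r := Num.max 0 (s - dl / 2).
have r0 : 0 <= r by rewrite le_max lexx.
have rs : r < s by rewrite gt_max s_gt0 ltrBlDr ltrDl divr_gt0.
have rd : `|r - s| < dl.
  rewrite ltr0_norm ?subr_lt0// opprB.
  have : s - dl / 2 <= r by rewrite le_max lexx orbT.
  lra.
have := h r r0 rd; have := sM r r0 rs; have := lerB_dist (y s) (y r).
rewrite distrC; lra.
Qed.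

End PathMeasurability.

(** * The solution of the truncated equation *)

Section TruncatedSolution.
Context {d : measure_display} {Omega : measurableType d} {R : realType}.
Variables (P : probability Omega R) (W : R -> Omega -> R).
Hypothesis W_brownian : brownian_motion P W.
Variables (x0 K : R) (M : nat) (mu sigma mu' sigma' : R -> R) (x : R -> Omega -> R).
Hypothesis x_reg : regular_path_process P W x0 x.
Hypothesis x0M : `|x0| <= M%:R.
Hypothesis K_ge1 : 1 <= K.
Hypothesis mu'_lip : bounded_lipschitz K mu'.
Hypothesis sigma'_lip : bounded_lipschitz K sigma'.
Hypothesis mu_agree : forall z, `|z| <= M%:R -> mu' z = mu z.
Hypothesis sigma_agree : forall z, `|z| <= M%:R -> sigma' z = sigma z.
Hypothesis x_solves : forall (m : nat) t, 0 <= t -> solves_until P W m%:R x0 mu sigma x t.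

Variables (N0 : set Omega) (Z : R -> Omega -> R).
Hypothesis N0_meas : measurable N0.
Hypothesis N0_null : P N0 = 0%E.
Hypothesis Z_meas : forall t, 0 <= t -> measurable_fun setT (Z t : history P W t -> R).
Hypothesis Z_path : forall w, path_continuous (Z ^~ w).
Hypothesis Z_limit : forall w, ~ N0 w -> forall T : nat, exists n0, forall n, (n0 <= n)%N ->
  forall s, 0 <= s <= T%:R ->
  `|euler_at W (glued x M%:R mu') (glued x M%:R sigma') n s w - Z s w| <= 4 * 2 ^- n.

Local Notation Y := (solution x M%:R Z).
Local Notation S w := (exit_at M%:R (x ^~ w)).

Let Y_path w : path_continuous (Y ^~ w).
Proof. exact: (solution_path M%:R (regular_path x_reg) Z_path). Qed.

Let Y_before w s : ~ N0 w -> 0 <= s -> (s%:E <= S w)%E -> Y s w = x s w.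
Proof. by move=> nw s0 se; apply: (solution_before (regular_path x_reg) Z_path Z_limit). Qed.

Let x_bound w s : 0 <= s -> (s%:E <= S w)%E -> `|x s w| <= M%:R.
Proof.
apply: (@exit_norm_le _ (x ^~ w) M%:R s (regular_path x_reg w)).
by rewrite (regular_start x_reg).
Qed.

Let nae (Q : Omega -> Prop) : (forall w, ~ N0 w -> Q w) -> {ae P, forall w, Q w}.
Proof. exact: ae_off_null. Qed.

(** Level m is left by x no later than level M, and until then Y = x lies in [-M, M], where the
    coefficients agree: the equation is that of x. *)
Lemma truncated_equation_le (m : nat) t : (m <= M)%N -> 0 <= t ->
  solves_until P W m%:R x0 mu' sigma' Y t.
Proof.
move=> mM t0; have mM' : m%:R <= M%:R :> R by rewrite ler_nat.
have exitE w : ~ N0 w -> exit_at m%:R (Y ^~ w) = exit_at m%:R (x ^~ w).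
  move=> nw; apply: (exit_at_agree _ mM'); first exact: (regular_path x_reg w).
  by move=> s s0; exact: Y_before.
have exit_le w : (exit_at m%:R (x ^~ w) <= S w)%E by exact: exit_at_agree_le.
have coefE (nu nu' : R -> R) w s : (forall z, `|z| <= M%:R -> nu' z = nu z) -> ~ N0 w ->
    0 <= s <= t -> nu (x s w) * (s%:E <= exit_at m%:R (x ^~ w))%E%:R =
    nu' (Y s w) * (s%:E <= exit_at m%:R (Y ^~ w))%E%:R.
  move=> nuE nw /andP[s0 _]; rewrite exitE//.
  have [h|_] := leP s%:E (exit_at m%:R (x ^~ w)); last by rewrite !mulr0.
  have h' := le_trans h (exit_le w).
  by rewrite Y_before// nuE// x_bound.
have [J ito eqn] := x_solves m t0; exists J.
  by apply: ito_integral_congr (aeW _ (fun=> erefl)) ito; apply: nae => w nw s st; exact: coefE.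
have : {ae P, forall w, ~ N0 w} by exact: nae.
apply: filterS2 eqn => w eqn nw; rewrite exitE// Y_before//; first last.
- by apply: le_trans (exit_le w); apply: stop_at_le_tau; exact: exit_at_ge0.
- by apply: stop_at_ge0 => //; exact: exit_at_ge0.
rewrite eqn; congr (_ + _ + _); apply: Rintegral_ext => s st.
by rewrite (coefE mu mu')// exitE.
Qed.

(** The equation splits at S: until S it is that of x at level M, and from S to the exit of Y it is
    that of Z, given by [stopped_ito]. *)
Lemma truncated_equation_gt (m : nat) t : (M <= m)%N -> 0 <= t ->
  solves_until P W m%:R x0 mu' sigma' Y t.
Proof.
move=> Mm t0; have Mm' : M%:R <= m%:R :> R by rewrite ler_nat.
have exit_ge w : ~ N0 w -> (S w <= exit_at m%:R (Y ^~ w))%E.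
  by move=> nw; apply: (exit_at_agree_le Mm') => s s0; exact: Y_before.
pose H nu s w : R := nu (x s w) * (s%:E <= S w)%E%:R.
pose G nu s w := stopped_integrand x M%:R Z m%:R nu s w.
have split_coef (nu nu' : R -> R) w s : (forall z, `|z| <= M%:R -> nu' z = nu z) -> ~ N0 w ->
    0 <= s <= t -> H nu s w + G nu' s w = nu' (Y s w) * (s%:E <= exit_at m%:R (Y ^~ w))%E%:R.
  move=> nuE nw /andP[s0 _]; rewrite /H /G /stopped_integrand /exit_time_of ltNge.
  have [h|_] /= := leP s%:E (S w); last by rewrite mulr0 add0r.
  by rewrite (le_trans h (exit_ge w nw)) Y_before// nuE ?x_bound// mulr0 addr0.
have mH nu nu' w : bounded_lipschitz K nu' -> (forall z, `|z| <= M%:R -> nu' z = nu z) ->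
    measurable_fun `[0, t] (H nu ^~ w).
  move=> lnu nuE; apply: (@eq_measurable_fun _ _ _ _ _ (H nu' ^~ w)).
    move=> s; rewrite inE/= in_itv/= /H => /andP[s0 _].
    by have [h|_] := leP s%:E (S w); rewrite ?mulr0// nuE// x_bound.
  apply: measurable_funM; last exact: measurable_before.
  apply: measurableT_comp; first exact: bounded_lipschitz_measurable lnu.
  by apply: (@path_continuous_measurable _ (x ^~ w)); exact: (regular_path x_reg w).
have mG nu w : bounded_lipschitz K nu -> measurable_fun `[0, t] (G nu ^~ w).
  move=> lnu; rewrite (_ : G nu ^~ w = fun s => nu (Y s w) * ((S w < s%:E)%E%:R *
      (s%:E <= exit_at m%:R (Y ^~ w))%E%:R)); last first.
    by apply/funext => s; rewrite -natrM mulnb.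
  apply: measurable_funM.
    apply: measurableT_comp; first exact: bounded_lipschitz_measurable lnu.
    exact: (@path_continuous_measurable _ (Y ^~ w)).
  by apply: measurable_funM; [exact: measurable_after|exact: measurable_before].
have b1 (c : bool) : `|c%:R| <= 1 :> R by case: c; rewrite ?normr0 ?normr1.
have [J ito eqn] := x_solves M t0.
pose J' w := Z (stop_at (exit_solution x M%:R Z m%:R w) t) w -
  \int[lebesgue_measure]_(s in `[0, t]) G mu' s w.
have ito' : is_ito_integral P W (G sigma') t J'.
  apply: (stopped_ito W_brownian (regular_path x_reg) (regular_measurable x_reg) K_ge1
    mu'_lip sigma'_lip N0_meas N0_null Z_meas Z_path Z_limit) => //.
exists (fun w => J w + J' w).
  apply: ito_integral_congr (aeW _ (fun=> erefl)) (ito_integral_add _ _ ito ito').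
  - by apply: nae => w nw s st; exact: split_coef.
  - by apply: aeW => w; exact: mH sigma'_lip sigma_agree.
  - by apply: aeW => w; exact: mG.
have : {ae P, forall w, ~ N0 w} by exact: nae.
apply: filterS2 eqn => w eqn nw.
set r := stop_at _ t.
have rS : stop_at (S w) r = stop_at (S w) t.
  rewrite /r; have := exit_ge w nw; have := exit_at_ge0 M%:R (x ^~ w).
  move: (S w) (exit_at m%:R (Y ^~ w)) => a b a0 ab.
  have b0 := le_trans a0 ab.
  apply: EFin_inj; rewrite !stop_atE//. 
  by rewrite -minA (min_r ab).
rewrite {1}/solution /frozen /exit_time_of rS eqn.
have -> : \int[lebesgue_measure]_(s in `[0, t]) (mu' (Y s w) * (s%:E <= exit_at m%:R (Y ^~ w))%E%:R) =
    \int[lebesgue_measure]_(s in `[0, t]) H mu s w + \int[lebesgue_measure]_(s in `[0, t]) G mu' s w.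
  rewrite -RintegralD//; first by apply: Rintegral_ext => s st; rewrite -(split_coef mu mu').
    apply: (@bounded_integrable _ _ t K); first exact: mH mu'_lip mu_agree.
    move=> s /andP[s0 _]; rewrite /H; have [h|_] := leP s%:E (S w); last first.
      by rewrite mulr0 normr0 (le_trans _ K_ge1).
    by rewrite mulr1 -mu_agree ?x_bound//; case: mu'_lip.
  apply: (@bounded_integrable _ _ t K); first exact: mG.
  move=> s _; rewrite /G /stopped_integrand normrM -[leRHS]mulr1.
  by apply: ler_pM => //; case: mu'_lip.
rewrite /J' /H /exit_solution -/r; ring.
Qed.

Lemma truncated_solution : strong_solution P x0 mu' sigma' W (fun t w => (Y t w)%:E).
Proof.
split.
- move=> t t0 B mB.
  have mY : measurable_fun setT ((fun w => (Y t w)%:E) : history P W t -> \bar R).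
    apply/measurable_EFinP; exact: (measurable_solution M%:R (regular_path x_reg) (regular_measurable x_reg) Z_meas).
  by have := mY measurableT _ mB; rewrite setTI.
- apply: nae => w nw; rewrite Y_before ?(regular_start x_reg)//; exact: exit_at_ge0.
- by apply: aeW => w; exact: within_continuous_EFin.
- by apply: aeW.
- move=> m t t0.
  have [_ h] := @solves_untilP _ _ _ P W x0 mu' sigma' (fun t w => (Y t w)%:E) set0 Y m t t0
    measurable0 (measure0 P) (fun _ _ _ _ => erefl).
  by apply: h; have [mM|/ltnW Mm] := leqP m M;
    [exact: truncated_equation_le|exact: truncated_equation_gt].
Qed.

End TruncatedSolution.

(** * Localization *)

Section Confinement.
Context {d : measure_display} {Omega : measurableType d} {R : realType}.
Variables (P : probability Omega R) (W : R -> Omega -> R).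
Hypothesis W_brownian : brownian_motion P W.

(** The events decrease to the empty set as k grows, a continuous path being bounded on [0, T]. *)
Lemma hit_probability_small (x : R -> Omega -> R) (T e c : R) : 0 <= T -> 0 < e ->
  (forall w, path_continuous (x ^~ w)) ->
  (forall t, 0 <= t -> measurable_fun setT (x t : history P W t -> R)) ->
  exists k : nat, [/\ c <= k%:R, measurable [set w | hit k%:R (x ^~ w) T] &
    (P [set w | hit k%:R (x ^~ w) T] <= e%:E)%E].
Proof.
move=> T0 e0 x_path x_meas; pose A (k : nat) := [set w | hit k%:R (x ^~ w) T].
have mA k : measurable (A k).
  by apply: (history_measurable W_brownian (t := T)); exact: measurable_hit.
have A_dec : nonincreasing_seq A.
  apply/nonincreasing_seqP => k; apply/subsetPset => w [s [sT ks]]; exists s; split => //.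
  by apply: le_trans ks; rewrite ler_nat.
have A_cap : \bigcap_k A k = set0.
  rewrite -subset0 => w Aw; have [s sT smax] := path_norm_max (x_path w) T0.
  have [r [rT]] := Aw (Num.truncn `|x s w|).+1 I; rewrite leNgt => /negP; apply.
  exact: le_lt_trans (smax r rT) (truncnS_gt _).
have cA : P (A k) @[k --> \oo] --> 0%E.
  rewrite -(measure0 P) -A_cap; apply: nonincreasing_cvg_mu => //.
    by rewrite (le_lt_trans (probability_le1 P (mA 0)))// ltry.
  by rewrite A_cap.
have [k0 hk0] := (cvge0P (fun k => measure_ge0 P (A k))).1 cA e e0.
exists (maxn k0 (Num.truncn c).+1); split => //.
  by rewrite (le_trans (ltW (truncnS_gt c)))// ler_nat leq_maxr.
  exact: mA.
exact: (hk0 _ (leq_maxl _ _)).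
Qed.

Lemma powR_unbounded (alpha c : R) : 0 < alpha ->
  exists n0 : nat, forall n : nat, (n0 <= n)%N -> (0 < n)%N /\ c <= n%:R `^ alpha.
Proof.
move=> a0; exists (Num.truncn (`|c| `^ alpha^-1)).+1 => n n0n.
split; first exact: leq_trans n0n.
apply: (le_trans (ler_norm c)).
have -> : `|c| = (`|c| `^ alpha^-1) `^ alpha by rewrite -powRrM mulVf ?gt_eqF// powRr1.
apply: ge0_ler_powR; rewrite ?nnegrE ?powR_ge0//; first exact: ltW.
by apply: (le_trans (ltW (truncnS_gt _))); rewrite ler_nat.
Qed.

Lemma passage_time_pinfty (T : R) (Z : R -> Omega -> R) m w :
  (forall t, 0 <= t <= T -> `|Z t w| <= m%:R) -> passage_time T Z m w = +oo%E.
Proof.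
move=> Zm; rewrite /passage_time /first_time.
rewrite (_ : [set t%:E | t in _] = set0) ?ereal_inf0//.
rewrite -subset0 => _ [t [/= tT h] _].
by move: h; rewrite ltNge Zm//; move: tT; rewrite in_itv.
Qed.

End Confinement.

Theorem theorem2p1 (d : measure_display) (Omega : measurableType d)
    (R : realType) (P : probability Omega R) (W : R -> Omega -> R)
    (T x0 alpha : R) (phi : numerical_scheme Omega R)
    (W_brownian : brownian_motion P W) (T_gt0 : 0 < T) (alpha_gt0 : 0 < alpha)
    (phi_well_defined : well_defined P T W phi)
    (phi_local : local_scheme P T W phi)
    (phi_cvg_lipschitz : forall (mu sigma : R -> R) (X : R -> Omega -> \bar R),
       globally_lipschitz mu -> globally_lipschitz sigma ->
       strong_solution P x0 mu sigma W X ->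
       cvg_with_order P T alpha (phi x0 mu sigma W) X) :
  forall (mu sigma : R -> R) (X : R -> Omega -> \bar R),
    locally_lipschitz mu -> locally_lipschitz sigma ->
    strong_solution P x0 mu sigma W X -> no_explosion P X ->
    cvg_with_order P T alpha (phi x0 mu sigma W) X.
Proof.
move=> mu sigma X mu_loc sigma_loc X_sol X_noex.
have [N [x [mN PN x_reg Xx]]] := regular_version X_sol X_noex.
have x_solves (m : nat) t : 0 <= t -> solves_until P W m%:R x0 mu sigma x t.
  move=> t0; have [h _] := @solves_untilP _ _ _ P W x0 mu sigma X N x m t t0 mN PN Xx.
  exact/h/(solution_equation X_sol).
apply/cvg_in_probabilityP => C e C0 e0; have e2 : 0 < e / 2 by rewrite divr_gt0.
have [k [x0k mA PA]] := hit_probability_small W_brownian `|x0| (ltW T_gt0) e2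
  (regular_path x_reg) (regular_measurable x_reg).
pose M := k.+1; have M0 : 0 <= M%:R :> R by [].
have kM : k%:R < M%:R :> R by rewrite ltr_nat.
have x0M : `|x0| < M%:R by exact: le_lt_trans kM.
have [K1 K10 mu_lip] := locally_lipschitz_clip mu_loc M0.
have [K2 K20 sigma_lip] := locally_lipschitz_clip sigma_loc M0.
pose K := 1 + K1 + K2; have K_ge1 : 1 <= K by rewrite /K -addrA lerDl addr_ge0.
pose mu' := mu \o clip M%:R; pose sigma' := sigma \o clip M%:R.
have mu'_lip : bounded_lipschitz K mu' by apply: mu_lip; rewrite /K; lra.
have sigma'_lip : bounded_lipschitz K sigma' by apply: sigma_lip; rewrite /K; lra.
have mu_agree z : `|z| <= M%:R -> mu' z = mu z by move=> zM; rewrite /mu' /= clip_id.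
have sigma_agree z : `|z| <= M%:R -> sigma' z = sigma z by move=> zM; rewrite /sigma' /= clip_id.
have x_path := regular_path x_reg; have x_meas := regular_measurable x_reg.
have [N0 [Z [mN0 PN0 W_path Z_meas [Z_path Z_limit]]]] :=
  euler_limit W_brownian (exit_clockP M%:R x_path x_meas) K_ge1
    (a_adm M%:R x_path x_meas K_ge1 mu'_lip) (b_adm M%:R x_path x_meas K_ge1 sigma'_lip).
pose Y := solution x M%:R Z.
have Y_sol : strong_solution P x0 mu' sigma' W (fun t w => (Y t w)%:E).
  exact: (truncated_solution W_brownian x_reg (ltW x0M) K_ge1 mu'_lip sigma'_lip mu_agree
    sigma_agree x_solves mN0 PN0 Z_meas Z_path Z_limit).
have mu'_glob := bounded_lipschitz_globally mu'_lip.
have sigma'_glob := bounded_lipschitz_globally sigma'_lip.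
have /cvg_in_probabilityP/(_ C (e / 2) C0 e2)[n1 hn1] := phi_cvg_lipschitz _ _ _ mu'_glob sigma'_glob Y_sol.
(* Once n^alpha >= 2 C, an error whose product with n^alpha is at most C is at most 1 / 2. *)
have [n2 hn2] := powR_unbounded (2 * C) alpha_gt0.
exists (maxn n1 n2) => n; rewrite geq_max => /andP[/hn1 hn /hn2[n_gt0 npow]].
have considered' : considered P W x0 mu' sigma' by left.
have considered_mu : considered P W x0 mu sigma by right; split => //; exists X.
(* The truncated coefficients come first, so that the passage time in the locality property is that
   of the truncated scheme, the one that convergence controls. *)
have phi_agree := phi_local x0 mu' sigma' mu sigma M considered' considered_mu x0M.
have {}phi_agree := phi_agree _ _ n n_gt0.
pose L := [set w | ~ (forall t : R, 0 <= t <= T ->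
  stopped (phi x0 mu' sigma' W n ^~ w) (passage_time T (phi x0 mu' sigma' W n) M w) t =
  stopped (phi x0 mu sigma W n ^~ w) (passage_time T (phi x0 mu' sigma' W n) M w) t)].
have L_null : P.-negligible L.
  by apply: phi_agree => z; rewrite in_itv/= -ler_norml => zM;
    [exact: mu_agree|exact: sigma_agree].
pose bad := N `|` N0 `|` L.
have bad0 : (P^*)%mu bad = 0%E.
  apply: outer_probability_null; apply: negligibleU => //.
  by apply: negligibleU; [exists N|exists N0]; split.
pose A := [set w | hit k%:R (x ^~ w) T].
pose B := [set w | (C%:E < (n%:R `^ alpha)%:E *
  ereal_sup [set `|(phi x0 mu' sigma' W n t w)%:E - (Y t w)%:E| | t in `[0%R, T]])%E].
have PAB : ((P^*)%mu (bad `|` (A `|` B)) <= e%:E)%E.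
  apply: (le_trans (outer_probabilityU _ _ _)); rewrite bad0 add0e.
  apply: (le_trans (outer_probabilityU _ _ _)); rewrite (splitr e) EFinD.
  by apply: leeD => //; rewrite measurable_mu_extE.
apply: le_trans PAB; apply: le_mu_ext => w /=.
(* Outside the exceptional events the two suprema are equal, so the bound C for the truncated
   problem is the bound for the original one. *)
apply: contraPP => /not_orP[nbad /not_orP[nA nB]].
have [nw n0w nL] : [/\ ~ N w, ~ N0 w & ~ L w].
  by split=> h; apply: nbad; [left; left|left; right|right].
have npos : 0 < n%:R `^ alpha by rewrite powR_gt0// ltr0n.
have x_small t : 0 <= t <= T -> `|x t w| < k%:R.
  by move=> tT; rewrite ltNge; apply/negP => h; apply: nA; exists t.
have Yx t : 0 <= t <= T -> Y t w = x t w.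
  move=> /andP[t0 tT]; apply: (solution_before x_path Z_path Z_limit) => //.
  apply/le_exit_at => r r0 rt; apply: lt_trans kM; apply: x_small.
  by rewrite r0 (le_trans (ltW rt)).
have Yn_small t : 0 <= t <= T -> `|phi x0 mu' sigma' W n t w| <= M%:R.
  move=> tT; have : (n%:R `^ alpha * `|phi x0 mu' sigma' W n t w - Y t w| <= C).
    move/negP : nB; rewrite -leNgt -lee_fin EFinM; apply: le_trans.
    apply: lee_wpmul2l; first by rewrite lee_fin ltW.
    by apply: ereal_sup_ubound; exists t => //; rewrite /= in_itv.
  rewrite Yx// => h.
  have h2 : `|phi x0 mu' sigma' W n t w - x t w| <= 1 / 2.
    rewrite -(ler_pM2l npos); apply: (le_trans h); rewrite mulrA mulr1 ler_pdivlMr//; lra.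
  have := lerB_dist (phi x0 mu' sigma' W n t w) (x t w); have := x_small t tT.
  rewrite /M -natr1; lra.
have Xn_eq t : 0 <= t <= T -> phi x0 mu sigma W n t w = phi x0 mu' sigma' W n t w.
  move=> tT; have /notP/(_ t tT) := nL; rewrite (passage_time_pinfty Yn_small).
  by rewrite /stopped min_l ?leey.
apply/negP; rewrite -leNgt; move/negP : nB; rewrite -leNgt; apply: le_trans.
rewrite le_eqVlt; apply/orP; left; apply/eqP; congr (_ * ereal_sup _)%E.
apply: eq_imagel => t; rewrite /= in_itv/= => tT; have /andP[t0 _] := tT.
by rewrite Xn_eq// Xx// Yx.
Qed.
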